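(* There is an ascending function $B$ from dimension sequences $\delta = (\delta_1,\ldots,\delta_d)$ to $\mathbb{Z}_+$ with the following property: if $K$ is an algebraically closed field, $R$ is a polynomial ring over $K$ (in any number of variables), and $V$ is a finite-dimensional $\mathbb{Z}_+$-graded $K$-vector subspace of $R$ with dimension sequence $\delta$, then $V$ (and hence the $K$-subalgebra of $R$ generated by $V$) is contained in a $K$-subalgebra $K[G_1,\ldots,G_s]$ of $R$ generated by a regular sequence $G_1,\ldots,G_s$ of forms of degree at most $d$ with $s \leq B(\delta)$. Moreover, for every $\eta \geq 1$ there is such a function ${}^\eta\!B$ with the additional property that every sequence of $K$-linearly independent homogeneous $K$-linear combinations of $G_1,\ldots,G_s$ is an $\mathrm{R}_\eta$-sequence in $R$.
   Context: A finite-dimensional graded $K$-subspace $V$ of $R$ spanned by forms of positive degree at most $d$ is written $V = V_1\oplus\cdots\oplus V_d$ with $V_i$ its degree-$i$ part; its dimension sequence is $(\delta_1,\ldots,\delta_d)$ with $\delta_i = \dim_K V_i$ (sequences differing by trailing zeros are identified). A sequence of elements generating a proper ideal of a Noetherian ring $S$ is an $\mathrm{R}_\eta$-sequence if the quotient of $S$ by the ideal generated by any initial segment satisfies Serre's condition $\mathrm{R}_\eta$. A function from $\mathbb{N}^h$ to $\mathbb{Z}$ is ascending if it is nondecreasing in each argument when the others are fixed. *)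

(* Defs.v *)
From HB Require Import structures.
From mathcomp Require Import all_boot all_order all_algebra.
Set Implicit Arguments. Unset Strict Implicit. Unset Printing Implicit Defensive.
Import Order.TTheory GRing.Theory Num.Theory.
Local Open Scope ring_scope.

Fixpoint mpoly (K : idomainType) (n : nat) : idomainType :=
  match n with
  | 0 => K
  | n'.+1 => {poly (mpoly K n')}
  end.

Fixpoint mconst (K : idomainType) (n : nat) : K -> mpoly K n :=
  match n return K -> mpoly K n with
  | 0 => fun c => c
  | n'.+1 => fun c => (mconst n' c)%:P
  end.

(* [mhomog i p] : p is a form (homogeneous polynomial) of total degree i
   (every variable has degree 1); the zero polynomial is a form of every degree *)
Fixpoint mhomog (K : idomainType) (n : nat) : nat -> mpoly K n -> bool :=
  match n return nat -> mpoly K n -> bool with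
  | 0 => fun i c => (i == 0%N) || (c == 0)
  | n'.+1 => fun i p =>
      [forall j : 'I_(size p),
         if (j <= i)%N then mhomog (i - j)%N p`_j else p`_j == 0]
  end.

Definition klincomb (K : idomainType) (n : nat) (cs : seq K) (fs : seq (mpoly K n))
  : mpoly K n := \sum_(i < size fs) mconst n cs`_i * fs`_i.

Definition klinindep (K : idomainType) (n : nat) (fs : seq (mpoly K n)) : Prop :=
  forall cs : seq K, size cs = size fs -> klincomb cs fs = 0 ->
    forall i, (i < size fs)%N -> cs`_i = 0.

Inductive in_kalg (K : idomainType) (n : nat) (gs : seq (mpoly K n)) : mpoly K n -> Prop :=
  | kalg_const c : in_kalg gs (mconst n c)
  | kalg_gen g : g \in gs -> in_kalg gs g
  | kalg_add f h : in_kalg gs f -> in_kalg gs h -> in_kalg gs (f + h)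
  | kalg_mul f h : in_kalg gs f -> in_kalg gs h -> in_kalg gs (f * h).

Section CommAlg.
Variable R : comNzRingType.

Definition in_ideal (gs : seq R) (x : R) : Prop :=
  exists rs : seq R, size rs = size gs /\ x = \sum_(i < size gs) rs`_i * gs`_i.

Definition regular_seq (gs : seq R) : Prop :=
  ~ in_ideal gs 1 /\
  forall i, (i < size gs)%N -> forall x,
    in_ideal (take i gs) (x * gs`_i) -> in_ideal (take i gs) x.

Definition is_ideal (I : R -> Prop) : Prop :=
  I 0 /\ (forall x y, I x -> I y -> I (x + y)) /\ (forall r x, I x -> I (r * x)).

Definition is_prime (P : R -> Prop) : Prop :=
  is_ideal P /\ ~ P 1 /\ forall x y, P (x * y) -> P x \/ P y.

(* a chain Q_0 < Q_1 < ... < Q_h = P of primes of R all containing J,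
   i.e. a chain of primes of length h in R/J ending at P/J *)
Definition prime_chain (J P : R -> Prop) (h : nat) : Prop :=
  exists Q : nat -> R -> Prop,
    (forall i, (i <= h)%N -> is_prime (Q i)) /\
    (forall x, J x -> Q 0%N x) /\
    (forall i, (i < h)%N ->
        (forall x, Q i x -> Q i.+1 x) /\ exists x, Q i.+1 x /\ ~ Q i x) /\
    (forall x, Q h x <-> P x).

(* height of P/J in R/J equals h, i.e. dim (R/J)_P = h *)
Definition height_eq (J P : R -> Prop) (h : nat) : Prop :=
  prime_chain J P h /\ ~ prime_chain J P h.+1.

(* the elements as (all in P) generate the maximal ideal of the local ring (R/J)_P:
   every x in P satisfies u*x in J + (as) for some u outside P *)
Definition loc_generates (J P : R -> Prop) (as_ : seq R) : Prop :=
  (forall a, a \in as_ -> P a) /\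
  forall x, P x -> exists u, ~ P u /\
    exists j rs, J j /\ size rs = size as_ /\
      u * x = j + \sum_(i < size as_) rs`_i * as_`_i.

(* Serre's condition R_eta for R/J: for every prime P/J of R/J with
   dim (R/J)_P <= eta, the local ring (R/J)_P is regular, i.e. its maximal
   ideal can be generated by dim (R/J)_P elements *)
Definition serre_R (eta : nat) (J : R -> Prop) : Prop :=
  forall P, is_prime P -> (forall x, J x -> P x) ->
    forall h, (h <= eta)%N -> height_eq J P h ->
      exists as_ : seq R, size as_ = h /\ loc_generates J P as_.

Definition Reta_seq (eta : nat) (fs : seq R) : Prop :=
  ~ in_ideal fs 1 /\
  forall k, (k <= size fs)%N -> serre_R eta (in_ideal (take k fs)).

End CommAlg.

Definition ascending (B : seq nat -> nat) : Prop :=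
  forall (delta : seq nat) (i m : nat), (i < size delta)%N ->
    (nth 0%N delta i <= m)%N -> (B delta <= B (set_nth 0%N delta i m))%N.

(* well defined on dimension sequences (identified up to trailing zeros) *)
Definition trailing_zero_invariant (B : seq nat -> nat) : Prop :=
  forall delta : seq nat, B (rcons delta 0%N) = B delta.

Definition theoremB_property (B : seq nat -> nat) (eta : option nat) : Prop :=
  forall (K : closedFieldType) (n : nat) (delta : seq nat)
         (bas : 'I_(size delta) -> seq (mpoly K n)),
    (* V = (+)_{i=1..d} V_i, d = size delta, with bas i a K-basis of V_{i+1} *)
    (forall i, size (bas i) = nth 0%N delta i) ->
    (forall i f, f \in bas i -> mhomog i.+1 f) ->
    (forall i, klinindep (bas i)) ->
    exists gs : seq (mpoly K n),
      [/\ (forall g, g \in gs -> exists e, (e <= size delta)%N /\ mhomog e g),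
          regular_seq gs,
          (size gs <= B delta)%N,
          (forall i f, f \in bas i -> in_kalg gs f) &
          match eta with
          | None => True
          | Some e =>
              forall fs : seq (mpoly K n),
                (forall f, f \in fs ->
                   (exists cs : seq K, size cs = size gs /\ f = klincomb cs gs) /\
                   (exists k, mhomog k f)) ->
                klinindep fs ->
                Reta_seq e fs
          end].

(* Main.v *)
Require Import Defs.
From Stdlib Require Import ClassicalEpsilon FunctionalExtensionality PropExtensionality.
From HB Require Import structures.
From mathcomp Require Import all_boot all_algebra fingroup perm.
From mathcomp.multinomials Require Import mpoly.
From mathcomp Require Import ring zify.
Set Implicit Arguments. Unset Strict Implicit. Unset Printing Implicit Defensive.
Import GRing.Theory.
Local Open Scope ring_scope.

(* A form is weak if it is a sum of few products of forms of smaller degree, and a system of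
   forms is strong if no nontrivial homogeneous combination is weak.  Any system can be
   replaced by a strong one, of bounded size, whose algebra contains it: as long as some
   combination is weak, replace a form involved in it by the factors; the multiset of
   degrees decreases.  So it suffices that a sufficiently strong system is regular, with
   singular locus of large codimension.

   The key is [star]: a form whose partial derivatives lie in an ideal generated by few
   forms of smaller degree is weak.  It gives the separable, hence algebraic, independence
   of strong systems.  Restricting the forms [f_1, .., f_r] to the span of [r] generic
   vectors, the coefficients of the restrictions lie in a polynomial ring generated by a
   strong system, in which each restriction is linear in a fresh variable; the restricted
   sequence is therefore regular, and so is [f_1, .., f_r].  Applying this to the [f_j]
   together with their derivatives in generic directions, and specialising the directions,
   yields Jacobian minors that extend [f_1, .., f_r] to a regular sequence of any prescribed
   length, whence Serre's condition.  [star] in degree [d] is Euler's formula, except when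
   the characteristic divides [d]; then it follows from the Jacobian minors in degrees
   below [d]. *)

(** All bounds must be uniform in the field and in the number of variables. Thresholds are therefore
    chosen before [K] and [n], and Noetherian arguments only produce primes or good points inside
    one ring. The strength demanded of a refined system is a function of its size, because that size
    is known only when the refinement stops. When forms are restricted to generic vectors, only the
    coefficients of pure powers, which are the values of the forms at those vectors, inherit
    strength. The mixed coefficients may well be weak and have to be replaced. The forms are ordered
    by degree so that the replacements of the coefficients of one form never involve the pure
    coefficients of that form or of later ones; this is why a fresh variable remains. Regular
    sequences have to be compared in three settings: in a ring, in its localization at a prime, and
    after inverting nonzero constants. All three are handled inside the original ring by saturating
    ideals with respect to a multiplicative set. *)

Lemma predext (T : Type) (P Q : T -> Prop) : (forall x, P x <-> Q x) -> P = Q.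
Proof.
move=> h; apply: functional_extensionality => x.
exact: propositional_extensionality.
Qed.

(** * Ideals and regular sequences up to a multiplicative set *)

Section Ideals.
Variable R : comNzRingType.
Implicit Types (I J : R -> Prop) (a b x y z : R) (s : seq R).

Definition zeroid : R -> Prop := fun x => x = 0.

Definition isum I a : R -> Prop := fun x => exists r, I (x - r * a).

Definition idadd I s := foldl isum I s.

Lemma zeroid_ideal : is_ideal zeroid.
Proof.
split=> //; split=> [x y -> ->|r x ->]; by rewrite /zeroid ?addr0 ?mulr0.
Qed.

Section OneIdeal.
Variables (I : R -> Prop) (idI : is_ideal I).

Lemma ideal0 : I 0. Proof. by case: idI. Qed.
Lemma idealD x y : I x -> I y -> I (x + y).
Proof. by case: idI => _ [h _]; apply: h. Qed.
Lemma idealM r x : I x -> I (r * x).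
Proof. by case: idI => _ [_ h]; apply: h. Qed.
Lemma idealMr r x : I x -> I (x * r).
Proof. by rewrite mulrC; apply: idealM. Qed.
Lemma idealN x : I x -> I (- x).
Proof. by rewrite -mulN1r; apply: idealM. Qed.
Lemma idealB x y : I x -> I y -> I (x - y).
Proof. by move=> hx hy; apply: idealD => //; apply: idealN. Qed.
Lemma ideal_sum (J : Type) (r : seq J) (P : pred J) (F : J -> R) :
  (forall j, P j -> I (F j)) -> I (\sum_(j <- r | P j) F j).
Proof. by move=> h; apply: (big_ind I) => //; [exact: ideal0 | exact: idealD]. Qed.
Lemma idealDl x y : I x -> (I (x + y) <-> I y).
Proof.
move=> hx; split=> h; last exact: idealD.
by rewrite -[y](addKr x); apply: idealD => //; apply: idealN.
Qed.

Lemma isum_ideal a : is_ideal (isum I a).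
Proof.
split; first by exists 0; rewrite mul0r subr0; exact: ideal0.
split=> [x y [r hr] [t ht]|c x [r hr]].
  exists (r + t); have -> : x + y - (r + t) * a = (x - r * a) + (y - t * a) by ring.
  exact: idealD.
exists (c * r); have -> : c * x - c * r * a = c * (x - r * a) by ring.
exact: idealM.
Qed.

Lemma isum_sub a x : I x -> isum I a x.
Proof. by move=> h; exists 0; rewrite mul0r subr0. Qed.

Lemma isum_gen a : isum I a a.
Proof. by exists 1; rewrite mul1r subrr; exact: ideal0. Qed.

Lemma isum_eq a a' : I (a - a') -> isum I a = isum I a'.
Proof.
move=> h; apply: predext => x; split=> -[r hr]; exists r.
  have -> : x - r * a' = (x - r * a) + r * (a - a') by ring.
  by apply: idealD => //; apply: idealM.
have -> : x - r * a = (x - r * a') - r * (a - a') by ring.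
by apply: idealB => //; apply: idealM.
Qed.

Lemma isum_in a : I a -> isum I a = I.
Proof.
move=> h; apply: predext => x; split; last exact: isum_sub.
by case=> r hr; rewrite -(subrK (r * a) x); apply: idealD => //; apply: idealM.
Qed.

End OneIdeal.

Lemma isum_mono I J a x : (forall y, I y -> J y) -> isum I a x -> isum J a x.
Proof. by move=> h [r hr]; exists r; apply: h. Qed.

Lemma isumC I a b : isum (isum I a) b = isum (isum I b) a.
Proof.
by apply: predext => x; split=> -[r [t h]]; exists t; exists r;
  congr I: h; ring.
Qed.

Lemma idadd_ideal I s : is_ideal I -> is_ideal (idadd I s).
Proof. by elim: s I => //= a s IH I h; apply: IH; apply: isum_ideal. Qed.

Lemma idadd_sub I s x : is_ideal I -> I x -> idadd I s x.
Proof.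
elim: s I => //= a s IH I h hx; apply: IH; first exact: isum_ideal.
exact: isum_sub.
Qed.

Lemma idadd_isum I s a : idadd (isum I a) s = isum (idadd I s) a.
Proof. by elim: s I => //= b s IH I; rewrite isumC IH. Qed.

Lemma idadd_rcons I s a : idadd I (rcons s a) = isum (idadd I s) a.
Proof. by rewrite /idadd foldl_rcons. Qed.

Lemma idadd_cat I s t : idadd I (s ++ t) = idadd (idadd I s) t.
Proof. by rewrite /idadd foldl_cat. Qed.

Lemma idadd_gen I s a : is_ideal I -> a \in s -> idadd I s a.
Proof.
elim: s I => //= b s IH I hI; rewrite inE => /orP[/eqP->|h].
  by apply: idadd_sub; [exact: isum_ideal | exact: isum_gen].
by apply: IH => //; apply: isum_ideal.
Qed.

Lemma idadd_min I J s : is_ideal J -> (forall x, I x -> J x) ->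
  (forall a, a \in s -> J a) -> forall x, idadd I s x -> J x.
Proof.
move=> hJ; elim: s I => //= a s IH I hI hs; apply: IH.
  move=> x [r hr]; rewrite -(subrK (r * a) x); apply: idealD => //.
    exact: hI.
  by apply: idealM => //; apply: hs; rewrite inE eqxx.
by move=> b hb; apply: hs; rewrite inE hb orbT.
Qed.

Lemma idadd_mono I J s : (forall x, I x -> J x) -> forall x, idadd I s x -> idadd J s x.
Proof.
elim: s I J => //= a s IH I J h; apply: IH => x; exact: isum_mono.
Qed.

Lemma in_idealE s x : in_ideal s x <-> idadd zeroid s x.
Proof.
elim/last_ind: s x => [|s a IH] x.
  split=> [[rs [_ ->]]|h]; first by rewrite big_ord0.
  by exists [::]; rewrite big_ord0; split.
rewrite idadd_rcons; split.
  case=> rs; rewrite size_rcons; case/lastP: rs => [[]//|rs r].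
  rewrite size_rcons => -[[hs] ->]; rewrite big_ord_recr /=; exists r.
  rewrite !nth_rcons hs ltnn eqxx addrK; apply/IH; exists rs; split=> //.
  by apply: eq_bigr => i _; rewrite !nth_rcons hs ltn_ord.
case=> r /IH [rs [hs e]]; exists (rcons rs r); rewrite !size_rcons hs; split=> //.
rewrite big_ord_recr /= !nth_rcons hs ltnn eqxx.
move/eqP: e; rewrite subr_eq => /eqP ->; congr (_ + _).
by apply: eq_bigr => i _; rewrite !nth_rcons hs ltn_ord.
Qed.

Section Sat.
Variable T : R -> Prop.
Hypothesis T1 : T 1.
Hypothesis TM : forall u v, T u -> T v -> T (u * v).

(** The contraction to [R] of the extension of [I] to the localization at [T]. The choices of [T]
    used below are 1 alone, the complement of a prime, and the nonzero constants. *)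
Definition sat I : R -> Prop := fun x => exists u, T u /\ I (u * x).

Lemma sat_ideal I : is_ideal I -> is_ideal (sat I).
Proof.
move=> hI; split; first by exists 1; split=> //; rewrite mulr0; exact: ideal0.
split=> [x y [u [hu hx]] [v [hv hy]]|r x [u [hu hx]]].
  exists (u * v); split; first exact: TM.
  have -> : u * v * (x + y) = v * (u * x) + u * (v * y) by ring.
  by apply: idealD => //; apply: idealM.
by exists u; split=> //; rewrite mulrCA; apply: idealM.
Qed.

Lemma sat_sub I x : I x -> sat I x.
Proof. by exists 1; rewrite mul1r. Qed.

Lemma sat_mono I J x : (forall y, I y -> J y) -> sat I x -> sat J x.
Proof. by move=> h [u [hu hx]]; exists u; split=> //; apply: h. Qed.

Lemma satM I u x : T u -> sat I (u * x) -> sat I x.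
Proof. by move=> hu [v [hv h]]; exists (v * u); split; [exact: TM | rewrite -mulrA]. Qed.

Definition nzd I a := forall x, sat I (a * x) -> sat I x.

(** Only the nonzerodivisor conditions are kept, so that the notion behaves well under localization;
    properness of the ideal is supplied at the end in [regular_of_reg]. *)
Fixpoint regT I s : Prop :=
  if s is a :: s' then nzd I a /\ regT (isum I a) s' else True.

Lemma nzdM I a b : is_ideal I -> nzd I a -> nzd I b -> nzd I (a * b).
Proof. by move=> hI ha hb x; rewrite -mulrA => /ha /hb. Qed.

Lemma nzdX I a k : is_ideal I -> nzd I a -> nzd I (a ^+ k).
Proof.
move=> hI ha; elim: k => [|k IH]; first by rewrite expr0 => x; rewrite mul1r.
by rewrite exprS; apply: nzdM.
Qed.

(** If [z x = g f] modulo [I], then [g] is a multiple [g' z] because [f] is regular modulo [z], and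
    cancelling [z] gives [x = g' f]. This half of an exchange is purely formal; the other half,
    [nzd_front], depends on separatedness. *)
Lemma nzd_swap I z f : is_ideal I -> nzd I z -> nzd (isum I z) f -> nzd (isum I f) z.
Proof.
move=> hI hz hf x [u [hu [g hg]]].
have {}hg : I (z * (u * x) - g * f) by congr I: hg; ring.
have h1 : sat (isum I z) (f * g).
  apply: sat_sub; exists (u * x).
  have -> : f * g - u * x * z = - (z * (u * x) - g * f) by ring.
  exact: idealN.
have [v [hv [g' hg']]] := hf _ h1.
have h2 : sat I (z * (v * u * x - f * g')).
  apply: sat_sub.
  have -> : z * (v * u * x - f * g') = v * (z * (u * x) - g * f) + f * (v * g - g' * z) by ring.
  by apply: idealD => //; apply: idealM.
have [w [hw h3]] := hz _ h2.
exists (w * v * u); split; first by do 2?apply: TM.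
exists (w * g').
by have -> : w * v * u * x - w * g' * f = w * (v * u * x - f * g') by ring.
Qed.

Lemma regT_skip I z f s : is_ideal I ->
  regT I (z :: f :: s) -> regT (isum I f) (z :: s).
Proof.
move=> hI /= [hz [hf hs]]; split; first exact: nzd_swap.
by rewrite isumC.
Qed.

Lemma regT_nzd_last I z s : is_ideal I -> regT I (z :: s) -> nzd (idadd I s) z.
Proof.
elim: s I => [|f s IH] I hI h; first by case: h.
by apply: IH; [exact: isum_ideal | exact: regT_skip].
Qed.

(** For the next element [c]: if [c x = r a b], then [x = x' a] by regularity modulo [a]; cancelling
    [a] leaves [c x' = r b], so [x'] is a multiple of [b] by regularity modulo [b]. The rest of the
    sequence is treated after adding [c] to the ideal. *)
Lemma regT_mul I a b s : is_ideal I ->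
  regT I (a :: s) -> regT I (b :: s) -> regT I (a * b :: s).
Proof.
elim: s I => [|c s IH] I hI ha hb.
  by split=> //; apply: nzdM => //; [case: ha | case: hb].
have IH' := IH _ (isum_ideal hI c) (regT_skip hI ha) (regT_skip hI hb).
case: ha hb => [ha [hca _]] [hb [hcb _]].
split; [exact: nzdM | split; last by case: IH' => _; rewrite isumC].
move=> x [u [hu [r hr]]].
have h1 : sat (isum I a) (c * x).
  by exists u; split=> //; exists (r * b); congr I: hr; ring.
have [v [hv [x' hx']]] := hca _ h1.
have h2 : sat I (a * (c * (u * x') - v * r * b)).
  apply: sat_sub; have -> : a * (c * (u * x') - v * r * b) =
    v * (u * (c * x) - r * (a * b)) - u * c * (v * x - x' * a) by ring.
  by apply: idealB => //; apply: idealM.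
have [w [hw h3]] := ha _ h2.
have h4 : sat (isum I b) (c * x').
  exists (w * u); split; first exact: TM.
  exists (w * v * r); congr I: h3; ring.
have [t [ht [x2 h5]]] := hcb _ h4.
exists (t * v); split; first exact: TM.
exists x2; have -> : t * v * x - x2 * (a * b) = t * (v * x - x' * a) + a * (t * x' - x2 * b) by ring.
by apply: idealD => //; apply: idealM.
Qed.

Lemma regT_exp I a s k : is_ideal I -> regT I (a :: s) -> regT I (a ^+ k.+1 :: s).
Proof.
move=> hI h; elim: k => [|k IH]; first by rewrite expr1.
by rewrite exprS; apply: regT_mul.
Qed.

Lemma regT_cat I s t : regT I (s ++ t) <-> regT I s /\ regT (idadd I s) t.
Proof.
elim: s I => [|a s IH] I /=; first by split=> [|[]].
by rewrite IH; tauto.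
Qed.

Lemma regT_prod I (J : Type) (r : seq J) (F : J -> R) s : is_ideal I -> 
  regT I s -> (forall j, regT I (F j :: s)) -> regT I ((\prod_(j <- r) F j) :: s).
Proof.
move=> hI h0 h; elim: r => [|j r IH].
  rewrite big_nil; split; first by move=> x; rewrite mul1r.
  elim: s I hI h0 {h} => //= c s IH I hI [h1 h2]; split.
    move=> x _; exists 1; split=> //; exists x; rewrite mul1r mulr1 subrr; exact: ideal0.
  by rewrite isumC; apply: IH => //; apply: isum_ideal.
by rewrite big_cons; apply: regT_mul.
Qed.

Lemma regT_eqmod I (J : Type) (r : seq J) (F G : J -> R) : is_ideal I ->
  (forall j, I (F j - G j)) -> regT I (map F r) -> regT I (map G r).
Proof.
move=> + h; elim: r I h => //= j r IH I h hI [h1 h2]; split.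
  move=> x [u [hu hx]]; apply: h1; exists u; split=> //.
  have -> : u * (F j * x) = u * (G j * x) + u * x * (F j - G j) by ring.
  by apply: idealD => //; apply: idealM.
rewrite -(isum_eq hI (h j)); apply: IH => // [k|]; last exact: isum_ideal.
by apply: isum_sub.
Qed.

Section Swap.
Variables (C : (R -> Prop) -> Prop) (G : R -> Prop).
Hypothesis Cid : forall I, C I -> is_ideal I.
Hypothesis Cadd : forall I a, C I -> G a -> C (isum I a).
Hypothesis Csep : forall I z x, C I -> G z -> nzd I z ->
  (forall k, sat (isum I (z ^+ k)) x) -> sat I x.

(** If [f x] lies in [I], regularity of [f] modulo [z] shows step by step that [x] lies in [I] plus
    every power of [z], and [Csep] concludes. [Csep] holds in Noetherian local rings
    ([local_separated]) and for homogeneous ideals ([graded_separated]), the two cases in which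
    sequences are permuted. *)
Lemma nzd_front I z f : C I -> G z -> nzd I z -> nzd (isum I z) f -> nzd I f.
Proof.
move=> hC hG hz hf x hx; apply: (Csep hC hG hz) => k.
have hI := Cid hC; elim: k x hx => [|k IH] x hx.
  rewrite expr0; apply: sat_sub; exists x; rewrite mulr1 subrr; exact: ideal0.
have [|u [hu [r hr]]] := hf x; first by apply: sat_mono hx => y; apply: isum_sub.
have h1 : sat I (z * (f * r)).
  have -> : z * (f * r) = u * (f * x) - f * (u * x - r * z) by ring.
  have hS := sat_ideal hI.
  apply: (idealB hS); first exact: (idealM hS).
  by apply: (idealM hS); apply: sat_sub.
have [v [hv [t ht]]] := IH _ (hz _ h1).
exists (v * u); split; first exact: TM.
exists t; have -> : v * u * x - t * z ^+ k.+1 = v * (u * x - r * z) + z * (v * r - t * z ^+ k).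
  rewrite exprS; ring.
by apply: idealD => //; apply: idealM.
Qed.

Lemma regT_swap I z f s : C I -> G z -> regT I (z :: f :: s) -> regT I (f :: z :: s).
Proof.
move=> hC hG h; have hI := Cid hC; split; last exact: regT_skip.
by case: h => h1 [h2 _]; apply: nzd_front h2.
Qed.

Lemma regT_bubble I s z t : C I -> (forall a, a \in s -> G a) ->
  regT I (s ++ z :: t) -> regT I (z :: s ++ t).
Proof.
elim: s I => [|a s IH] I hC hs //= [h1 h2].
have hG : G a by apply: hs; rewrite inE eqxx.
have hC' : C (isum I a) by apply: Cadd.
apply: regT_swap => //; split=> //.
by apply: IH => // b hb; apply: hs; rewrite inE hb orbT.
Qed.

Lemma regT_drop I z s : C I -> G z -> (forall a, a \in s -> G a) ->
  regT I (z :: s) -> regT I s.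
Proof.
elim: s I => [|f s IH] I hC hG hs //= h.
have := regT_swap hC hG h => -[h1 h2]; split=> //.
apply: IH h2 => //; first by apply: Cadd => //; apply: hs; rewrite inE eqxx.
by move=> b hb; apply: hs; rewrite inE hb orbT.
Qed.

Lemma regT_dropl I t s : C I -> (forall a, a \in t ++ s -> G a) ->
  regT I (t ++ s) -> regT I s.
Proof.
elim: t => [//|a t IH] hC hs h.
apply: IH => //; first by move=> b hb; apply: hs; rewrite inE hb orbT.
apply: regT_drop h => //; first by apply: hs; rewrite inE eqxx.
by move=> b hb; apply: hs; rewrite inE hb orbT.
Qed.

Lemma regT_perm I s t : C I -> (forall a, a \in s -> G a) -> perm_eq s t ->
  regT I s -> regT I t.
Proof.
elim: t I s => [|b t IH] I s hC hs.
  by move/perm_size/eqP; rewrite size_eq0 => /eqP ->.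
move=> hp; have hb : b \in s by rewrite (perm_mem hp) inE eqxx.
case/splitPr: hb hs hp => s1 s2 hs hp h.
have [|h1 h2] := regT_bubble hC _ h.
  by move=> a ha; apply: hs; rewrite mem_cat ha.
split=> //; apply: IH h2.
- by apply: Cadd => //; apply: hs; rewrite mem_cat inE eqxx orbT.
- by move=> a; rewrite mem_cat => /orP[] ha; apply: hs; rewrite mem_cat ?inE ha ?orbT.
- by rewrite -(perm_cons b) -(permPr hp) -cat_rcons -cat1s -cats1 -catA perm_catCA catA -!catA /= .
Qed.

End Swap.
End Sat.

End Ideals.

Lemma exists_min (T : Type) (f : T -> nat) (P : T -> Prop) :
  (exists x, P x) -> exists x, P x /\ forall y, P y -> (f x <= f y)%N.
Proof.
case=> x; have [n] := ubnP (f x); elim: n x => // n IH x lex hx.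
case: (classic (exists y, P y /\ (f y < f x)%N)) => [[y [hy ltyx]]|h].
  by apply: (IH y) => //; lia.
exists x; split=> // y hy; rewrite leqNgt; apply/negP => lt; apply: h; by exists y.
Qed.

Section Regular.
Variable R : comNzRingType.

Definition reg := @regT R (fun u => u = 1).

Lemma sat1 (I : R -> Prop) : sat (fun u => u = 1) I = I.
Proof.
apply: predext => x; split; first by case=> u [->]; rewrite mul1r.
by move=> h; exists 1; rewrite mul1r.
Qed.

Lemma regT_T (T T' : R -> Prop) I s : is_ideal I -> T 1 -> (forall u, T u -> T' u) ->
  (forall u v, T' u -> T' v -> T' (u * v)) -> regT T I s -> regT T' I s.
Proof.
move=> + T1 hT hM; elim: s I => //= a s IH I hI [h1 h2]; split; last first.
  by apply: IH => //; apply: isum_ideal.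
move=> x [u [hu hx]].
have [|v [hv hvx]] := h1 (u * x); first by exists 1; rewrite mul1r mulrCA.
by exists (v * u); split; [apply: hM => //; apply: hT | rewrite -mulrA].
Qed.

Definition lcomb (cs fs : seq R) := \sum_(p <- zip cs fs) p.1 * p.2.

Lemma lcomb_cat c1 c2 f1 f2 : size c1 = size f1 ->
  lcomb (c1 ++ c2) (f1 ++ f2) = lcomb c1 f1 + lcomb c2 f2.
Proof. by move=> h; rewrite /lcomb zip_cat // big_cat. Qed.

Lemma lcomb_cons c f cs fs : lcomb (c :: cs) (f :: fs) = c * f + lcomb cs fs.
Proof. by rewrite /lcomb /= big_cons. Qed.

Lemma lcombN cs fs : lcomb (map -%R cs) fs = - lcomb cs fs.
Proof.
elim: cs fs => [|c cs IH] [|f fs]; rewrite /lcomb /= ?big_nil ?oppr0 //.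
by rewrite !big_cons -!/(lcomb _ _) IH mulNr opprD.
Qed.

Lemma lcomb0 k fs : lcomb (nseq k 0) fs = 0.
Proof.
elim: k fs => [|k IH] [|f fs]; rewrite /lcomb /= ?big_nil //.
by rewrite big_cons -/(lcomb _ _) IH mul0r addr0.
Qed.

Lemma idaddP I s x : idadd I s x <-> exists cs, size cs = size s /\ I (x - lcomb cs s).
Proof.
elim: s x => [|a s IH] x.
  split=> [h|[cs [hs]]]; first by exists [::]; rewrite /lcomb big_nil subr0.
  by rewrite (size0nil hs) /lcomb big_nil subr0.
rewrite /= idadd_isum; split.
  case=> r /IH [cs [hs h]]; exists (r :: cs); rewrite /= hs; split=> //.
  by rewrite lcomb_cons opprD addrA.
case=> cs [hs h]; case: cs hs h => [|c cs] // [hs] h.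
exists c; apply/IH; exists cs; split=> //.
by move: h; rewrite lcomb_cons opprD addrA.
Qed.

Lemma idadd0P s x : idadd (@zeroid R) s x <-> exists cs, size cs = size s /\ x = lcomb cs s.
Proof.
rewrite idaddP; split=> -[cs [h e]]; exists cs; split=> //; last by rewrite e /zeroid subrr.
by move/eqP: e; rewrite subr_eq0 => /eqP.
Qed.

End Regular.

Lemma regT_preim (R R' : comNzRingType) (g : {rmorphism R -> R'}) (T T' : _ -> Prop)
    (I' : R' -> Prop) s :
  is_ideal I' ->
  (forall y, exists x, g x = y) -> (forall u, T u -> T' (g u)) ->
  (forall u', T' u' -> exists u, T u /\ g u = u') ->
  regT T (fun x => I' (g x)) s <-> regT T' I' (map g s).
Proof.
move=> + hg hT hT'; elim: s I' => [|a s IH] I' hI //=.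
have hsat J x : sat T (fun x => J (g x)) x <-> sat T' J (g x).
  split=> [[u [hu h]]|[u' [/hT' [u [hu <-]] h]]].
    by exists (g u); split; [exact: hT | rewrite -rmorphM].
  by exists u; split=> //; rewrite rmorphM.
have -> : isum (fun x => I' (g x)) a = fun x => isum I' (g a) (g x).
  apply: predext => x; split=> -[r hr].
    by exists (g r); rewrite -rmorphM -rmorphB.
  by have [t ht] := hg r; exists t; rewrite rmorphB rmorphM ht.
rewrite IH; last exact: isum_ideal.
split=> -[h1 h2]; split=> //.
  move=> y; have [x <-] := hg y; rewrite -rmorphM => /hsat /h1 /hsat //.
by move=> x /hsat; rewrite rmorphM => /h1 /hsat.
Qed.

(** * Noetherian rings *)

Section Noeth.
Variable R : comNzRingType.

(** The ascending chain condition in terms of elements. Ideals are bare predicates without chosen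
    generators, and every application builds one sequence by choice. *)
Definition noeth := forall a : nat -> R, exists m, idadd (@zeroid R) (mkseq a m) (a m).

Hypothesis nR : noeth.
Implicit Types I J : R -> Prop.

Lemma noeth_mod I (a : nat -> R) : is_ideal I -> exists m, idadd I (mkseq a m) (a m).
Proof.
move=> hI; have [m hm] := nR a; exists m; apply: idadd_mono hm => x ->; exact: ideal0.
Qed.

Lemma noeth_max (F : (R -> Prop) -> Prop) I0 :
  (forall I, F I -> is_ideal I) -> F I0 ->
  exists I, [/\ F I, forall x, I0 x -> I x &
    forall J, F J -> (forall x, I x -> J x) -> forall x, J x -> I x].
Proof.
move=> hF h0; apply: NNPP => hn.
pose up I J := [/\ F J, forall x, I x -> J x & exists x, J x /\ ~ I x].
pose nx I := epsilon (inhabits I) (up I).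
have nxP I : F I -> (forall x, I0 x -> I x) ->
    up I (nx I).
  move=> hI h; apply: (epsilon_spec (inhabits I) (up I)); apply: NNPP => hno; apply: hn.
  exists I; split=> // J hJ hIJ x hx; apply: NNPP => hnx; apply: hno.
  by exists J; split=> //; exists x.
pose Is k := iter k nx I0.
have IsP k : F (Is k) /\ forall x, I0 x -> Is k x.
  elim: k => [|k [h1 h2]] //=; have [h3 h4 _] := nxP _ h1 h2; split=> // x hx.
  by apply: h4; apply: h2.
have Ismono k l x : Is k x -> Is (l + k)%N x.
  move=> hx; elim: l => // l IH; have [h1 h2] := IsP (l + k)%N.
  by have [_ + _] := nxP _ h1 h2; apply.
pose xs k := epsilon (inhabits 0) (fun x => Is k.+1 x /\ ~ Is k x).
have xsP k : Is k.+1 (xs k) /\ ~ Is k (xs k).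
  apply: (epsilon_spec (inhabits 0) (fun x => Is k.+1 x /\ ~ Is k x)).
  by have [h1 h2] := IsP k; have [_ _] := nxP _ h1 h2.
have [m hm] := nR xs; case: (xsP m) => _; apply.
have [hFm _] := IsP m; have hI := hF _ hFm.
apply: idadd_min hm => // [x ->|x /mapP[k]]; first exact: ideal0.
rewrite mem_iota => /andP[_ ltkm] ->; have -> : m = (m - k.+1 + k.+1)%N by lia.
by apply: Ismono; case: (xsP k).
Qed.

Lemma prime_avoid I (S : R -> Prop) : is_ideal I -> S 1 ->
  (forall u v, S u -> S v -> S (u * v)) -> (forall x, S x -> ~ I x) ->
  exists Q, [/\ is_prime Q, forall x, I x -> Q x & forall x, S x -> ~ Q x].
Proof.
move=> hI S1 SM hS.
pose F J := is_ideal J /\ forall x, S x -> ~ J x.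
have [|//|Q [[hQ hSQ] hIQ hmax]] := @noeth_max F I; first by move=> J [].
exists Q; split=> //; split=> //; split; first exact: hSQ.
have key x : ~ Q x -> exists r s, S s /\ Q (s - r * x).
  move=> hx; apply: NNPP => hno; apply: hx.
  apply: (hmax (isum Q x)); last exact: isum_gen.
    split; first exact: isum_ideal.
    by move=> s hs [r hr]; apply: hno; exists r, s.
  by move=> y; apply: isum_sub.
move=> x y hxy; apply: NNPP => hno.
have [r [s [hs h1]]] := key x (fun h => hno (or_introl h)).
have [r' [s' [hs' h2]]] := key y (fun h => hno (or_intror h)).
apply: (hSQ (s * s')); first exact: SM.
have -> : s * s' = s' * (s - r * x) + r * x * (s' - r' * y) + r * r' * (x * y) by ring.
by apply: idealD => //; [apply: idealD => // |]; apply: idealM.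
Qed.

Definition colon I c : R -> Prop := fun x => I (c * x).

Lemma colon_ideal I c : is_ideal I -> is_ideal (colon I c).
Proof.
move=> hI; rewrite /colon; split; first by rewrite mulr0; exact: ideal0.
by split=> [x y|r x] h; rewrite ?mulrDr ?[c * (r * x)]mulrCA => *; [apply: idealD | apply: idealM].
Qed.

(** A Vandermonde argument: after division by ['X - t i] the quotient has smaller size, and its
    values at the remaining points still lie in [I] because the differences of the points are
    units. *)
Lemma coefs_of_values I (a : {poly R}) (t : nat -> R) (l : seq nat) : is_ideal I ->
  (forall i j, i != j -> exists v, v * (t i - t j) = 1) ->
  uniq l -> (size a <= size l)%N -> (forall i, i \in l -> I a.[t i]) ->
  forall j, I a`_j.
Proof.
move=> hI ht; elim: l a => [|i l IH] a.
  move=> _; rewrite leqn0 size_poly_eq0 => /eqP -> _ j; rewrite coef0; exact: ideal0.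
move=> /= /andP[hil hu] hsz hr.
have hr0 : I a.[t i] by apply: hr; rewrite inE eqxx.
have [->|a0] := eqVneq a 0; first by move=> j; rewrite coef0; exact: ideal0.
have /factor_theorem [b' hb'] : root (a - (a.[t i])%:P) (t i).
  by rewrite /root !hornerE subrr.
have Ib : forall j, I b'`_j.
  apply: IH => //.
    have [->|nz] := eqVneq b' 0; first by rewrite size_poly0.
    have: (size (b' * ('X - (t i)%:P))%R <= size a)%N.
      rewrite -hb'; apply: leq_trans (size_polyD _ _) _.
      rewrite size_polyN geq_max leqnn /= (leq_trans (size_polyC_leq1 _)) //.
      by rewrite lt0n size_poly_eq0.
    rewrite size_Mmonic ?monicXsubC // size_XsubC addn2 /= => h.
    by rewrite -ltnS (leq_trans h).
  move=> j hj; have hji : j != i by apply: contraNneq hil => <-.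
  have [v hv] := ht _ _ hji.
  have -> : b'.[t j] = v * (a.[t j] - a.[t i]).
    have := congr1 (fun p => p.[t j]) hb'; rewrite !hornerE => ->.
    by rewrite [_ * (_ - _)]mulrC mulrA hv mul1r.
  by apply: idealM => //; apply: idealB => //; apply: hr; rewrite inE hj orbT.
move=> j; have -> : a`_j = (b' * ('X - (t i)%:P) + (a.[t i])%:P)`_j by rewrite -hb' subrK.
rewrite coefD coefC mulrBr coefB coefMX coefMC; apply: idealD => //; last first.
  by case: ifP => // _; exact: ideal0.
apply: idealB => //; last by apply: idealMr.
by case: ifP => // _; exact: ideal0.
Qed.

End Noeth.

Lemma bounded_of_no_uniq (P : nat -> Prop) q :
  (forall l, uniq l -> (q <= size l)%N -> ~ (forall i, i \in l -> P i)) ->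
  exists B, forall i, P i -> (i < B)%N.
Proof.
move=> h; apply: NNPP => hn.
have unb B : exists i, P i /\ (B <= i)%N.
  apply: NNPP => hno; apply: hn; exists B => i hi; rewrite ltnNge; apply/negP => hB.
  by apply: hno; exists i.
have [l [hu hs hl]] : exists l, [/\ uniq l, size l = q & forall i, i \in l -> P i].
  elim: q {h} => [|q [l [hu hs hl]]]; first by exists [::].
  have [i [hi hB]] := unb (\max_(j <- l) j).+1.
  exists (i :: l); rewrite /= hu hs andbT; split=> //.
    apply/negP => hil; have: (i <= \max_(j <- l) j)%N by apply: (@leq_bigmax_seq _ l predT id i).
    by rewrite leqNgt hB.
  by move=> j; rewrite inE => /orP[/eqP->|/hl].
by apply: (h l); rewrite ?hs.
Qed.

Section Avoid.
Variable R : comNzRingType.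
Hypothesis nR : noeth R.

(* The maximal proper colon ideals [(I : c)] are prime; an infinite family of
   distinct ones would give a strictly increasing chain of ideals. *)
Lemma generic_value_nzd (I : R -> Prop) (a : {poly R}) (t : nat -> R) : is_ideal I ->
  (forall i j, i != j -> exists v, v * (t i - t j) = 1) ->
  (forall c, (forall j, I (c * a`_j)) -> I c) ->
  exists i, forall x, I (a.[t i] * x) -> I x.
Proof.
move=> hI ht ha; apply: NNPP => hno.
pose max c := ~ I c /\ forall c', ~ I c' -> (forall x, I (c * x) -> I (c' * x)) ->
  forall x, I (c' * x) -> I (c * x).
have hmax i : exists c, max c /\ I (c * a.[t i]).
  have [c0 [hc0 hc1]] : exists c, I (a.[t i] * c) /\ ~ I c.
    apply: NNPP => hn; apply: hno; exists i => x hx; apply: NNPP => hnx.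
    by apply: hn; exists x.
  have [||J [[c [hc eJ]] h0 h1]] :=
    @noeth_max _ nR (fun J => exists c, ~ I c /\ J = colon I c) (colon I c0).
  - by move=> J [c [_ ->]]; apply: colon_ideal.
  - by exists c0.
  subst J; exists c; split; last by apply: h0; rewrite /colon mulrC.
  split=> // c' hc' h x; apply: (h1 (colon I c')) => //; by exists c'.
pose cs i := epsilon (inhabits 0) (fun c => max c /\ I (c * a.[t i])).
have csP i : max (cs i) /\ I (cs i * a.[t i]).
  exact: (epsilon_spec (inhabits 0) (fun c => max c /\ I (c * a.[t i]))).
have maxprime c x y : max c -> I (c * (x * y)) -> I (c * x) \/ I (c * y).
  move=> [hc hm] hxy; apply: NNPP => hn.
  have hcx : ~ I (c * x) by move=> h; apply: hn; left.
  apply: hn; right; apply: (hm (c * x)) => //; last by rewrite -mulrA.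
  by move=> z hz; rewrite mulrAC; apply: idealMr.
pose same i j := forall x, I (cs i * x) <-> I (cs j * x).
(* If one of these colon ideals occurred for [size a] indices, it would contain that many values of
   [a], hence all coefficients of [a], and [ha] would put [cs j] into [I]. *)
have bnd j : exists B, forall i, same j i -> (i < B)%N.
  apply: (@bounded_of_no_uniq _ (size a)) => l hu hs hl.
  case: (csP j) => -[hcj _] _; apply: hcj; apply: ha => k.
  apply: (@coefs_of_values R (colon I (cs j)) a t l) => //; first exact: colon_ideal.
  by move=> i hi; apply/(hl i hi); case: (csP i).
have fresh (l : seq nat) : exists i, forall j, j \in l -> ~ same j i.
  suff [B hB] : exists B, forall j i, j \in l -> same j i -> (i < B)%N.
    by exists B => j hj hs; have := hB _ _ hj hs; rewrite ltnn.
  elim: l => [|j l [B hB]]; first by exists 0%N.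
  have [B' hB'] := bnd j; exists (maxn B B') => k i.
  rewrite inE => /orP[/eqP->|hk] hs; first by rewrite (leq_trans (hB' _ hs)) ?leq_maxr.
  by rewrite (leq_trans (hB _ _ hk hs)) ?leq_maxl.
pose nx (l : seq nat) := epsilon (inhabits 0%N) (fun i => forall j, j \in l -> ~ same j i).
have nxP (l : seq nat) j : j \in l -> ~ same j (nx l).
  by move: j; apply: (epsilon_spec (inhabits 0%N) (fun i => forall j, j \in l -> ~ same j i)).
pose L := fix L k : seq nat := if k is k'.+1 then rcons (L k') (nx (L k')) else [::].
pose ix k := nx (L k).
have LE k : L k = mkseq ix k.
  by elim: k => // k IH; rewrite /= -/(L k) /mkseq -addn1 iotaD map_cat -/(mkseq _ _) -IH cats1.
have [m hm] := noeth_mod nR (cs \o ix) hI.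
have [hpm _] := csP (ix m).
(* Each earlier colon ideal has an element outside the one at [ix m]. By primality their product [y]
   stays outside, yet it kills all earlier [cs] modulo [I], and so also [cs (ix m)] by the choice of
   [m]. *)
have [y [hy1 hy2]] : exists y, ~ I (cs (ix m) * y) /\
    forall c, c \in mkseq (cs \o ix) m -> I (c * y).
  have: forall i, i \in L m -> ~ same i (ix m) by move=> i; apply: nxP.
  have -> : mkseq (cs \o ix) m = map cs (L m) by rewrite LE /mkseq -map_comp.
  elim: (L m) => [|i l IH] hl.
    by exists 1; split=> //; rewrite mulr1; case: hpm.
  have [|y [hy1 hy2]] := IH; first by move=> j hj; apply: hl; rewrite inE hj orbT.
  have [z [hz1 hz2]] : exists z, I (cs i * z) /\ ~ I (cs (ix m) * z).
    apply: NNPP => hn; apply: (hl i); rewrite ?inE ?eqxx //.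
    have h1 x : I (cs i * x) -> I (cs (ix m) * x).
      by move=> hx; apply: NNPP => hnx; apply: hn; exists x.
    move=> x; split; first exact: h1.
    by have [[_ hmi] _] := csP i; apply: hmi => //; case: hpm.
  exists (y * z); split; first by case/(maxprime _ _ _ hpm).
  move=> c; rewrite /= inE => /orP[/eqP->|hc].
    by rewrite mulrCA; apply: idealM.
  by rewrite mulrA; apply: idealMr => //; apply: hy2.
apply: hy1; rewrite mulrC.
apply: (@idadd_min _ I (colon I y) _ _ _ _ _ hm); first exact: colon_ideal.
  by move=> x hx; rewrite /colon; apply: idealM.
by move=> c hc; rewrite /colon mulrC; apply: hy2.
Qed.

End Avoid.

Section Hilbert.
Variable A : comNzRingType.
Hypothesis nA : noeth A.

(** Hilbert's argument: choose successively an element of least size among those of [I] outside the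
    ideal of the earlier choices. Once a leading coefficient depends on the earlier ones, cancelling
    the leading term contradicts minimality. *)
Theorem noeth_poly : noeth {poly A}.
Proof.
move=> g; apply: NNPP => hno.
have g_out m : ~ idadd (@zeroid _) (mkseq g m) (g m) by move=> h; apply: hno; exists m.
pose z := @zeroid {poly A}; have hz : is_ideal z by exact: zeroid_ideal.
pose I x := exists m, idadd z (mkseq g m) x.
have mono m k x : idadd z (mkseq g m) x -> idadd z (mkseq g (m + k)) x.
  rewrite /mkseq iotaD map_cat idadd_cat; apply: idadd_sub; exact: idadd_ideal.
have hI : is_ideal I.
  split; first by exists 0%N.
  split=> [x y [m hm] [k hk]|r x [m hm]]; last first.
    by exists m; apply: idealM => //; apply: idadd_ideal.
  exists (m + k)%N; apply: idealD; first exact: idadd_ideal.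
    exact: mono.
  by rewrite addnC; apply: mono.
pose nice (l : seq {poly A}) (f : {poly A}) := [/\ I f, ~ idadd z l f &
  forall h, I h -> ~ idadd z l h -> (size f <= size h)%N].
have hnice (l : seq {poly A}) : (forall x, x \in l -> I x) -> exists f, nice l f.
  move=> hl; have [m hm] : exists m, forall x, x \in l -> idadd z (mkseq g m) x.
    elim: l hl => [|x l IH] hl; first by exists 0%N.
    have [|m hm] := IH; first by move=> y hy; apply: hl; rewrite inE hy orbT.
    have [k hk] := hl x (mem_head _ _).
    exists (m + k)%N => y; rewrite inE => /orP[/eqP->|hy]; last by apply: mono; apply: hm.
    by rewrite addnC; apply: mono.
  have [|f [[h1 h2] h3]] := @exists_min _ (fun f : {poly A} => size f)
     (fun f => I f /\ ~ idadd z l f).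
    exists (g m); split.
      exists m.+1; rewrite /mkseq -addn1 iotaD map_cat cats1 idadd_rcons.
      by apply: isum_gen; apply: idadd_ideal.
    move=> h; apply: (g_out m); apply: idadd_min h => //; first exact: idadd_ideal.
    by move=> x; apply: idadd_sub.
  by exists f; split=> // h h4 h5; apply: h3.
pose nx l := epsilon (inhabits 0) (nice l).
pose L := fix L k : seq {poly A} := if k is k'.+1 then rcons (L k') (nx (L k')) else [::].
pose f k := nx (L k).
have LE k : L k = mkseq f k.
  by elim: k => // k IH; rewrite /= -/(L k) /mkseq -addn1 iotaD map_cat -/(mkseq _ _) -IH cats1.
have LI k : forall x, x \in L k -> I x.
  elim: k => // k IH x; rewrite /= -/(L k) mem_rcons inE => /orP[/eqP->|]; last exact: IH.
  by case: (epsilon_spec (inhabits 0) (nice (L k)) (hnice _ IH)).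
have fP k : nice (L k) (f k).
  exact: (epsilon_spec (inhabits 0) (nice (L k)) (hnice _ (LI k))).
have fsz i m : (i <= m)%N -> (size (f i) <= size (f m))%N.
  move=> leim; have [_ _ h] := fP i; have [h1 h2 _] := fP m; apply: h => // h3; apply: h2.
  have -> : L m = L i ++ map f (iota i (m - i)).
    by rewrite !LE -{1}(subnKC leim) /mkseq iotaD map_cat.
  by rewrite idadd_cat; apply: idadd_sub => //; apply: idadd_ideal.
have [m /in_idealE [rs]] := nA (fun k => lead_coef (f k)).
rewrite size_mkseq => -[hrs e].
have [h1 h2 h3] := fP m.
have fm0 : f m != 0.
  by apply/eqP => f0; apply: h2; rewrite f0; apply: ideal0; apply: idadd_ideal.
pose S := \sum_(i < m) rs`_i *: ('X^(size (f m) - size (f i)) * f i).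
have hS : idadd z (L m) S.
  apply: ideal_sum; first exact: idadd_ideal.
  move=> i _; rewrite -mul_polyC; apply: idealM; first exact: idadd_ideal.
  apply: idealM; first exact: idadd_ideal.
  apply: idadd_gen => //; rewrite LE; apply/mapP; exists (val i) => //.
  by rewrite mem_iota ltn_ord.
have hIS : I S.
  apply: (@idadd_min _ z I (L m)) => // [x ->|x]; first exact: ideal0.
  exact: LI.
have: (size (f m) <= size (f m - S)%R)%N.
  apply: h3; first exact: idealB.
  move=> h; apply: h2; rewrite -(subrK S (f m)); apply: idealD => //; exact: idadd_ideal.
apply/negP; rewrite -ltnNge.
have szS : (size S <= size (f m))%N.
  apply: (leq_trans (size_sum _ _ _)); apply/bigmax_leqP => i _.
  apply: (leq_trans (size_scale_leq _ _)).
  apply: (leq_trans (size_polyMleq _ _)); rewrite size_polyXn.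
  have := fsz i m (ltnW (ltn_ord i)); lia.
have hle : (size (f m - S)%R <= size (f m))%N.
  by rewrite (leq_trans (size_polyD _ _)) // size_polyN geq_max leqnn.
rewrite ltn_neqAle hle andbT; apply/eqP => esz.
have: lead_coef (f m - S) != 0 by rewrite lead_coef_eq0 -size_poly_eq0 esz size_poly_eq0.
rewrite lead_coefE esz coefB -lead_coefE e coef_sum -sumrB big1 ?eqxx // => i _.
rewrite nth_mkseq // coefZ coefXnM.
have i0 : (0 < size (f i))%N.
  rewrite lt0n size_poly_eq0; apply/eqP => f0; have [_ hh _] := fP i; apply: hh.
  by rewrite f0; apply: ideal0; apply: idadd_ideal.
have lei := fsz i m (ltnW (ltn_ord i)).
rewrite ifF; last by lia.
have -> : ((size (f m)).-1 - (size (f m) - size (f i)) = (size (f i)).-1)%N by lia.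
by rewrite -lead_coefE subrr.
Qed.

End Hilbert.

(** * Prime chains and regular local rings *)

Section Chains.
Variable R : comNzRingType.
Hypothesis nR : noeth R.
Implicit Types (I J P Q : R -> Prop) (s : seq R).

Definition off P : R -> Prop := fun u => ~ P u.

Lemma off1 P : is_prime P -> off P 1.
Proof. by case=> _ []. Qed.

Lemma offM P : is_prime P -> forall u v, off P u -> off P v -> off P (u * v).
Proof. by case=> _ [_ h] u v hu hv /h []. Qed.

Lemma sat_off P I x : is_prime P -> (forall y, I y -> P y) -> sat (off P) I x -> P x.
Proof. by case=> _ [_ h] hI [u [hu /hI /h []]]. Qed.

(** The chain grows downwards. A prime [Q] above the ideal of the first elements that avoids all
    [u * a ^+ k] with [u] outside [P] is contained in [P] and misses [a]; such a prime exists
    because the last element [a] is regular at [P]. A sequence regular at [P] stays regular at the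
    smaller prime [Q]. *)
Lemma prime_chain_reg J P s : is_prime P -> is_ideal J -> (forall x, J x -> P x) ->
  (forall a, a \in s -> P a) -> regT (off P) J s -> prime_chain J P (size s).
Proof.
elim/last_ind: s P => [|s a IH] P hP hJ hJP hs hreg.
  by exists (fun _ => P); split=> //; split=> //; split.
have idP : is_ideal P by case: hP.
move: hreg; rewrite -cats1 => /regT_cat [hreg [ha _]].
pose I := idadd J s; have hI : is_ideal I by apply: idadd_ideal.
have IP x : I x -> P x.
  apply: idadd_min => // b hb; apply: hs; by rewrite mem_rcons inE hb orbT.
pose S x := exists u k, off P u /\ x = u * a ^+ k.
have [||||Q [hQ hIQ hSQ]] := @prime_avoid _ nR I S.
- by [].
- by exists 1, 0%N; split; [exact: off1 | rewrite mul1r].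
- move=> u v [u' [k [hu ->]]] [v' [l [hv ->]]]; exists (u' * v'), (k + l)%N; split.
    exact: offM.
  by rewrite exprD; ring.
- move=> x [u [k [hu ->]]] h.
  have : sat (off P) I u.
    apply: (@nzdX _ _ _ _ k hI ha); apply: sat_sub; first exact: off1.
    by rewrite mulrC.
  by move/(sat_off hP IP).
have aQ : ~ Q a by apply: hSQ; exists 1, 1%N; split; [exact: off1 | rewrite mul1r].
have QP x : Q x -> P x.
  move=> hx; apply: NNPP => hnx; apply: (hSQ x) => //.
  by exists x, 0%N; split=> //; rewrite mulr1.
have hJI x : J x -> I x by apply: idadd_sub.
have [|||Qs [h1 [h2 [h3 h4]]]] := IH Q hQ hJ.
- by move=> x hx; apply/hIQ/hJI.
- by move=> b hb; apply: hIQ; apply: idadd_gen.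
- apply: (@regT_T _ (off P) (off Q)) => //; first exact: off1.
    by move=> u hu hQu; apply: hu; apply: QP.
  exact: offM.
rewrite size_cat addn1; exists (fun i => if (i <= size s)%N then Qs i else P); split.
  by move=> i _; case: ifP => // hi; apply: h1.
split; first by rewrite leq0n; exact: h2.
split=> [i|x]; last by rewrite ltnn.
rewrite ltnS => hi; rewrite hi; case: ifP => [hi'|hi']; first exact: h3.
have -> : i = size s by lia.
split=> [x /h4|]; first exact: QP.
exists a; split; first by apply: hs; rewrite mem_rcons mem_head.
by move/h4.
Qed.

Lemma prime_chain_le J P h k : (k <= h)%N -> prime_chain J P h -> prime_chain J P k.
Proof.
move=> lekh [Q [h1 [h2 [h3 h4]]]].
exists (fun i => Q (i + (h - k))%N); split; first by move=> i hi; apply: h1; lia.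
split; last first.
  split; first by move=> i hi; rewrite addSn; apply: h3; lia.
  by move=> x; rewrite subnKC.
move=> x /h2; have: (0 + (h - k) <= h)%N by lia.
elim: (0 + (h - k))%N => // j IH hj /(IH (ltnW hj)); apply: (h3 _ _).1; lia.
Qed.

(** Krull's intersection theorem for the powers of one regular element. Up to units at [P],
    [x = z ^+ k * y k] and [y k] is a multiple of [z * y m] for [k < m]. The chain condition gives
    [y m = c * z * y m], and [1 - c z] is a unit at [P]. *)
Lemma local_separated P I z x : is_prime P -> is_ideal I -> P z -> nzd (off P) I z ->
  (forall k, sat (off P) (isum I (z ^+ k)) x) -> sat (off P) I x.
Proof.
move=> hP hI hz hnz hx; have idP : is_ideal P by case: hP.
have O1 := off1 hP; have OM := offM hP.
have hS := sat_ideal O1 OM hI.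
pose J := sat (off P) I.
pose Y k y := exists u, off P u /\ J (u * x - z ^+ k * y).
have exY k : exists y, Y k y.
  have [u [hu [y hy]]] := hx k; exists y, u; split=> //.
  by apply: sat_sub => //; rewrite [_ * y]mulrC.
pose y k := epsilon (inhabits 0) (Y k).
have yP k : Y k (y k) by apply: (epsilon_spec (inhabits 0) (Y k)).
have step k l : exists u, off P u /\ exists c, J (u * y k - z ^+ l * c * y (k + l)%N) /\ off P c.
  have [u [hu h1]] := yP k; have [v [hv h2]] := yP (k + l)%N.
  exists v; split=> //; exists u; split=> //.
  have : J (z ^+ k * (v * y k - z ^+ l * u * y (k + l)%N)).
    have -> : z ^+ k * (v * y k - z ^+ l * u * y (k + l)%N) =
      u * (v * x - z ^+ (k + l) * y (k + l)%N) - v * (u * x - z ^+ k * y k).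
      by rewrite exprD; ring.
    by apply: (idealB hS); apply: (idealM hS).
  exact: nzdX.
have [m hm] := noeth_mod nR y hS.
have [u [c [hu h]]] : exists u c, off P u /\ J (u * y m - c * z * y m).
  suff : sat (off P) (isum J (z * y m)) (y m).
    by move=> [u [hu [c hc]]]; exists u, c; split=> //; rewrite -mulrA.
  have hJ' : is_ideal (isum J (z * y m)) by apply: isum_ideal.
  have hJs := sat_ideal O1 OM hJ'.
  apply: (idadd_min hJs) hm => [w hw|w /mapP[k]].
    by apply: sat_sub => //; apply: isum_sub.
  rewrite mem_iota => /andP[_ ltkm] ->.
  have [v [hv [d [hd _]]]] := step k (m - k)%N.
  exists v; split=> //; exists (z ^+ (m - k).-1 * d).
  rewrite add0n in ltkm; rewrite subnKC in hd; last by lia.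
  have ez : z ^+ (m - k) = z * z ^+ (m - k).-1 by rewrite -exprS; congr (_ ^+ _); lia.
  by have -> : z ^+ (m - k).-1 * d * (z * y m) = z ^+ (m - k) * d * y m by rewrite ez; ring.
have hu' : off P (u - c * z).
  by move=> h'; apply: hu; rewrite -(subrK (c * z) u); apply: idealD => //; apply: idealM.
have hym : J (y m) by apply: (satM OM hu'); rewrite mulrBl.
have [v [hv h1]] := yP m.
apply: (satM OM hv); rewrite -(subrK (z ^+ m * y m) (v * x)).
by apply: (idealD hS) => //; apply: (idealM hS).
Qed.

Lemma regT_local_perm P s t : is_prime P -> (forall a, a \in s -> P a) -> perm_eq s t ->
  regT (off P) (@zeroid R) s -> regT (off P) (@zeroid R) t.
Proof.
move=> hP hs hp; apply: (@regT_perm _ _ (off1 hP) (offM hP) (@is_ideal R) P) => //.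
- by move=> I a hI _; apply: isum_ideal.
- by move=> I z x; apply: local_separated.
- exact: zeroid_ideal.
Qed.

(** Regularity of the local rings in the form that passes to polynomial rings, where at most one
    generator has to be appended to such a sequence. *)
Definition locally_regular := forall P, is_prime P -> exists cs : seq R,
  [/\ forall c, c \in cs -> P c,
      forall x, P x -> sat (off P) (idadd (@zeroid R) cs) x &
      regT (off P) (@zeroid R) cs].

Definition psq P : R -> Prop := fun x => exists ps : seq (R * R),
  (forall p, p \in ps -> P p.1 /\ P p.2) /\ x = \sum_(p <- ps) p.1 * p.2.

Lemma psqM P a b : P a -> P b -> psq P (a * b).
Proof.
move=> ha hb; exists [:: (a, b)]; split; last by rewrite big_seq1.
by move=> p; rewrite inE => /eqP ->.
Qed.

Lemma psqD P x y : psq P x -> psq P y -> psq P (x + y).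
Proof.
move=> [p [hp ->]] [q [hq ->]]; exists (p ++ q); split; last by rewrite big_cat.
by move=> c; rewrite mem_cat => /orP[/hp|/hq].
Qed.

Lemma psq0 P : psq P 0.
Proof. by exists [::]; rewrite big_nil. Qed.

(** Linear independence in the cotangent space of the local ring at [P]. A denominator outside [P]
    can be absorbed into the coefficients, so the condition can be stated in [R] itself. *)
Definition indep_mod_sq P fs := forall cs, size cs = size fs ->
  psq P (lcomb cs fs) -> forall c, c \in cs -> P c.

Lemma idadd_split P I ds y : (forall d, d \in ds -> P d) -> idadd I ds y ->
  (exists ds1 d ds2 b, [/\ ds = ds1 ++ d :: ds2, ~ P b & idadd I (ds1 ++ ds2) (y - b * d)]) \/
  (exists z, I (y - z) /\ psq P z).
Proof.
elim: ds y => [|d ds IH] y hds /=.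
  by move=> h; right; exists 0; rewrite subr0; split=> //; exact: psq0.
rewrite idadd_isum => -[b hb].
case: (classic (P b)) => hPb; last first.
  by left; exists [::], d, ds, b; split.
have [||[ds1 [e [ds2 [c [-> hc h]]]]]|[z [h hz]]] := IH (y - b * d).
- by move=> e he; apply: hds; rewrite inE he orbT.
- by [].
- left; exists (d :: ds1), e, ds2, c; split=> //=.
  by rewrite idadd_isum; exists b; congr (idadd _ _ _): h; ring.
right; exists (b * d + z); split; first by congr I: h; ring.
by apply: psqD => //; apply: psqM => //; apply: hds; rewrite mem_head.
Qed.

(* Steinitz exchange against a regular system of generators of [P R_P]. *)
Lemma extend_regular P fs : locally_regular -> is_prime P ->
  (forall f, f \in fs -> P f) -> indep_mod_sq P fs ->
  exists ds, [/\ forall d, d \in ds -> P d,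
    forall x, P x -> sat (off P) (idadd (@zeroid R) (fs ++ ds)) x &
    regT (off P) (@zeroid R) (fs ++ ds)].
Proof.
move=> hL hP hfs hind; have idP : is_ideal P by case: hP.
have O1 := off1 hP; have OM := offM hP.
pose z0 := @zeroid R; have hz0 : is_ideal z0 by apply: zeroid_ideal.
suff H fs1 fs2 : fs = fs1 ++ fs2 -> exists ds, [/\ forall d, d \in ds -> P d,
    forall x, P x -> sat (off P) (idadd z0 (fs1 ++ ds)) x &
    regT (off P) z0 (fs1 ++ ds)] by apply: (H fs [::]); rewrite cats0.
elim/last_ind: fs1 fs2 => [|fs1 f IH] fs2 efs; first exact: hL.
have [|ds [h1 h2 h3]] := IH (f :: fs2); first by rewrite efs cat_rcons.
have hf : P f by apply: hfs; rewrite efs mem_cat mem_rcons mem_head.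
have hfs1 a : a \in fs1 -> P a.
  by move=> ha; apply: hfs; rewrite efs mem_cat mem_rcons inE ha orbT.
have [u [hu]] := h2 _ hf; rewrite idadd_cat => /(idadd_split h1) [].
  move=> [ds1 [d [ds2 [b [eds hb hI]]]]].
  set I := idadd (idadd z0 fs1) (ds1 ++ ds2) in hI.
  have idI : is_ideal I by do 2?apply: idadd_ideal.
  have hd : P d by apply: h1; rewrite eds mem_cat mem_head orbT.
  have hds12 a : a \in ds1 ++ ds2 -> P a.
    by move=> ha; apply: h1; rewrite eds; move: ha; rewrite !mem_cat inE => /orP[] ->; rewrite ?orbT.
  have hreg : regT (off P) z0 (rcons (fs1 ++ ds1 ++ ds2) d).
    apply: regT_local_perm h3 => //.
      by move=> a; rewrite mem_cat => /orP[/hfs1|/h1].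
    by apply/seq.permP => p; rewrite eds -cats1 !count_cat /=; lia.
  have hI' : idadd z0 (fs1 ++ ds1 ++ ds2) = I by rewrite idadd_cat.
  move: hreg; rewrite -cats1 => /regT_cat [hreg]; rewrite hI' => -[hdnz _].
  have hfnz : nzd (off P) I f.
    move=> x [v [hv hx]]; apply: hdnz; apply: (satM OM hb); exists v; split=> //.
    have -> : v * (b * (d * x)) = u * (v * (f * x)) - v * x * (u * f - b * d) by ring.
    by apply: idealB => //; apply: idealM.
  exists (ds1 ++ ds2); split=> //; last first.
    apply: (@regT_local_perm P (rcons (fs1 ++ ds1 ++ ds2) f)) => //.
    - move=> a; rewrite mem_rcons inE mem_cat => /orP[/eqP->//|/orP[/hfs1//|/hds12//]].
    - by apply/seq.permP => p; rewrite -!cats1 !count_cat /=; lia.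
    - by rewrite -cats1 regT_cat hI'; split=> //; split.
  move=> x hx.
  have -> : idadd z0 (rcons fs1 f ++ ds1 ++ ds2) = isum I f.
    by rewrite idadd_cat idadd_rcons idadd_isum.
  have [v [hv hvx]] := h2 _ hx.
  have : isum I d (v * x).
    by move: hvx; rewrite eds !idadd_cat /= idadd_isum /I idadd_cat.
  case=> r hr; exists (b * v); split; first exact: OM.
  exists (r * u); have -> : b * v * x - r * u * f = b * (v * x - r * d) - r * (u * f - b * d) by ring.
  by apply: idealB => //; apply: idealM.
(* No generator can be exchanged for [f]: then [u * f] is a combination of [fs1] plus an element of
   the square of [P], which contradicts independence as [u] is outside [P]. *)
move=> [z []] /idadd0P [cs [hcs e] hz]; case: hu.
apply: (hind (map -%R cs ++ u :: nseq (size fs2) 0)).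
- by rewrite efs !size_cat /= size_map size_nseq size_rcons hcs addSnnS.
- rewrite efs cat_rcons lcomb_cat ?size_map // lcombN -e lcomb_cons lcomb0.
  by have -> : - (u * f - z) + (u * f + 0) = z by ring.
- by rewrite mem_cat mem_head orbT.
Qed.

(** At a prime containing [s], the regular sequence [s] gives a chain of length [eta + 1], more than
    the height allows. At any other prime [fs] extends to a regular system of generators of the
    maximal ideal, and the added elements generate it modulo [fs]; their number is bounded by the
    height because they are regular modulo [fs]. *)
Theorem serre_criterion eta fs s : locally_regular -> size s = eta.+1 ->
  reg (idadd (@zeroid R) fs) s ->
  (forall P, is_prime P -> (forall f, f \in fs -> P f) ->
     (forall a, a \in s -> P a) \/ indep_mod_sq P fs) ->
  serre_R eta (in_ideal fs).
Proof.
move=> hL hs hreg hJac P hP hJP h leh [hch hnch].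
have O1 := off1 hP; have OM := offM hP.
have idP : is_ideal P by case: hP.
have eJ : in_ideal fs = idadd (@zeroid R) fs by apply: predext => x; exact: in_idealE.
have idJ : is_ideal (in_ideal fs) by rewrite eJ; apply/idadd_ideal/zeroid_ideal.
have hfs f : f \in fs -> P f.
  by move=> hf; apply: hJP; apply/in_idealE; apply: idadd_gen => //; exact: zeroid_ideal.
case: (hJac P hP hfs) => [hsP|hind].
  case: hnch; apply: (@prime_chain_le _ _ (size s)); first by rewrite hs.
  apply: prime_chain_reg => //; rewrite eJ.
  apply: (@regT_T _ (fun u => u = 1)) hreg => //; first by rewrite -eJ.
  by move=> u ->.
have [ds [h1 h2 h3]] := extend_regular hL hP hfs hind.
have lt : (size ds <= h)%N.
  rewrite leqNgt; apply/negP => lt; apply: hnch; apply: prime_chain_le lt _.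
  by apply: prime_chain_reg => //; rewrite eJ; case/regT_cat: h3.
(* The number of generators must be exactly [h], while only [size ds <= h] is known; zeros fill the
   gap. *)
exists (ds ++ nseq (h - size ds) 0); rewrite size_cat size_nseq subnKC //; split=> //; split.
  move=> a; rewrite mem_cat => /orP[/h1//|]; rewrite mem_nseq => /andP[_ /eqP->]; exact: ideal0.
move=> x /h2 [u [hu]]; rewrite idadd_cat -eJ => /idaddP [cs [hcs hJ]].
exists u; split=> //; exists (u * x - lcomb cs ds), (cs ++ nseq (h - size ds) 0).
rewrite !size_cat !size_nseq hcs; split=> //; split=> //.
rewrite -[LHS](subrK (lcomb cs ds)); congr (_ + _).
have -> : \sum_(i < size ds + (h - size ds))
    (cs ++ nseq (h - size ds) 0)`_i * (ds ++ nseq (h - size ds) 0)`_i =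
  lcomb (cs ++ nseq (h - size ds) 0) (ds ++ nseq (h - size ds) 0).
  rewrite /lcomb (big_nth (0, 0)) size_zip !size_cat !size_nseq hcs minnn big_mkord.
  by apply: eq_bigr => i _; rewrite nth_zip // !size_cat !size_nseq hcs.
by rewrite lcomb_cat // lcomb0 addr0.
Qed.

End Chains.

(** * Local regularity of polynomial rings *)

Lemma noeth_field (K : fieldType) : noeth K.
Proof.
move=> a; have [a0|a0] := eqVneq (a 0%N) 0; first by exists 0%N; rewrite a0.
exists 1%N; rewrite /=; exists (a 1%N / a 0%N).
by rewrite mulfVK // subrr.
Qed.

Lemma locally_regular_field (K : fieldType) : locally_regular K.
Proof.
move=> P hP; exists [::]; split=> // x hx.
have -> : x = 0.
  apply/eqP; apply/negPn/negP => x0; case: hP => idP [P1 _]; apply: P1.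
  by rewrite -(mulVf x0); apply: idealM.
by apply: sat_sub; first exact: off1.
Qed.

Section PolyRegular.
Variable A : comNzRingType.

Definition polyid (I : A -> Prop) : {poly A} -> Prop := fun f => forall i, I f`_i.

Lemma polyid_ideal I : is_ideal I -> is_ideal (polyid I).
Proof.
move=> hI; split; first by move=> i; rewrite coef0; exact: ideal0.
split=> [x y hx hy i|r x hx i]; first by rewrite coefD; apply: idealD.
by rewrite coefM; apply: ideal_sum => // j _; apply: idealM.
Qed.

Lemma polyid_idadd (I : A -> Prop) s f : is_ideal I ->
  polyid (idadd I s) f -> idadd (polyid I) (map polyC s) f.
Proof.
elim: s I f => //= a s IH I f hI h.
have hs : is_ideal (idadd (isum (polyid I) a%:P) (map polyC s)).
  by apply/idadd_ideal/isum_ideal/polyid_ideal.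
apply: (@idadd_mono _ (polyid (isum I a))); last by apply: IH => //; apply: isum_ideal.
move=> g hg.
have hx i : exists r, I (g`_i - r * a) by apply: hg.
have [r hr] := fin_all_exists (fun i : 'I_(size g) => hx i).
exists (\poly_(i < size g) (if insub i is Some j then r j else 0)) => i.
rewrite coefB coefMC coef_poly; case: ltnP => hi; first by rewrite insubT; apply: (hr (Ordinal hi)).
by rewrite mul0r subr0 nth_default //; exact: ideal0.
Qed.

Lemma idadd_polyid (I : A -> Prop) s f : is_ideal I ->
  idadd (polyid I) (map polyC s) f -> polyid (idadd I s) f.
Proof.
move=> hI; have hs : is_ideal (idadd I s) by apply: idadd_ideal.
apply: idadd_min; first exact: polyid_ideal.
  by move=> g hg i; apply: idadd_sub.
move=> _ /mapP[a ha ->] i; rewrite coefC; case: eqP => _; last exact: ideal0.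
exact: idadd_gen.
Qed.

Lemma polyid_sat T (I : A -> Prop) f : T 1 -> (forall u v, T u -> T v -> T (u * v)) ->
  is_ideal I -> polyid (sat T I) f -> exists u, T u /\ polyid I (u%:P * f).
Proof.
move=> T1 TM hI hf.
suff [u [hu h]] : exists u, T u /\ forall i, (i < size f)%N -> I (u * f`_i).
  exists u; split=> // i; rewrite coefCM; case: (ltnP i (size f)) => hi; first exact: h.
  by rewrite nth_default // mulr0; exact: ideal0.
elim: (size f) => [|k [u [hu h]]]; first by exists 1.
have [v [hv hk]] := hf k; exists (u * v); split; first exact: TM.
move=> i; rewrite ltnS leq_eqVlt => /orP[/eqP->|hi].
  by rewrite -mulrA; apply: idealM.
by rewrite [u * v]mulrC -mulrA; apply: idealM => //; apply: h.
Qed.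

Lemma polyid_prime P : is_prime P -> is_prime (polyid P).
Proof.
move=> [idP [P1 hP]]; split; first exact: polyid_ideal.
split; first by move=> /(_ 0%N); rewrite coefC.
move=> f g hfg; apply: NNPP => hn.
have first_out (h : {poly A}) : ~ polyid P h -> exists i, ~ P h`_i /\ forall j, (j < i)%N -> P h`_j.
  move=> hh; have [|i [hi hmin]] := @exists_min _ id (fun i => ~ P h`_i).
    by apply: NNPP => hno; apply: hh => i; apply: NNPP => hi; apply: hno; exists i.
  exists i; split=> // j hj; apply: NNPP => hPj; have := hmin _ hPj; lia.
have [i [hi hi']] := first_out f (fun h => hn (or_introl h)).
have [j [hj hj']] := first_out g (fun h => hn (or_intror h)).
have := hfg (i + j)%N; rewrite coefM.
have hio : (i < (i + j).+1)%N by lia.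
rewrite (bigD1 (Ordinal hio)) //= addKn addrC => h.
have: P (f`_i * g`_j).
  rewrite -(idealDl idP _ _ : _ <-> _); first exact: h.
  apply: ideal_sum => // k /negP hk.
  case: (ltngtP k i) => hki.
  - by apply: idealMr => //; apply: hi'.
  - by apply: idealM => //; apply: hj'; have := ltn_ord k; lia.
  - by case: hk; apply/eqP/val_inj.
by case/hP.
Qed.

Lemma size_sub_lead (f : {poly A}) : f != 0 ->
  (size (f - lead_coef f *: 'X^((size f).-1))%R < size f)%N.
Proof.
move=> f0; have s0 : (0 < size f)%N by rewrite lt0n size_poly_eq0.
rewrite -[X in (_ < X)%N](prednK s0) ltnS.
apply/leq_sizeP => j hj; rewrite coefB coefZ coefXn.
have [->|ne] := eqVneq j (size f).-1; first by rewrite mulr1 lead_coefE subrr.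
rewrite mulr0 subr0 nth_default // -(prednK s0) ltn_neqAle eq_sym ne; exact: hj.
Qed.

(** Let [p] be the contraction of [P] to [A]. Either [P] is the extension of [p], or it contains
    some [q] of least size with leading coefficient outside [p]. Pseudo-division then shows that [p]
    and [q] generate [P] locally, and [q] is regular modulo [p] because the extension of [p] is
    prime and does not contain [q]. *)
Theorem locally_regular_poly : locally_regular A -> locally_regular {poly A}.
Proof.
move=> hA P hP; have [idP [P1 primeP]] := hP.
have O1 := off1 hP; have OM := offM hP.
pose p a := P a%:P.
have idp : is_ideal p.
  split; first by rewrite /p polyC0; exact: ideal0.
  by split=> [x y|r x]; rewrite /p ?polyCD ?polyCM => *; [apply: idealD | apply: idealM].
have hp : is_prime p.
  split=> //; split; first by rewrite /p.
  by move=> x y; rewrite /p polyCM => /primeP.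
have o1 := off1 hp; have oM := offM hp.
have [cs [c1 c2 c3]] := hA p hp.
have sub f : polyid p f -> P f.
  move=> hf; rewrite -[f]coefK poly_def; apply: ideal_sum => // i _.
  by rewrite -mul_polyC; apply: idealMr => //; apply: hf.
have ez : polyid (@zeroid A) = @zeroid {poly A}.
  apply: predext => f; split=> [h|-> i]; last by rewrite coef0.
  by apply/polyP => i; rewrite coef0; apply: h.
have z0 := zeroid_ideal A.
have ids s : is_ideal (idadd (@zeroid A) s) by apply: idadd_ideal.
have hoff u : off p u -> off P u%:P by [].
have satC s f : polyid (sat (off p) (idadd (@zeroid A) s)) f ->
    sat (off P) (idadd (@zeroid _) (map polyC s)) f.
  move=> /(polyid_sat o1 oM (ids s)) [u [hu h]]; exists u%:P; split=> //.
  by rewrite -ez; apply: polyid_idadd.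
have gen f : polyid p f -> sat (off P) (idadd (@zeroid _) (map polyC cs)) f.
  by move=> hf; apply: satC => i; apply: c2.
have hreg : regT (off P) (@zeroid _) (map polyC cs).
  suff H s1 s2 : cs = s1 ++ s2 -> regT (off P) (@zeroid _) (map polyC s1) by apply: (H cs [::]); rewrite cats0.
  elim/last_ind: s1 s2 => // s1 c IH s2 ecs.
  rewrite map_rcons -cats1 regT_cat; split; first by apply: (IH (c :: s2)); rewrite ecs cat_rcons.
  split=> // f [u [hu h]].
  have {}h : polyid (idadd (@zeroid A) s1) (u * (c%:P * f)) by apply: idadd_polyid => //; rewrite ez.
  apply: (satM OM hu); apply: satC => i.
  move: c3; rewrite ecs => /regT_cat [+ _]; rewrite -cats1 => /regT_cat [_ [hc _]].
  apply: hc; apply: sat_sub => //; have := h i.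
  by rewrite mulrCA coefCM.
case: (classic (forall f, P f -> polyid p f)) => hall.
  by exists (map polyC cs); split=> // [_ /mapP[c hc ->]|f /hall]; [exact: c1 | exact: gen].
have ex : exists q, P q /\ ~ p (lead_coef q).
  apply: NNPP => hno; apply: hall => f.
  have [n] := ubnP (size f); elim: n f => // n IH f lef hf.
  have hl : p (lead_coef f) by apply: NNPP => h; apply: hno; exists f.
  have [->|f0] := eqVneq f 0; first by move=> i; rewrite coef0; exact: ideal0.
  pose g := f - lead_coef f *: 'X^((size f).-1).
  have szg : (size g < size f)%N by apply: size_sub_lead.
  have hg : polyid p g.
    apply: IH; first by lia.
    apply: idealB => //; rewrite -mul_polyC; exact: idealMr.
  move=> i; have := hg i; rewrite coefB coefZ coefXn => h.
  rewrite -(subrK (lead_coef f * (i == (size f).-1)%:R) f`_i); apply: idealD => //.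
  exact: idealMr.
have [q [[hq hlq] hmin]] := exists_min (fun q : {poly A} => size q) ex.
have q0 : q != 0 by apply: contra_notN hlq => /eqP ->; rewrite lead_coef0; exact: ideal0.
have key f : P f -> exists u r, off p u /\ polyid p (u%:P * f - r * q).
  have [n] := ubnP (size f); elim: n f => // n IH f lef hf.
  have [->|f0] := eqVneq f 0.
    by exists 1, 0; split=> // i; rewrite mulr0 mul0r subrr coef0; exact: ideal0.
  case: (classic (p (lead_coef f))) => hl.
    pose g := f - lead_coef f *: 'X^((size f).-1).
    have szg : (size g < size f)%N by apply: size_sub_lead.
    have [||u [r [hu h]]] := IH g; first by lia.
      by apply: idealB => //; rewrite -mul_polyC; exact: idealMr.
    exists u, r; split=> //; have hpp := polyid_ideal idp.
    have -> : u%:P * f - r * q = (u%:P * g - r * q) + u%:P * (lead_coef f *: 'X^((size f).-1)).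
      by rewrite /g; ring.
    apply: (idealD hpp) => //; apply: (idealM hpp) => i; rewrite coefZ; exact: idealMr.
  have leqf : (size q <= size f)%N := hmin f (conj hf hl).
  pose g := (lead_coef q)%:P * f - (lead_coef f)%:P * 'X^(size f - size q) * q.
  have szg : (size g < size f)%N.
    rewrite -[X in (_ < X)%N](@prednK (size f)) ?lt0n ?size_poly_eq0 // ltnS.
    apply/leq_sizeP => j hj; rewrite coefB coefCM -mulrA coefCM coefXnM.
    have sq : (0 < size q)%N by rewrite lt0n size_poly_eq0.
    rewrite ifF; last by lia.
    have [ej|nej] := eqVneq j (size f).-1.
      have -> : (j - (size f - size q) = (size q).-1)%N by lia.
      by rewrite ej -!lead_coefE mulrC subrr.
    have hfj : (size f <= j)%N by rewrite -(prednK (leq_trans sq leqf)) ltn_neqAle eq_sym nej hj.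
    have -> : q`_(j - (size f - size q)) = 0.
      by apply: nth_default; move: (size f) (size q) hfj leqf => a b; lia.
    by rewrite [f`_j]nth_default // !mulr0 subrr.
  have [||u [r [hu h]]] := IH g; first by lia.
    by apply: idealB => //; apply: idealM.
  exists (u * lead_coef q), (r + u%:P * ((lead_coef f)%:P * 'X^(size f - size q))); split.
    by apply: oM.
  congr (polyid p _): h; rewrite /g polyCM; ring.
exists (rcons (map polyC cs) q); split.
- move=> c; rewrite mem_rcons inE => /orP[/eqP->//|/mapP[a ha ->]]; exact: c1.
- move=> f /key [u [r [hu h]]].
  have [v [hv h']] := gen _ h; exists (v * u%:P); split; first by apply: OM => //; apply: hoff.
  rewrite idadd_rcons; exists (v * r); congr (idadd _ _ _): h'; ring.
rewrite -cats1 regT_cat; split=> //; split=> // f [u [hu h]].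
apply: gen.
have : polyid p (u * (q * f)).
  have {}h : polyid (idadd (@zeroid A) cs) (u * (q * f)) by apply: idadd_polyid => //; rewrite ez.
  by move=> i; apply: idadd_min (h i) => // x ->; exact: ideal0.
have [_ [_ pp]] := polyid_prime hp.
move=> /pp [/sub//|/pp [h'|//]]; case: hlq; exact: h'.
Qed.

End PolyRegular.

Lemma noeth_mpoly (K : fieldType) n : noeth (Defs.mpoly K n).
Proof. by elim: n => [|n IH] /=; [exact: noeth_field | exact: noeth_poly]. Qed.

Lemma locally_regular_mpoly (K : fieldType) n : locally_regular (Defs.mpoly K n).
Proof.
by elim: n => [|n IH] /=; [exact: locally_regular_field | exact: locally_regular_poly].
Qed.

(** * Strength *)

Lemma mem_zip (S T : eqType) (s : seq S) (t : seq T) x y :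
  (x, y) \in zip s t -> (x \in s) && (y \in t).
Proof.
elim: s t => [|a s IH] [|b t] //=; rewrite !inE xpair_eqE.
by move=> /orP[/andP[-> ->]|/IH /andP[-> ->]] //; rewrite !orbT.
Qed.

Section Strength.
Variables (K : fieldType) (n : nat).
Local Notation R := {mpoly K[n]}.
Implicit Types (f g : R) (E F : seq (nat * R)) (c : seq K).

(* [weak s d f]: the strength of the degree-[d] form [f] is less than [s]. *)
Definition weak (s d : nat) f := exists ps : seq (nat * (R * R)),
  [/\ (size ps <= s)%N,
      forall p, p \in ps -> [/\ (0 < p.1)%N, (p.1 < d)%N,
        p.2.1 \is p.1.-homog & p.2.2 \is (d - p.1).-homog] &
      f = \sum_(p <- ps) p.2.1 * p.2.2].

(** Forms carry their degree as a label, since the zero form is homogeneous of every degree. *)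
Definition wf (D : nat) E := forall e, e \in E ->
  [/\ (0 < e.1)%N, (e.1 <= D)%N & e.2 \is e.1.-homog].

Definition lc c E : R := \sum_(p <- zip c E) p.1 *: p.2.2.

Definition degs_in c E d := forall p, p \in zip c E -> p.1 != 0 -> p.2.1 = d.

(** Since [0] is weak for every [s], a strong system is linearly independent in each degree; in
    degree 1 this is all that is demanded. *)
Definition strong s E := forall c d, size c = size E -> degs_in c E d ->
  weak s d (lc c E) -> forall x, x \in c -> x = 0.

Lemma weak_le s s' d f : (s <= s')%N -> weak s d f -> weak s' d f.
Proof. by move=> h [ps [h1 h2 h3]]; exists ps; split=> //; apply: leq_trans h. Qed.

Lemma strong_le s s' E : (s <= s')%N -> strong s' E -> strong s E.
Proof. by move=> h hE c d h1 h2 /(weak_le h); apply: hE. Qed.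

Lemma weak0 s d : weak s d 0.
Proof. by exists [::]; rewrite big_nil. Qed.

Lemma weakD s t d f g : weak s d f -> weak t d g -> weak (s + t) d (f + g).
Proof.
move=> [p [p1 p2 ->]] [q [q1 q2 ->]]; exists (p ++ q); split.
- by rewrite size_cat leq_add.
- by move=> x; rewrite mem_cat => /orP[/p2|/q2].
- by rewrite big_cat.
Qed.

Lemma weakM d k g h : (0 < k < d)%N -> g \is k.-homog -> h \is (d - k).-homog ->
  weak 1 d (g * h).
Proof.
move=> /andP[h1 h2] h3 h4; exists [:: (k, (g, h))]; split=> //; last by rewrite big_seq1.
by move=> p; rewrite inE => /eqP ->.
Qed.

Lemma lc_cat c1 c2 E1 E2 : size c1 = size E1 -> lc (c1 ++ c2) (E1 ++ E2) = lc c1 E1 + lc c2 E2.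
Proof. by move=> h; rewrite /lc zip_cat // big_cat. Qed.

Lemma lc_cons a c e E : lc (a :: c) (e :: E) = a *: e.2 + lc c E.
Proof. by rewrite /lc /= big_cons. Qed.

Lemma lc0 c E : (forall x, x \in c -> x = 0) -> lc c E = 0.
Proof.
move=> h; rewrite /lc big_seq big1 // => -[x e] /mem_zip /andP[].
by move=> /h -> _; rewrite scale0r.
Qed.

Lemma degs_in_cat c1 c2 E1 E2 d : size c1 = size E1 ->
  degs_in (c1 ++ c2) (E1 ++ E2) d <-> degs_in c1 E1 d /\ degs_in c2 E2 d.
Proof.
move=> h; rewrite /degs_in zip_cat //; split.
  by move=> H; split=> p hp; apply: H; rewrite mem_cat hp ?orbT.
by move=> [H1 H2] p; rewrite mem_cat => /orP[/H1|/H2].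
Qed.

Lemma degs_in0 c E d : (forall x, x \in c -> x = 0) -> degs_in c E d.
Proof. by move=> h [x e] /mem_zip /andP[/h -> _]; rewrite eqxx. Qed.

Inductive alg (S : R -> Prop) : R -> Prop :=
| algC a : alg S a%:MP
| alg_gen f : S f -> alg S f
| algD f g : alg S f -> alg S g -> alg S (f + g)
| algM f g : alg S f -> alg S g -> alg S (f * g).

Lemma alg_trans (S S' : R -> Prop) f : (forall g, S g -> alg S' g) -> alg S f -> alg S' f.
Proof. by move=> h; elim=> *; [exact: algC | exact: h | exact: algD | exact: algM]. Qed.

Lemma alg_mono (S S' : R -> Prop) f : (forall g, S g -> S' g) -> alg S f -> alg S' f.
Proof. by move=> h; apply: alg_trans => g /h; apply: alg_gen. Qed.

Lemma algZ S a f : alg S f -> alg S (a *: f).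
Proof. by move=> h; rewrite -mul_mpolyC; apply: algM => //; apply: algC. Qed.

Lemma alg0 S : alg S 0.
Proof. by rewrite -(mpolyC0 n K); apply: algC. Qed.

Lemma alg_sum S (I : eqType) (r : seq I) (F : I -> R) :
  (forall i, i \in r -> alg S (F i)) -> alg S (\sum_(i <- r) F i).
Proof.
move=> h; rewrite big_seq; apply: (big_ind (alg S)) => //; [exact: alg0 | exact: algD].
Qed.

(** The degree bound records that a form of degree [k] is rewritten without generators of larger
    degree; the search for fresh variables depends on this. *)
Definition gens E k : R -> Prop := fun f => exists d, (d, f) \in E /\ (d <= k)%N.

Lemma gens_mono E k k' f : (k <= k')%N -> gens E k f -> gens E k' f.
Proof. by move=> h [d [h1 h2]]; exists d; split=> //; apply: leq_trans h. Qed.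

Lemma alg_lc S c E d : degs_in c E d ->
  (forall e, e \in E -> e.1 = d -> alg S e.2) -> alg S (lc c E).
Proof.
move=> hd h; apply: alg_sum => -[x e] hp /=.
have [->|x0] := eqVneq x 0; first by rewrite scale0r; exact: alg0.
apply: algZ; apply: h; last exact: (hd _ hp).
by case/mem_zip/andP: hp.
Qed.

End Strength.

Section FiniteMax.

(** This is how thresholds found for each list of degrees become thresholds for all lists of bounded
    length. *)
Lemma fin_uniform (I : finType) (Q : I -> nat -> nat -> Prop) :
  (forall i s s' N N', (s <= s')%N -> (N <= N')%N -> Q i s N -> Q i s' N') ->
  (forall i, exists s N, Q i s N) -> exists s N, forall i, Q i s N.
Proof.
move=> mono /fin_all_exists [s /fin_all_exists [N h]].
exists (\max_i s i)%N, (\max_i N i)%N => i; apply: mono (h i); exact: leq_bigmax.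
Qed.

(* One step of the multiset order on degrees, which makes the refinement of a system
   by the factors of its weak combinations terminate. *)
Definition replaced (m l : seq nat) := exists l1 d l2 m',
  [/\ l = l1 ++ d :: l2, m = l1 ++ m' ++ l2 & forall x, x \in m' -> (x < d)%N].

(** A step on [d :: l] either acts inside [l] or replaces [d] by smaller entries. The first kind is
    covered by accessibility of [l], the second by induction on [d], adding the new entries one at a
    time. *)
Lemma replaced_wf : well_founded replaced.
Proof.
have key d : forall l, Acc replaced l -> Acc replaced (d :: l).
  elim/ltn_ind: d => d IH l hl; elim: hl => {}l hl IHl.
  apply: Acc_intro => m.
  move=> [[|d' l1] [e [l2 [m' [/= [e1 e2] -> hm]]]]].
    rewrite /= {m}; subst.
    have hl2 : Acc replaced l2 by apply: Acc_intro.
    elim: m' hm => [_|x m' IHm hm] /=; first exact: hl2.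
    apply: IH; first by apply: hm; rewrite mem_head.
    by apply: IHm => y hy; apply: hm; rewrite inE hy orbT.
  by subst=> /=; apply: IHl; exists l1, e, l2, m'.
by elim=> [|d l IH]; [apply: Acc_intro => m [[|? ?] [? [? [? []]]]] | exact: key].
Qed.

End FiniteMax.

Section Refine.
Variables (D : nat) (sigma : nat -> nat).

(** [E] is a part already strong that has to survive the refinement. The final strength is [sigma]
    of the final size, whereas [s] and [N] may depend only on the list of degrees. *)
Definition refinable rE (fs : seq nat) s N :=
  forall (K : closedFieldType) n (E F : seq (nat * {mpoly K[n]})),
  (size E <= rE)%N -> wf D E -> [seq e.1 | e <- F] = fs -> wf D F -> strong s E ->
  exists F', [/\ wf D F', (size F' <= N)%N, strong (sigma (size E + size F')) (E ++ F') &
    forall f, f \in F -> alg (gens (E ++ F') f.1) f.2].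

Lemma refinable_le rE fs s s' N N' : (s <= s')%N -> (N <= N')%N ->
  refinable rE fs s N -> refinable rE fs s' N'.
Proof.
move=> hs hN h K n E F h1 h2 h3 h4 h5.
have [F' [f1 f2 f3 f4]] := h K n E F h1 h2 h3 h4 (strong_le hs h5).
by exists F'; split=> //; apply: leq_trans hN.
Qed.

Lemma refine_exact rE fs : exists s N, refinable rE fs s N.
Proof.
elim/(well_founded_ind replaced_wf): fs => fs IH.
(* The most that can be demanded if [F] is kept as it is. A combination failing it is a sum of at
   most [s0] products, so at most [2 * s0] factors replace one form; this leaves finitely many
   degree lists [fs']. *)
pose s0 := (\max_(e < rE.+1) sigma (e + size fs))%N.
pose fs' (x : 'I_(size fs) * (2 * s0)%N.-bseq 'I_D.+1) :=
  take x.1 fs ++ map val x.2 ++ drop x.1.+1 fs.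
pose ok (x : 'I_(size fs) * (2 * s0)%N.-bseq 'I_D.+1) :=
  all (fun k : 'I_D.+1 => (k < nth 0%N fs x.1)%N) x.2.
have [||s [N hsN]] := @fin_uniform _ (fun x s N => ok x -> refinable rE (fs' x) s N).
- by move=> x s s' N N' hs hN h /h; apply: refinable_le.
- move=> x; case hok: (ok x); last by exists 0%N, 0%N.
  have [|s [N h]] := IH (fs' x); last by exists s, N.
  exists (take x.1 fs), (nth 0%N fs x.1), (drop x.1.+1 fs), (map val x.2).
  split=> //; first by rewrite -drop_nth ?cat_take_drop.
  by move=> k /mapP[j hj ->]; apply: (allP hok).
exists (maxn s0 s), (maxn (size fs) N) => K n E F hE wE hF wF sE.
have szF : size F = size fs by rewrite -hF size_map.
have sigs0 : (sigma (size E + size F) <= s0)%N.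
  have := @leq_bigmax _ (fun e : 'I_rE.+1 => sigma (e + size fs)) (inord (size E)).
  by rewrite inordK ?ltnS // szF.
case: (classic (strong (sigma (size E + size F)) (E ++ F))) => [hs|].
  exists F; split=> //; first by rewrite szF leq_maxl.
  by move=> [k f] hf; apply: alg_gen; exists k; rewrite mem_cat hf orbT.
move=> hns; apply: NNPP => hno; apply: hns => c d szc hc wk.
rewrite -(cat_take_drop (size E) c) in hc wk *.
set c1 := take _ _ in hc wk *; set c2 := drop _ _ in hc wk *.
have szc1 : size c1 = size E by rewrite size_takel // szc size_cat leq_addr.
have szc2 : size c2 = size F by rewrite size_drop szc size_cat addKn.
move: hc wk; rewrite (degs_in_cat _ _ _ szc1) (lc_cat _ _ szc1) => -[hc1 hc2] wk.
(* The weak combination must involve [F], because [E] by itself has strength at least [s0]. A form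
   of [F] that occurs is then solved for. *)
case: (classic (forall x, x \in c2 -> x = 0)) => h2.
  move: wk; rewrite [lc c2 F]lc0 // addr0 => wk x; rewrite mem_cat => /orP[|/h2 //].
  apply: (sE c1 d) => //; apply: weak_le wk; apply: leq_trans sigs0 _; exact: leq_maxl.
case: hno.
have [x [hx x0]] : exists x, x \in c2 /\ x != 0.
  apply: NNPP => hn; apply: h2 => y hy; apply/eqP; apply/negPn/negP => y0; apply: hn; by exists y.
pose i := index x c2; have lti : (i < size c2)%N by rewrite index_mem.
have ltiF : (i < size F)%N by rewrite -szc2.
pose f := nth (0%N, 0) F i.
have eF : F = take i F ++ f :: drop i.+1 F by rewrite -drop_nth // cat_take_drop.
have ec : c2 = take i c2 ++ x :: drop i.+1 c2.
  by rewrite -[X in _ ++ X :: _](nth_index 0 hx) -drop_nth // cat_take_drop.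
set F1 := take i F in eF; set F2 := drop _ F in eF.
set d1 := take i c2 in ec; set d2 := drop _ c2 in ec.
have szd1 : size d1 = size F1 by rewrite !size_take szc2.
have fF : f \in F by rewrite eF mem_cat mem_head orbT.
have [_ fD fh] := wF _ fF.
have hfd : f.1 = d.
  apply: (hc2 (x, f)) => //; rewrite {1}ec {1}eF zip_cat // mem_cat /= inE eqxx.
  by rewrite orbT.
have [ps [ps1 ps2 ps3]] := weak_le sigs0 wk.
pose gh := flatten [seq [:: (p.1, p.2.1); ((d - p.1)%N, p.2.2)] | p <- ps].
have ghP e : e \in gh -> [/\ (0 < e.1)%N, (e.1 < d)%N & e.2 \is e.1.-homog].
  move=> /flatten_mapP[[k [g h]] /ps2 /= [h3 h4 h5 h6]]; rewrite !inE => /orP[] /eqP -> //=.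
  by split; [rewrite subn_gt0 | rewrite ltn_subrL h3 (leq_ltn_trans _ h4) |].
have szgh : (size gh <= 2 * s0)%N.
  rewrite size_flatten /shape -map_comp (eq_map (g := fun _ => 2)) //.
  rewrite (_ : sumn _ = 2 * size ps)%N ?leq_mul2l ?orbT //=.
  by elim: (ps) => //= a l ->; lia.
have dD : (d <= D)%N by rewrite -hfd.
pose m := [seq inord e.1 : 'I_D.+1 | e <- gh].
have szm : (size m <= 2 * s0)%N by rewrite size_map.
have hio : (i < size fs)%N by rewrite -szF.
have em : map val m = [seq e.1 | e <- gh].
  rewrite /m -map_comp; apply/eq_in_map => e /ghP [_ he _] /=; rewrite inordK //.
  by rewrite ltnS (leq_trans (ltnW he)).
pose X := (Ordinal hio, Bseq szm).
have okX : ok X.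
  apply/allP => k hk /=; have : val k \in map val m by apply: map_f.
  rewrite em => /mapP[e /ghP [_ he _] ->].
  by rewrite -hF (nth_map (0%N, 0)) // -/f hfd.
have [|||F' [f1 f2 f3 f4]] := hsN X okX K n E (F1 ++ gh ++ F2) hE wE.
- by rewrite !map_cat -em /fs' /= -hF map_take map_drop.
- move=> e; rewrite !mem_cat => /orP[/mem_take /wF //|/orP[/ghP[h3 h4 h5]|/mem_drop/wF //]].
  by split=> //; rewrite (leq_trans (ltnW h4)).
- by apply: strong_le sE; exact: leq_maxr.
exists F'; split=> //; first by rewrite (leq_trans f2) ?leq_maxr.
move=> e; rewrite {1}eF mem_cat inE => /orP[he|/orP[/eqP->|he]]; last first.
- by apply: f4; rewrite !mem_cat he !orbT.
- have -> : f.2 = x^-1 *: (\sum_(p <- ps) p.2.1 * p.2.2 - lc c1 E - lc d1 F1 - lc d2 F2).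
    rewrite -ps3 ec eF lc_cat // lc_cons.
    have -> : lc c1 E + (lc d1 F1 + (x *: f.2 + lc d2 F2)) - lc c1 E - lc d1 F1 - lc d2 F2 = x *: f.2 by ring.
    by rewrite scalerA mulVf // scale1r.
  rewrite hfd; apply: algZ.
  have algB S (u v : {mpoly K[n]}) : alg S u -> alg S v -> alg S (u - v).
    by move=> hu hv; apply: algD => //; rewrite -scaleN1r; apply: algZ.
  move: hc2; rewrite {1}ec {1}eF (degs_in_cat _ _ _ szd1) => -[hd1 hd2].
  apply: (algB); [apply: (algB); [apply: (algB) |] |].
  + apply: alg_sum => p hp; have [h3 h4 _ _] := ps2 _ hp.
    apply: algM.
      apply: (alg_mono (S := gens (E ++ F') p.1)); first by move=> g; apply: gens_mono; apply: ltnW.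
      apply: (f4 (p.1, p.2.1)); rewrite !mem_cat (_ : _ \in gh) ?orbT //.
      by apply/flatten_mapP; exists p => //; rewrite mem_head.
    apply: (alg_mono (S := gens (E ++ F') (d - p.1))); first by move=> g; apply: gens_mono; lia.
    apply: (f4 ((d - p.1)%N, p.2.2)); rewrite !mem_cat (_ : _ \in gh) ?orbT //.
    by apply/flatten_mapP; exists p => //; rewrite !inE eqxx orbT.
  + apply: (alg_lc hc1) => -[k e'] he /= ek; subst k; apply: alg_gen; exists d.
    by rewrite mem_cat he.
  + apply: (alg_lc hd1) => e' he <-; apply: f4; by rewrite !mem_cat he.
  + apply: (@alg_lc _ _ _ d2 F2 d) => [p hp|e' he <-].
      by apply: hd2; rewrite /= inE hp orbT.
    by apply: f4; rewrite !mem_cat he !orbT.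
- by apply: f4; rewrite !mem_cat he.
Qed.

Lemma refine rE g : exists s N,
  forall (K : closedFieldType) n (E F : seq (nat * {mpoly K[n]})),
  (size E <= rE)%N -> (size F <= g)%N -> wf D E -> wf D F -> strong s E ->
  exists F', [/\ wf D F', (size F' <= N)%N, strong (sigma (size E + size F')) (E ++ F') &
    forall f, f \in F -> alg (gens (E ++ F') f.1) f.2].
Proof.
have [||s [N hsN]] := @fin_uniform _ (fun (x : g.-bseq 'I_D.+1) s N => refinable rE (map val x) s N).
- by move=> x s s' N N' hs hN; apply: refinable_le.
- by move=> x; apply: refine_exact.
exists s, N => K n E F h1 h2 wE wF sE.
have sz : (size [seq inord e.1 : 'I_D.+1 | e <- F] <= g)%N by rewrite size_map.
apply: (hsN (Bseq sz)) => //=.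
by rewrite -map_comp; apply/eq_in_map => e /wF [_ h _] /=; rewrite inordK.
Qed.

(* The elements of [M] may be dropped during the refinement; the condition on the weak
   combinations of [E] and [M] says that [E] is not involved when this happens. *)
Lemma soft_refine rE k g : exists s N,
  forall (K : closedFieldType) n (E M G : seq (nat * {mpoly K[n]})),
  (size E <= rE)%N -> (size M <= k)%N -> (size G <= g)%N ->
  wf D E -> wf D M -> wf D G -> strong s E ->
  (forall c1 c2 d, size c1 = size E -> size c2 = size M ->
     degs_in c1 E d -> degs_in c2 M d -> weak s d (lc c1 E + lc c2 M) ->
     forall x, x \in c1 -> x = 0) ->
  exists M' F', [/\ wf D (M' ++ F'), (size M' + size F' <= N)%N,
    strong (sigma (size E + size (M' ++ F'))) (E ++ M' ++ F'),
    forall m, m \in M ->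
      alg (fun f => gens M' m.1 f \/ gens (E ++ M' ++ F') m.1.-1 f) m.2 &
    forall f, f \in G -> alg (gens (E ++ M' ++ F') f.1) f.2].
Proof.
elim: k g => [|k IH] g.
  have [s [N h]] := refine rE g; exists s, N => K n E M G hE.
  rewrite leqn0 size_eq0 => /eqP -> hG wE _ wG sE _.
  by have [F' [f1 f2 f3 f4]] := h K n E G hE hG wE wG sE; exists [::], F'; split.
(* If [E ++ M] is already strong enough for this [s0], it is kept as the fixed part and only [G] is
   refined. Otherwise one element of [M] is dropped and its factors are added to [G]. *)
have [s0 [N0 h0]] := refine (rE + k.+1) g.
have [s1 [N1 h1]] := IH (g + 2 * s0)%N.
exists (maxn s0 s1), (maxn (k.+1 + N0) N1) => K n E M G hE hM hG wE wM wG sE hsoft.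
have wEM : wf D (E ++ M) by move=> e; rewrite mem_cat => /orP[/wE|/wM].
case: (classic (strong s0 (E ++ M))) => [hs|].
  have szEM : (size (E ++ M) <= rE + k.+1)%N by rewrite size_cat leq_add.
  have [F' [f1 f2 f3 f4]] := h0 K n (E ++ M) G szEM hG wEM wG hs.
  exists M, F'; rewrite !size_cat !catA; split=> //.
  - by move=> e; rewrite mem_cat => /orP[/wM|/f1].
  - by rewrite leq_max leq_add.
  - by move: f3; rewrite size_cat addnA.
  - by move=> [d m] hm; apply: alg_gen; left; exists d.
move=> hns; apply: NNPP => hno; apply: hns => c d szc hc wk.
rewrite -(cat_take_drop (size E) c) in hc wk *.
set c1 := take _ _ in hc wk *; set c2 := drop _ _ in hc wk *.
have szc1 : size c1 = size E by rewrite size_takel // szc size_cat leq_addr.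
have szc2 : size c2 = size M by rewrite size_drop szc size_cat addKn.
move: hc wk; rewrite (degs_in_cat _ _ _ szc1) (lc_cat _ _ szc1) => -[hc1 hc2] wk.
(* Here [E] drops out of the weak combination. The discarded element of [M] is thus expressed by
   other elements of [M] and by factors of smaller degree, without elements of [E] of its own
   degree. *)
have c10 : forall x, x \in c1 -> x = 0.
  by apply: (hsoft c1 c2 d) => //; apply: weak_le wk; exact: leq_maxl.
move: wk; rewrite lc0 // add0r => wk.
case: (classic (forall x, x \in c2 -> x = 0)) => h2.
  by move=> x; rewrite mem_cat => /orP[/c10|/h2].
case: hno.
have [x [hx x0]] : exists x, x \in c2 /\ x != 0.
  apply: NNPP => hn; apply: h2 => y hy; apply/eqP; apply/negPn/negP => y0; apply: hn; by exists y.
pose i := index x c2; have lti : (i < size c2)%N by rewrite index_mem.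
have ltiM : (i < size M)%N by rewrite -szc2.
pose f := nth (0%N, 0) M i.
have eM : M = take i M ++ f :: drop i.+1 M by rewrite -drop_nth // cat_take_drop.
have ec : c2 = take i c2 ++ x :: drop i.+1 c2.
  by rewrite -[X in _ ++ X :: _](nth_index 0 hx) -drop_nth // cat_take_drop.
set M1 := take i M in eM; set M2 := drop _ M in eM.
set d1 := take i c2 in ec; set d2 := drop _ c2 in ec.
have szd1 : size d1 = size M1 by rewrite !size_take szc2.
have fM : f \in M by rewrite eM mem_cat mem_head orbT.
have [_ fD fh] := wM _ fM.
have hfd : f.1 = d.
  apply: (hc2 (x, f)) => //; rewrite {1}ec {1}eM zip_cat // mem_cat /= inE eqxx.
  by rewrite orbT.
have [ps [ps1 ps2 ps3]] := wk.
pose gh := flatten [seq [:: (p.1, p.2.1); ((d - p.1)%N, p.2.2)] | p <- ps].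
have ghP e : e \in gh -> [/\ (0 < e.1)%N, (e.1 < d)%N & e.2 \is e.1.-homog].
  move=> /flatten_mapP[[l [g' h']] /ps2 /= [h3 h4 h5 h6]]; rewrite !inE => /orP[] /eqP -> //=.
  by split; [rewrite subn_gt0 | rewrite ltn_subrL h3 (leq_ltn_trans _ h4) |].
have szgh : (size gh <= 2 * s0)%N.
  rewrite size_flatten /shape -map_comp (eq_map (g := fun _ => 2)) //.
  rewrite (_ : sumn _ = 2 * size ps)%N ?leq_mul2l ?orbT //=.
  by elim: (ps) => //= a l ->; lia.
have dD : (d <= D)%N by rewrite -hfd.
have memM12 e : e \in M1 ++ M2 -> e \in M.
  by rewrite mem_cat => /orP[/mem_take|/mem_drop].
have [|||||||M' [F' [m1 m2 m3 m4 m5]]] := h1 K n E (M1 ++ M2) (G ++ gh) hE.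
- by move: hM; rewrite {1}eM !size_cat /= addnS ltnS.
- by rewrite size_cat leq_add.
- by [].
- by move=> e /memM12 /wM.
- move=> e; rewrite mem_cat => /orP[/wG //|/ghP[h3 h4 h5]].
  by split=> //; rewrite (leq_trans (ltnW h4)).
- by apply: strong_le sE; exact: leq_maxr.
- move=> a1 a2 d' sa1 sa2 ha1 ha2 wk'.
  apply: (hsoft a1 (take (size M1) a2 ++ 0 :: drop (size M1) a2) d') => //.
  + by rewrite size_cat /= addnS -size_cat cat_take_drop sa2 {1}eM !size_cat /= addnS.
  + have st : size (take (size M1) a2) = size M1 by rewrite size_takel // sa2 size_cat leq_addr.
    rewrite eM (degs_in_cat _ _ _ st).
    move: ha2; rewrite -{1}(cat_take_drop (size M1) a2) (degs_in_cat _ _ _ st) => -[h3 h4].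
    by split=> // p; rewrite /= inE => /orP[/eqP->|/h4 //]; rewrite eqxx.
  + have st : size (take (size M1) a2) = size M1 by rewrite size_takel // sa2 size_cat leq_addr.
    rewrite eM lc_cat // lc_cons scale0r add0r -lc_cat // cat_take_drop.
    apply: weak_le wk'; exact: leq_maxr.
exists M', F'; split=> //.
- by rewrite (leq_trans m2) // leq_maxr.
- move=> e; rewrite {1}eM mem_cat inE => /orP[he|/orP[/eqP->|he]]; last first.
  + by apply: m4; rewrite mem_cat he orbT.
  + have -> : f.2 = x^-1 *: (\sum_(p <- ps) p.2.1 * p.2.2 - lc d1 M1 - lc d2 M2).
      rewrite -ps3 ec eM lc_cat // lc_cons.
      have -> : lc d1 M1 + (x *: f.2 + lc d2 M2) - lc d1 M1 - lc d2 M2 = x *: f.2 by ring.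
      by rewrite scalerA mulVf // scale1r.
    rewrite hfd; apply: algZ.
    have algB S (u v : {mpoly K[n]}) : alg S u -> alg S v -> alg S (u - v).
      by move=> hu hv; apply: algD => //; rewrite -scaleN1r; apply: algZ.
    move: hc2; rewrite {1}ec {1}eM (degs_in_cat _ _ _ szd1) => -[hd1 hd2].
    apply: (algB); [apply: (algB) |].
    * apply: alg_sum => p hp; have [h3 h4 _ _] := ps2 _ hp.
      apply: algM.
        apply: (alg_mono (S := gens (E ++ M' ++ F') p.1)).
          by move=> g' hg'; right; apply: gens_mono hg'; move: h4; case: (d).
        apply: (m5 (p.1, p.2.1)); rewrite !mem_cat (_ : _ \in gh) ?orbT //.
        by apply/flatten_mapP; exists p => //; rewrite mem_head.
      apply: (alg_mono (S := gens (E ++ M' ++ F') (d - p.1))).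
        by move=> g' hg'; right; apply: gens_mono hg'; move: h3 h4; lia.
      apply: (m5 ((d - p.1)%N, p.2.2)); rewrite !mem_cat (_ : _ \in gh) ?orbT //.
      by apply/flatten_mapP; exists p => //; rewrite !inE eqxx orbT.
    * apply: (alg_lc hd1) => e' he <-; apply: m4; by rewrite mem_cat he.
    * apply: (@alg_lc _ _ _ d2 M2 d) => [p hp|e' he <-].
        by apply: hd2; rewrite /= inE hp orbT.
      by apply: m4; rewrite mem_cat he orbT.
  + by apply: m4; rewrite mem_cat he.
- by move=> e he; apply: m5; rewrite mem_cat he.
Qed.

End Refine.

(** * Graded and differential tools for multivariate polynomials *)

Section Tools.
Variables (A : comNzRingType) (n : nat).
Local Notation R := {mpoly A[n]}.

Lemma mpoly_scale_ind (Q : R -> Prop) : Q 0 -> (forall f g, Q f -> Q g -> Q (f + g)) ->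
  (forall (a : A) f, Q f -> Q (a *: f)) -> forall f,
  (forall m, m \in msupp f -> Q 'X_[m]) -> Q f.
Proof.
move=> Q0 QD QZ f h; rewrite [f]mpolyE big_seq; apply: (big_ind Q) => // m hm.
by apply: QZ; apply: h.
Qed.

Lemma mmap_graded (S : comNzRingType) (g : {rmorphism A -> S}) (h : 'I_n -> S)
    (H : nat -> S -> Prop) :
  (forall d, H d 0) -> (forall d x y, H d x -> H d y -> H d (x + y)) ->
  (forall d a x, H d x -> H d (g a * x)) -> H 0%N 1 -> (forall i, H 1%N (h i)) ->
  (forall d e x y, H d x -> H e y -> H (d + e)%N (x * y)) ->
  forall d f, f \is d.-homog -> H d (mmap g h f).
Proof.
move=> H0 HD HZ H1 Hh HM d f hf.
have Hm m : H (mdeg m) (mmap g h 'X_[m]).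
  rewrite mmapX /mmap1 mdegE; apply: (big_rec2 (fun d x => H d x)) => // i e x _ hx.
  apply: (HM) => //; elim: (m i) => [|k IH]; first by rewrite expr0.
  by rewrite exprS -add1n; apply: (HM).
apply: (@mpoly_scale_ind (fun f => H d (mmap g h f))).
- by rewrite raddf0.
- by move=> f1 f2; rewrite raddfD; apply: HD.
- by move=> a f1; rewrite mmapZ; apply: HZ.
- by move=> m hm; have := Hm m; rewrite (dhomog_mf hf hm).
Qed.

Lemma chain_rule (S : comNzRingType) (phi : {rmorphism R -> S}) (delta : R -> S) :
  (forall f g, delta (f + g) = delta f + delta g) ->
  (forall f g, delta (f * g) = delta f * phi g + phi f * delta g) ->
  (forall a : A, delta a%:MP = 0) ->
  forall f, delta f = \sum_i phi (f^`M(i)) * delta 'X_i.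
Proof.
move=> dD dM dC f.
have d1 : delta 1 = 0 by rewrite -mpolyC1.
apply: (@mpoly_scale_ind (fun f => delta f = \sum_i phi (f^`M(i)) * delta 'X_i)).
- rewrite -(mpolyC0 n A) dC big1 // => i _; by rewrite mderivC rmorph0 mul0r.
- move=> f1 f2 h1 h2; rewrite dD h1 h2 -big_split; apply: eq_bigr => i _ /=.
  by rewrite mderivD rmorphD mulrDl.
- move=> a f1 h1; rewrite -mul_mpolyC dM dC mul0r add0r h1 big_distrr /=.
  by apply: eq_bigr => i _; rewrite mderiv_mulC rmorphM mulrA.
move=> m _; move: m.
suff H k : forall m, mdeg m = k -> delta 'X_[m] = \sum_i phi ('X_[m])^`M(i) * delta 'X_i by move=> m; apply: H.
elim: k => [|k IH] m hm.
  move/eqP: hm; rewrite mdeg_eq0 => /eqP ->; rewrite mpolyX0 d1 big1 // => i _.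
  by rewrite -mpolyC1 mderivC rmorph0 mul0r.
have [j hj] : exists j, (0 < m j)%N.
  apply/existsP; apply: contraT => /existsPn h.
  have : mdeg m = 0%N by rewrite mdegE big1 // => i _; move: (h i); rewrite lt0n negbK => /eqP.
  by rewrite hm.
have em : m = (U_(j) + (m - U_(j)))%MM by rewrite addmC submK // lep1mP -lt0n.
rewrite {1}em mpolyXD dM (IH (m - U_(j))%MM); last first.
  by apply/eqP; rewrite -(eqn_add2l 1) -{1}(mdeg1 j) -mdegD -em hm add1n.
have -> : \sum_i phi (('X_[m] : R)^`M(i)) * delta 'X_i =
  \sum_i (phi (('X_j : R)^`M(i)) * phi 'X_[m - U_(j)] + phi 'X_j * phi (('X_[m - U_(j)] : R)^`M(i))) * delta 'X_i.
  by apply: eq_bigr => i _; rewrite {1}em mpolyXD mderivM rmorphD !rmorphM.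
under [in RHS]eq_bigr do rewrite mulrDl.
rewrite big_split /= big_distrr /=; congr (_ + _); last first.
  by apply: eq_bigr => i _; rewrite mulrA.
rewrite (bigD1 j) //= big1 ?addr0 => [|i ne].
  have e0 : (U_(j) - U_(j) = 0 :> 'X_{1..n})%MM by apply/mnmP => i; rewrite mnmBE mnm0E subnn.
  by rewrite mderivX mnm1E eqxx scale1r e0 mpolyX0 rmorph1 mul1r mulrC.
by rewrite mderivX mnm1E eq_sym (negbTE ne) scale0r rmorph0 !mul0r.
Qed.

Lemma pihomogM_homog d e (f z : R) : z \is e.-homog ->
  pihomog mdeg (d + e) (f * z) = pihomog mdeg d f * z.
Proof.
move=> hz; rewrite [f in LHS](pihomog_partitionE (leqnn (msize f))) mulr_suml raddf_sum /=.
have hom c : pihomog mdeg c f * z \is (c + e).-homog.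
  by apply: dhomogM => //; exact: pihomogP.
have [lt|ge] := ltnP d (msize f).
  rewrite (bigD1 (Ordinal lt)) //= pihomog_dE // big1 ?addr0 // => c ne.
  apply: (@pihomog_ne0 _ _ _ (c + e)%N) => //.
  by rewrite eqn_add2r; apply: contra ne => /eqP h; apply/eqP/val_inj.
rewrite big1 => [|c _].
  rewrite [X in _ = X * _](_ : _ = 0) ?mul0r // pihomogE big_seq_cond big1 // => m.
  move=> /andP[hm /eqP hd]; have := msize_mdeg_lt hm; rewrite hd ltnNge ge //.
apply: (@pihomog_ne0 _ _ _ (c + e)%N) => //.
by rewrite eqn_add2r; have := ltn_ord c; lia.
Qed.

Lemma pihomogM_lt d e (f z : R) : z \is e.-homog -> (d < e)%N ->
  pihomog mdeg d (f * z) = 0.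
Proof.
move=> hz lt; rewrite [f](pihomog_partitionE (leqnn (msize f))) mulr_suml raddf_sum /= big1 //.
move=> c _; have hom : pihomog mdeg c f * z \is (c + e).-homog.
  by apply: dhomogM => //; exact: pihomogP.
by apply: (@pihomog_ne0 _ _ _ (c + e)%N) => //; lia.
Qed.

Definition hid (I : R -> Prop) := is_ideal I /\ forall d f, I f -> I (pihomog mdeg d f).

Definition posform (z : R) := exists2 d, (0 < d)%N & z \is d.-homog.

Lemma hid0 : hid (@zeroid R).
Proof. by split=> [|d f ->]; [exact: zeroid_ideal | rewrite /zeroid raddf0]. Qed.

Lemma hid_isum I e z : z \is e.-homog -> hid I -> hid (isum I z).
Proof.
move=> hz [idI hI]; split; first exact: isum_ideal.
move=> d f [r hr]; have [led|ltd] := leqP e d.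
  exists (pihomog mdeg (d - e) r); have := hI d _ hr.
  by rewrite raddfB /= -{2}(subnK led) pihomogM_homog.
by exists 0; have := hI d _ hr; rewrite raddfB /= (pihomogM_lt _ hz) // mul0r.
Qed.

Lemma hid_idadd I s : (forall z, z \in s -> exists e, z \is e.-homog) -> hid I -> hid (idadd I s).
Proof.
elim: s I => //= z s IH I hs hI; apply: IH; first by move=> y hy; apply: hs; rewrite inE hy orbT.
by have [e he] := hs z (mem_head _ _); apply: (hid_isum he).
Qed.

Section GradedSwap.
Variable T : A -> Prop.
Hypothesis T1 : T 1.
Hypothesis TM : forall u v, T u -> T v -> T (u * v).

Definition cstT : R -> Prop := fun u => exists a, T a /\ u = a%:MP.

Lemma cstT1 : cstT 1.
Proof. by exists 1; rewrite mpolyC1. Qed.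

Lemma cstTM u v : cstT u -> cstT v -> cstT (u * v).
Proof. by move=> [a [ha ->]] [b [hb ->]]; exists (a * b); rewrite mpolyCM; split=> //; apply: TM. Qed.

(** With an exponent above every degree occurring in [x], the multiple of the power of [z] has no
    component in those degrees, so each component of [a%:MP * x] lies in [I]. *)
Lemma graded_separated I z x : hid I -> posform z ->
  (forall k, sat cstT (isum I (z ^+ k)) x) -> sat cstT I x.
Proof.
move=> [idI hI] [e e0 hz] /(_ (msize x)) [u [[a [ha ->]] [r hr]]].
exists a%:MP; split; first by exists a.
rewrite [x](pihomog_partitionE (leqnn (msize x))) mulr_sumr.
apply: ideal_sum => // d _; have := hI d _ hr.
have hzk : z ^+ msize x \is (e * msize x).-homog by apply: dhomogMn.
have lt : (d < e * msize x)%N by rewrite (leq_trans (ltn_ord d)) // leq_pmull.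
by rewrite raddfB /= (pihomogM_lt _ hzk lt) subr0 !mul_mpolyC linearZ.
Qed.

Lemma regT_graded_perm s t : (forall z, z \in s -> posform z) -> perm_eq s t ->
  regT cstT (@zeroid R) s -> regT cstT (@zeroid R) t.
Proof.
move=> hs hp; apply: (@regT_perm _ _ cstT1 cstTM hid posform) => //.
- by move=> I [].
- by move=> I z hI [e e0 hz]; apply: (hid_isum hz).
- by move=> I z x hI hz _; apply: graded_separated.
- exact: hid0.
Qed.

Lemma regT_graded_dropl t s : (forall z, z \in t ++ s -> posform z) ->
  regT cstT (@zeroid R) (t ++ s) -> regT cstT (@zeroid R) s.
Proof.
move=> hs; apply: (@regT_dropl _ _ cstT1 cstTM hid posform) => //.
- by move=> I [].
- by move=> I z hI [e e0 hz]; apply: (hid_isum hz).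
- by move=> I z x hI hz _; apply: graded_separated.
- exact: hid0.
Qed.

End GradedSwap.
End Tools.

(** * Iterated univariate and multivariate polynomials *)

Lemma mpoly_rmorph_ext (A : comNzRingType) n (S : nzRingType)
    (g h : {rmorphism {mpoly A[n]} -> S}) :
  (forall a : A, g a%:MP = h a%:MP) -> (forall i, g 'X_i = h 'X_i) -> g =1 h.
Proof.
move=> hC hX f; rewrite [f]mpolyE !rmorph_sum; apply: eq_bigr => m _.
rewrite -mul_mpolyC !rmorphM hC; congr (_ * _).
by rewrite mpolyXE_id !rmorph_prod; apply: eq_bigr => i _; rewrite !rmorphXn hX.
Qed.

Section Iso.
Variable K : fieldType.

Lemma mconst_is_additive n : zmod_morphism (@mconst K n).
Proof. by elim: n => //= n IH x y; rewrite IH polyCB. Qed.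

HB.instance Definition _ n := GRing.isZmodMorphism.Build K (Defs.mpoly K n) (@mconst K n)
  (@mconst_is_additive n).

Lemma mconst_is_multiplicative n : monoid_morphism (@mconst K n).
Proof.
by elim: n => //= n [IH1 IH2]; split=> [|x y]; rewrite ?IH1 ?IH2 ?polyCM.
Qed.

HB.instance Definition _ n := GRing.isMonoidMorphism.Build K (Defs.mpoly K n) (@mconst K n)
  (@mconst_is_multiplicative n).

(** The outermost variable of the iterated ring is matched with [ord_max], so that [polyC]
    corresponds to [mwiden]. *)
Fixpoint dvar n : 'I_n -> Defs.mpoly K n :=
  match n return 'I_n -> Defs.mpoly K n with
  | 0 => fun _ => 0
  | n'.+1 => fun i => if unlift ord_max i is Some j then (dvar j)%:P else 'X
  end.

Definition iter_of n : {mpoly K[n]} -> Defs.mpoly K n := mmap (@mconst K n) (@dvar n).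

HB.instance Definition _ n := GRing.RMorphism.on (@iter_of n).

Fixpoint multi_of n : {rmorphism Defs.mpoly K n -> {mpoly K[n]}} :=
  match n return {rmorphism Defs.mpoly K n -> {mpoly K[n]}} with
  | 0 => mpolyC 0 (R := K)
  | n'.+1 => @horner_morph _ _ (@mwiden n' K \o multi_of n') 'X_ord_max
      (fun x => mulrC _ _)
  end.

Lemma iter_ofC n c : iter_of (c%:MP_[n]) = mconst n c.
Proof. exact: mmapC. Qed.

Lemma iter_ofX n i : iter_of ('X_i : {mpoly K[n]}) = dvar i.
Proof. by rewrite /iter_of mmapX mmap1U. Qed.

Lemma multi_ofS n (p : Defs.mpoly K n.+1) :
  multi_of n.+1 p = \sum_(j < size p) mwiden (multi_of n p`_j) * 'X_ord_max ^+ j.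
Proof.
rewrite /= /horner_morph (@horner_coef_wide _ (size p)); last first.
  by rewrite (map_polyE _ p) (leq_trans (size_Poly _)) // size_map.
by apply: eq_bigr => j _; rewrite coef_map.
Qed.

Lemma multi_ofC n c : multi_of n (mconst n c) = c%:MP.
Proof.
by elim: n => //= n IH; rewrite /horner_morph map_polyC hornerC /= IH mwidenC.
Qed.

Lemma widen_lift n (j : 'I_n) : widen_ord (leqnSn n) j = lift ord_max j.
Proof. by apply: val_inj => /=; rewrite /bump leqNgt ltn_ord. Qed.

Lemma multi_ofX n (i : 'I_n) : multi_of n (dvar i) = 'X_i.
Proof.
elim: n i => [[]//|n IH] i /=; case: unliftP => [j ->|->].
  rewrite /horner_morph map_polyC hornerC /= IH mwidenX mnmwiden1.
  by rewrite widen_lift.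
by rewrite /horner_morph map_polyX hornerX.
Qed.

Lemma iter_ofK n : cancel (@iter_of n) (multi_of n).
Proof.
move=> f; apply: (mpoly_rmorph_ext (g := multi_of n \o @iter_of n) (h := idfun)) => [a|i] /=.
  by rewrite iter_ofC multi_ofC.
by rewrite iter_ofX multi_ofX.
Qed.

Lemma iter_of_widen n (f : {mpoly K[n]}) : iter_of (mwiden f) = (iter_of f)%:P.
Proof.
apply: (mpoly_rmorph_ext (g := @iter_of n.+1 \o @mwiden n K) (h := polyC \o @iter_of n)) => [a|i] /=.
  by rewrite mwidenC !iter_ofC.
by rewrite mwidenX mnmwiden1 !iter_ofX /= widen_lift liftK.
Qed.

Lemma multi_ofK n : cancel (multi_of n) (@iter_of n).
Proof.
elim: n => [|n IH] p; first exact: iter_ofC.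
rewrite multi_ofS rmorph_sum -[RHS]coefK poly_def; apply: eq_bigr => j _.
transitivity (iter_of (mwiden (multi_of n p`_j)) * iter_of 'X_ord_max ^+ j).
  by rewrite rmorphM rmorphXn.
by rewrite iter_of_widen IH iter_ofX /= unlift_none mul_polyC.
Qed.

Lemma mcoeff_multi_of n (p : Defs.mpoly K n.+1) (m : 'X_{1..n}) (j : nat) :
  (multi_of n.+1 p)@_(mnmwiden m + U_(ord_max) *+ j) = (multi_of n p`_j)@_m.
Proof.
have coefw (f : {mpoly K[n]}) k : (mwiden f * 'X_ord_max ^+ k)@_(mnmwiden m + U_(ord_max) *+ j) =
    if k == j then f@_m else 0.
  have [->|ne] := eqVneq k j.
    by rewrite mpolyXn addmC mcoeffMX mwiden_mnmwiden.
  apply: memN_msupp_eq0; rewrite mpolyXn (perm_mem (msuppMX _ _)).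
  apply/mapP => -[m' hm' e].
  have := congr1 (fun m : 'X_{1..n.+1} => m ord_max) e.
  rewrite !mnmDE !mulmnE !mnm1E eqxx !mul1n mnmwiden_ordmax add0n.
  have -> : m' ord_max = 0%N.
    move: hm'; rewrite (mwidenE (leqnn (msize f))) => /msupp_sum_le.
    move=> /flattenP[s /mapP[c _ ->]] /msuppZ_le; rewrite msuppX inE => /eqP ->.
    exact: mnmwiden_ordmax.
  by rewrite addn0 => ej; rewrite ej eqxx in ne.
rewrite multi_ofS raddf_sum /=.
under eq_bigr do rewrite coefw.
rewrite -big_mkcond /=; have [lt|ge] := ltnP j (size p).
  by rewrite (big_pred1 (Ordinal lt)).
rewrite big_pred0 => [|k]; last by apply/negbTE; rewrite neq_ltn (leq_trans (ltn_ord k)).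
by rewrite nth_default // rmorph0 mcoeff0.
Qed.

Lemma homog_multi_of n d (p : Defs.mpoly K n) : mhomog d p = (multi_of n p \is d.-homog).
Proof.
elim: n d p => [|n IH] d p /=.
  rewrite dhomogE msuppC orbC; case: eqP => //= _; by rewrite andbT mdeg0 eq_sym.
apply/forallP/idP => [h|h j].
  rewrite -/(multi_of n.+1 p) multi_ofS; apply: rpred_sum => j _.
  have := h j; case: ifP => [lej|_ /eqP ->]; last first.
    by rewrite rmorph0 mwiden0 mul0r; exact: dhomog0.
  rewrite IH => hj; rewrite -(subnK lej); apply: dhomogM; last first.
    by rewrite mpolyXn dhomogX /= mdegMn mdeg1 mul1n.
  apply: (mmap_graded (H := fun d x => x \is d.-homog)) hj => //.
  - by move=> e; exact: dhomog0.
  - by move=> e x y; exact: dhomogD.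
  - by move=> e a x hx; rewrite mul_mpolyC; exact: dhomogZ.
  - exact: dhomog1.
  - by move=> i; rewrite dhomogX /= mdeg1.
  - by move=> e1 e2 x y; exact: dhomogM.
have mw (m : 'X_{1..n}) : (mdeg (mnmwiden m) = mdeg m).
  rewrite !mdegE big_ord_recr /= mnmwiden_ordmax addn0; apply: eq_bigr => i _.
  by rewrite -[RHS](mnmwiden_widen m).
have key m : (multi_of n p`_j)@_m != 0 -> (mdeg m + j = d)%N.
  rewrite -mcoeff_multi_of -mcoeff_msupp => /(dhomog_mf h) <-.
  by rewrite /= mdegD mdegMn mdeg1 mul1n mw.
case: ifP => lej.
  rewrite IH; apply/dhomogP => m; rewrite mcoeff_msupp => /key <-; by rewrite addnK.
have : multi_of n p`_j = 0.
  apply/mpolyP => m; rewrite mcoeff0; apply/eqP; apply/negPn/negP => /key e.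
  by rewrite -e leq_addl in lej.
by move/(congr1 (@iter_of n)); rewrite multi_ofK rmorph0 => ->.
Qed.

End Iso.

Lemma infinite_closed (K : closedFieldType) : exists t : nat -> K, injective t.
Proof.
have fresh (l : seq K) : exists x, x \notin l.
  have /closed_nonrootP [x hx] : \prod_(a <- l) ('X - a%:P) != 0 :> {poly K}.
    by rewrite monic_neq0 // monic_prod_XsubC.
  by exists x; rewrite -root_prod_XsubC.
pose nx (l : seq K) := epsilon (inhabits 0) (fun x => x \notin l).
pose L := fix L k : seq K := if k is k'.+1 then rcons (L k') (nx (L k')) else [::].
exists (fun k => nx (L k)).
have sub k l : (nx (L k)) \in L (k.+1 + l)%N.
  elim: l => [|l IH]; first by rewrite addn0 /= mem_rcons mem_head.
  by rewrite addnS /= mem_rcons inE IH orbT.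
have out k : nx (L k) \notin L k by apply: (epsilon_spec (inhabits 0) (fun x => x \notin L k)).
have ne j k : (j < k)%N -> nx (L j) <> nx (L k).
  move=> lt e; have := out k; rewrite -e -(subnKC lt) => /negP; apply; exact: sub.
by move=> j k e; case: (ltngtP j k) => // /ne; [move/(_ e) | move/(_ (esym e))].
Qed.

Section Points.
Variable K : closedFieldType.

Lemma infinite_units (S : nzRingType) (g : {rmorphism K -> S}) : exists t : nat -> K,
  injective t /\ forall i j, i != j -> exists v : S, v * (g (t i) - g (t j)) = 1.
Proof.
have [t tI] := infinite_closed K; exists t; split=> // i j ne.
exists (g (t i - t j)^-1); rewrite -rmorphB -rmorphM mulVf ?rmorph1 //.
by rewrite subr_eq0; apply: contra ne => /eqP /tI ->.
Qed.

Lemma iter_nonroot n (p : Defs.mpoly K n) : p != 0 ->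
  exists g : {rmorphism Defs.mpoly K n -> K}, (forall c, g (mconst n c) = c) /\ g p != 0.
Proof.
elim: n p => [|n IH] p p0; first by exists idfun.
have [t [tI ht]] := infinite_units (@mconst K n).
have [i hi] : exists i, p.[mconst n (t i)] != 0.
  apply: NNPP => hno; move/negP: p0; apply; apply/eqP/polyP => j; rewrite coef0.
  apply: (@coefs_of_values _ (@zeroid _) p (fun i => mconst n (t i)) (iota 0 (size p))) => //.
  - exact: zeroid_ideal.
  - exact: iota_uniq.
  - by rewrite size_iota.
  - by move=> i _; apply/eqP; apply/negPn/negP => h; apply: hno; exists i.
have [g [g1 g2]] := IH _ hi.
exists (g \o horner_eval (mconst n (t i))); split=> // c /=.
by rewrite /horner_eval hornerC g1.
Qed.

Lemma mpoly_nonroot n (f : {mpoly K[n]}) : f != 0 -> exists v, f.@[v] != 0.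
Proof.
move=> f0; have [|g [g1 g2]] := @iter_nonroot n (iter_of f).
  by apply: contra f0 => /eqP h; rewrite -(iter_ofK f) h rmorph0.
exists (fun i => g (@dvar K n i)); congr (_ != 0): g2.
apply: (mpoly_rmorph_ext (g := g \o @iter_of K n) (h := meval _)) => [a|i] /=.
  by rewrite iter_ofC g1 mevalC.
by rewrite iter_ofX mevalXU.
Qed.

Lemma noeth_iso (S S' : comNzRingType) (g : {rmorphism S -> S'}) (h : S' -> S) :
  cancel h g -> noeth S -> noeth S'.
Proof.
move=> gK nS a; have [m /idadd0P [cs [hcs e]]] := nS (h \o a).
exists m; apply/idadd0P; exists (map g cs); rewrite size_map hcs !size_map; split=> //.
rewrite -[LHS]gK [h _]e /lcomb rmorph_sum.
have -> : mkseq a m = map g (mkseq (h \o a) m).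
  by rewrite /mkseq -map_comp; apply: eq_map => i /=; rewrite gK.
elim: cs (mkseq _ m) {hcs e} => [|c cs IH] [|b s] /=; rewrite ?big_nil //.
by rewrite !big_cons IH rmorphM.
Qed.

Lemma noeth_mpolyK n : noeth {mpoly K[n]}.
Proof. apply: (noeth_iso (g := multi_of K n) (@iter_ofK K n)); exact: noeth_mpoly. Qed.

End Points.

(** * Separable independence of strong systems *)

(* Taylor expansion: the coefficient of ['X^k] in [shift v f = f (x + 'X v)] is
   the [k]-th Hasse derivative of [f] in the direction [v]. *)
HB.lock Definition shift (K : fieldType) n (v : 'I_n -> K) (f : {mpoly K[n]}) :
    {poly {mpoly K[n]}} :=
  mmap (polyC \o @mpolyC n K) (fun i => ('X_i)%:P + ((v i)%:MP)%:P * 'X) f.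

Section Shift.
Variables (K : fieldType) (n : nat) (v : 'I_n -> K).
Local Notation R := {mpoly K[n]}.
Local Notation shift := (shift v).

Lemma shift_is_additive : zmod_morphism shift.
Proof. by move=> f g; rewrite !shift.unlock rmorphB. Qed.

HB.instance Definition _ := GRing.isZmodMorphism.Build R {poly R} shift shift_is_additive.

Lemma shift_is_multiplicative : monoid_morphism shift.
Proof. by split=> [|f g]; rewrite !shift.unlock ?rmorph1 ?rmorphM. Qed.

HB.instance Definition _ := GRing.isMonoidMorphism.Build R {poly R} shift shift_is_multiplicative.

Lemma shiftC a : shift a%:MP = (a%:MP)%:P.
Proof. by rewrite shift.unlock mmapC. Qed.

Lemma shiftX i : shift 'X_i = ('X_i)%:P + ((v i)%:MP)%:P * 'X.
Proof. by rewrite shift.unlock mmapX mmap1U. Qed.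

Lemma shiftX_coef i k :
  (shift 'X_i)`_k = if k == 0%N then 'X_i else if k == 1%N then (v i)%:MP else 0.
Proof.
rewrite shiftX coefD coefC coefCM coefX.
by case: k => [|[|k]]; rewrite /= ?mulr0 ?mulr1 ?addr0 ?add0r.
Qed.

Lemma shift_homog d f k : f \is d.-homog ->
  if (k <= d)%N then (shift f)`_k \is (d - k).-homog else (shift f)`_k == 0.
Proof.
move=> hf; move: k; rewrite shift.unlock.
apply: (mmap_graded (H := fun d (F : {poly R}) => forall k,
  if (k <= d)%N then F`_k \is (d - k).-homog else F`_k == 0)) hf.
- by move=> e k; rewrite coef0 dhomog0 eqxx if_same.
- move=> e x y hx hy k; rewrite coefD; move: (hx k) (hy k); case: ifP => _.
    exact: dhomogD.
  by move=> /eqP -> /eqP ->; rewrite addr0.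
- move=> e a x hx k; rewrite /= coefCM mul_mpolyC; move: (hx k); case: ifP => _.
    exact: dhomogZ.
  by move=> /eqP ->; rewrite scaler0.
- move=> k; rewrite coef1; case: k => [|k] //=; exact: dhomog1.
- move=> i k; rewrite -shiftX shiftX_coef.
  case: k => [|[|k]] //=.
    by rewrite dhomogX /= mdeg1.
  by rewrite dhomogE msuppC; case: eqP => //= _; rewrite mdeg0.
move=> e1 e2 x y hx hy k; rewrite coefM.
case: leqP => lek.
  apply: rpred_sum => j _; have := hx j; have := hy (k - j)%N.
  case: leqP => h1; last by move=> /eqP ->; rewrite mulr0 dhomog0.
  case: leqP => h2; last by move=> _ /eqP ->; rewrite mul0r dhomog0.
  move=> hy' hx'; have -> : (e1 + e2 - k = (e1 - j) + (e2 - (k - j)))%N.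
    by have := ltn_ord j; lia.
  exact: dhomogM.
apply/eqP; rewrite big1 // => j _; have := hx j; have := hy (k - j)%N.
case: leqP => h1; last by move=> /eqP ->; rewrite mulr0.
case: leqP => h2; last by move=> _ /eqP ->; rewrite mul0r.
by have := ltn_ord j; lia.
Qed.

Lemma shift_coef0 f : (shift f)`_0 = f.
Proof.
rewrite -horner_coef0.
apply: (mpoly_rmorph_ext (g := horner_eval (0 : R) \o shift) (h := idfun)) => [a|i] /=.
  by rewrite /horner_eval shiftC hornerC.
by rewrite /horner_eval shiftX !hornerE.
Qed.

Lemma shift_coef_top d f : f \is d.-homog -> (shift f)`_d = (f.@[v])%:MP.
Proof.
move=> hf; have := shift_homog d hf; rewrite leqnn subnn => h0.
have e1 : (shift f)`_d = ((shift f)`_d).@[fun=> 0]%:MP.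
  have c0 : (shift f)`_d = ((shift f)`_d)@_0%MM *: 1.
    apply/mpolyP => m; rewrite mcoeffZ mcoeff1; have [->|m0] := eqVneq m 0%MM; first by rewrite mulr1.
    rewrite mulr0; apply: (dhomog_nemf_coeff h0); by rewrite /= mdeg_eq0.
  by rewrite [in RHS]c0 mevalZ meval1 mulr1 {1}c0 -mul_mpolyC mulr1.
rewrite e1; congr (_%:MP).
have -> : ((shift f)`_d).@[fun=> 0] = (map_poly (meval (fun=> 0 : K)) (shift f))`_d by rewrite coef_map.
have -> : map_poly (meval (fun=> 0 : K)) (shift f) = mmap polyC (fun i => (v i)%:P * 'X) f.
  apply: (mpoly_rmorph_ext (g := map_poly (meval (fun=> 0 : K)) \o shift)
    (h := mmap polyC (fun i => (v i)%:P * 'X))) => [a|i] /=.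
    by rewrite shiftC map_polyC /= mevalC mmapC.
  rewrite shiftX mmapX mmap1U rmorphD rmorphM /= !map_polyC map_polyX /= mevalXU mevalC.
  by rewrite polyC0 add0r.
suff -> : mmap polyC (fun i => (v i)%:P * 'X) f = (f.@[v])%:P * 'X^d.
  by rewrite coefCM coefXn eqxx mulr1.
apply: (@mpoly_scale_ind _ _ (fun f => mmap polyC (fun i => (v i)%:P * 'X) f = (f.@[v])%:P * 'X^d)).
- by rewrite !raddf0 mul0r.
- by move=> f1 f2 h1 h2; rewrite !raddfD /= h1 h2 mulrDl.
- by move=> a f1 h1; rewrite mmapZ h1 mevalZ polyCM mulrA.
move=> m hm; rewrite mmapX mevalX /mmap1 rmorph_prod -(dhomog_mf hf hm) /= mdegE.
rewrite -prodrXr -big_split /=.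
by apply: eq_bigr => i _; rewrite exprMn rmorphXn.
Qed.

Lemma shift_deriv i f k : (shift (f^`M(i)))`_k = ((shift f)`_k)^`M(i).
Proof.
pose delta (f : R) := map_poly (mderiv i) (shift f).
have cd (g : {poly R}) j : (map_poly (mderiv i) g)`_j = (g`_j)^`M(i) by rewrite coef_map_id0 // mderiv0.
suff e : delta f = shift f^`M(i) by rewrite -e cd.
rewrite (@chain_rule _ _ _ shift delta).
- rewrite (bigD1 i) //= big1 ?addr0 => [|j ne].
    suff -> : delta 'X_i = 1 by rewrite mulr1.
    apply/polyP => j; rewrite /delta cd shiftX_coef coef1.
    have eX : ('X_i : R)^`M(i) = 1.
      by rewrite mderivX mnm1E eqxx scale1r -[in RHS]mpolyX0; congr 'X_[_]; apply/mnmP => l; rewrite mnmBE mnm0E subnn.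
    by case: j => [|[|j]] /=; rewrite ?eX ?mderivC ?mderiv0.
  suff -> : delta 'X_j = 0 by rewrite mulr0.
  apply/polyP => l; rewrite /delta cd shiftX_coef coef0.
  have eX : ('X_j : R)^`M(i) = 0 by rewrite mderivX mnm1E (negbTE ne) scale0r.
  by case: l => [|[|l]] /=; rewrite ?eX ?mderivC ?mderiv0.
- move=> f1 f2; apply/polyP => j; rewrite /delta (cd (shift (f1 + f2))) (rmorphD shift).
  by rewrite !coefD mderivD (cd (shift f1)) (cd (shift f2)).
- move=> f1 f2; apply/polyP => j; rewrite /delta (cd (shift (f1 * f2))) (rmorphM shift).
  rewrite coefD !coefM raddf_sum /= -big_split /=.
  by apply: eq_bigr => l _; rewrite mderivM (cd (shift f1)) (cd (shift f2)).
- by move=> a; rewrite /delta shiftC map_polyC /= mderivC polyC0.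
Qed.

End Shift.

Section Grad.
Variables (K : fieldType) (n : nat).
Local Notation R := {mpoly K[n]}.

Definition gradweak (s d : nat) (f : R) := exists hs : seq (nat * R),
  [/\ (size hs <= s)%N,
      forall h, h \in hs -> [/\ (0 < h.1)%N, (h.1 < d)%N & h.2 \is h.1.-homog] &
      forall i, idadd (@zeroid R) [seq h.2 | h <- hs] (f^`M(i))].

(** Taking the component of degree [d] in an expression of [f] by the generators turns each summand
    into one product of two forms of positive degree. *)
Lemma weak_of_ideal d f (hs : seq (nat * R)) : f \is d.-homog ->
  (forall h, h \in hs -> [/\ (0 < h.1)%N, (h.1 < d)%N & h.2 \is h.1.-homog]) ->
  idadd (@zeroid R) [seq h.2 | h <- hs] f -> weak (size hs) d f.
Proof.
move=> hf hhs /idadd0P [cs [_ ef]].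
have -> : f = pihomog mdeg d (lcomb cs [seq h.2 | h <- hs]) by rewrite -ef pihomog_dE.
elim: hs cs hhs {ef} => [|[e h] hs IH] cs hhs.
  by case: cs => [|c cs]; rewrite /lcomb /= big_nil raddf0; exact: weak0.
case: cs => [|c cs]; first by rewrite /lcomb /= big_nil raddf0; exact: weak0.
rewrite /= lcomb_cons raddfD /= -add1n; apply: weakD; last first.
  by apply: IH => x hx; apply: hhs; rewrite inE hx orbT.
have [h1 h2 h3] := hhs _ (mem_head _ _).
rewrite /= in h1 h2 h3; rewrite -{2}(subnK (ltnW h2)) (pihomogM_homog _ _ h3).
apply: (@weakM _ _ d (d - e)%N).
- by rewrite subn_gt0 h2 ltn_subrL h1 (leq_ltn_trans _ h2).
- exact: pihomogP.
- by rewrite subKn // ltnW.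
Qed.

Lemma euler d (f : R) : f \is d.-homog -> \sum_i 'X_i * f^`M(i) = d%:R *: f.
Proof.
move=> hf; apply: (@mpoly_scale_ind _ _ (fun f => \sum_i 'X_i * f^`M(i) = d%:R *: f)).
- by rewrite scaler0 big1 // => i _; rewrite mderiv0 mulr0.
- move=> f1 f2 h1 h2; rewrite scalerDr -h1 -h2 -big_split.
  by apply: eq_bigr => i _; rewrite mderivD mulrDr.
- move=> a f1 h1; rewrite scalerA mulrC -scalerA -h1 scaler_sumr.
  by apply: eq_bigr => i _; rewrite mderivZ scalerAr.
move=> m hm; rewrite -(dhomog_mf hf hm) /= mdegE natr_sum scaler_suml.
apply: eq_bigr => i _; rewrite mderivX -scalerAr -mpolyXD.
have [->|m0] := posnP (m i); first by rewrite !scale0r.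
by rewrite addmC submK // lep1mP -lt0n.
Qed.

Lemma homog_mderiv d (f : R) i : f \is d.-homog -> f^`M(i) \is d.-1.-homog.
Proof.
move=> hf; apply/dhomogP => m; rewrite mcoeff_msupp mcoeff_deriv => h.
have : (m + U_(i))%MM \in msupp f.
  by rewrite mcoeff_msupp; apply: contra h => /eqP ->; rewrite mul0rn.
by move/(dhomog_mf hf) => /= <-; rewrite mdegD mdeg1 addn1.
Qed.

Lemma strong_ord s (E : seq (nat * R)) (c : 'I_(size E) -> K) d : strong s E ->
  (forall j, c j != 0 -> (nth (0%N, 0) E j).1 = d) ->
  weak s d (\sum_j c j *: (nth (0%N, 0) E j).2) -> forall j, c j = 0.
Proof.
move=> sE hc wk j.
have eE : E = [seq nth (0%N, 0) E (val i) | i <- enum 'I_(size E)].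
  apply: (@eq_from_nth _ (0%N, 0)); first by rewrite size_map size_enum_ord.
  by move=> i hi; rewrite (nth_map j) ?size_enum_ord //= nth_enum_ord.
have ez : zip [seq c i | i <- enum 'I_(size E)] E =
    [seq (c i, nth (0%N, 0) E (val i)) | i <- enum 'I_(size E)].
  by rewrite -zip_map -eE.
apply: (sE [seq c i | i <- enum 'I_(size E)] d).
- by rewrite size_map size_enum_ord.
- by rewrite /degs_in ez => p /mapP[i _ ->] /=; exact: hc.
- by rewrite /lc ez big_map big_enum.
- by apply: map_f; rewrite mem_enum.
Qed.

End Grad.

Definition star d := forall s, exists s', forall (K : closedFieldType) n (f : {mpoly K[n]}),
  (0 < d)%N -> f \is d.-homog -> gradweak s d f -> weak s' d f.

Lemma mcoeff_pihomog (A : comNzRingType) n d (f : {mpoly A[n]}) m :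
  (pihomog mdeg d f)@_m = if mdeg m == d then f@_m else 0.
Proof.
apply: (@mpoly_scale_ind _ _ (fun f => (pihomog mdeg d f)@_m = if mdeg m == d then f@_m else 0)).
- by rewrite raddf0 mcoeff0 if_same.
- by move=> f1 f2 h1 h2; rewrite raddfD /= !mcoeffD h1 h2; case: eqP => // _; rewrite addr0.
- by move=> a f1 h1; rewrite linearZ /= !mcoeffZ h1; case: eqP => // _; rewrite mulr0.
move=> m' _; rewrite pihomogX /=; have [<-|ne] := eqVneq (mdeg m') d.
  by rewrite mcoeffX; case: (eqVneq m' m) => [->|_]; rewrite ?eqxx // if_same.
rewrite mcoeff0 mcoeffX; case: (eqVneq m' m) => [<-|_]; last by rewrite if_same.
by rewrite (negbTE ne).
Qed.

Section SepInd.
Variables (K : closedFieldType) (n : nat) (E : seq (nat * {mpoly K[n]})).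
Local Notation R := {mpoly K[n]}.
Local Notation m := (size E).
Local Notation dg j := (nth (0%N, 0) E (nat_of_ord j)).1.
Local Notation el j := (nth (0%N, 0) E (nat_of_ord j)).2.
Variables (D r s s' : nat).
Hypothesis Esz : (m <= r)%N.
Hypothesis Ewf : wf D E.
Hypothesis Estrong : strong s' E.
Hypothesis starD : forall d (f : R), (d <= D)%N -> (0 < d)%N -> f \is d.-homog -> gradweak (r * D) d f -> weak s' d f.

Lemma elP (j : 'I_m) : [/\ (0 < dg j)%N, (dg j <= D)%N & el j \is (dg j).-homog].
Proof. by apply: Ewf; apply: mem_nth. Qed.

(* Take the coefficient of ['X^k], [k] the degree of the multipliers [h j] of
   the top degree [el j], after the shift [x + 'X v]: these multipliers become constants. *)
Lemma sepind_homog B (h : 'I_m -> R) :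
  (forall j, if (dg j <= B)%N then h j \is (B - dg j).-homog else h j == 0) ->
  (forall i, \sum_j h j * (el j)^`M(i) = 0) -> forall j, h j = 0.
Proof.
move=> hh rel; apply: NNPP => hno.
have [j1 hj1] : exists j, h j != 0.
  apply: NNPP => hn; apply: hno => j; apply/eqP; apply/negPn/negP => h0; apply: hn; by exists j.
have [|j0 [hj0 jmax]] := @exists_min _ (fun j : 'I_m => (D - dg j)%N) (fun j => h j != 0).
  by exists j1.
set d := dg j0; have {}jmax j : h j != 0 -> (dg j <= d)%N.
  move=> /jmax; have [_ h1 _] := elP j; have [_ h2 _] := elP j0; rewrite /d.
  by move: (dg j) (dg j0) h1 h2 => a b; lia.
have dB : (d <= B)%N.
  by move: (hh j0); case: leqP => // _; rewrite (negbTE hj0).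
have [v hv] := mpoly_nonroot hj0.
pose k := (B - d)%N.
pose c j := if dg j == d then (h j).@[v] else 0.
have [d0 dD _] := elP j0; rewrite -/d in d0 dD.
suff : forall j, c j = 0 by move=> /(_ j0) /eqP; rewrite /c eqxx (negbTE hv).
apply: (strong_ord Estrong (d := d)) => [j|].
  by rewrite /c; case: (dg j =P d) => //; rewrite eqxx.
pose f := \sum_j c j *: el j.
apply: starD => //.
  apply: rpred_sum => j _; rewrite /c; case: (dg j =P d) => [e|_].
    by apply: dhomogZ; have [_ _] := elP j; rewrite e.
  by rewrite scale0r dhomog0.
(* In the coefficient of ['X^k] of the shifted relation, the terms with [dg j = d] and [l = 0] add
   up to the derivative of the combination with coefficients [c]. In every other term either the
   multiplier is a form of degree [d - dg j + l], strictly between 0 and [d], or the other factor is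
   the derivative of a constant or of zero. The pairs in [ok] list these multipliers. *)
pose ok (x : 'I_m * 'I_D) := [&& h x.1 != 0, (x.2 < dg x.1)%N, (x.2 <= k)%N & (dg x.1 < d)%N || (0 < x.2)%N].
pose hs := [seq ((d - dg x.1 + x.2)%N, (shift v (h x.1))`_(k - x.2)) | x : 'I_m * 'I_D <- enum [pred x | ok x]].
exists hs; split.
- rewrite size_map -cardE (leq_trans (max_card _)) // card_prod !card_ord leq_mul2r Esz.
  by rewrite orbT.
- move=> hx' /mapP[x]; rewrite mem_enum => /and4P[h1 h2 h3 h4] -> /=.
  have h5 := jmax _ h1.
  have := hh x.1; rewrite (leq_trans h5 dB) => hx.
  have := shift_homog v (k - x.2) hx; move: h2 h3 h4 h5 dB; rewrite /k.
  move: (dg x.1) (nat_of_ord x.2) => a b h2 h3 h4 h5 dB'.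
  have -> : (B - d - b <= B - a)%N by lia.
  have -> : (B - a - (B - d - b) = d - a + b)%N by lia.
  by move=> hom; split=> //; [case/orP: h4; lia | lia].
move=> i.
have rel' : \sum_j \sum_(l < k.+1) (shift v (h j))`_(k - l) * ((shift v (el j))`_l)^`M(i) = 0.
  have : (shift v (\sum_j h j * (el j)^`M(i)))`_k = 0 by rewrite rel rmorph0 coef0.
  rewrite rmorph_sum coef_sum /= => e; rewrite -[RHS]e; apply: eq_bigr => j _.
  rewrite rmorphM coefMr; apply: eq_bigr => l _; by rewrite shift_deriv.
pose J := idadd (@zeroid R) [seq h.2 | h <- hs].
have idJ : is_ideal J by apply/idadd_ideal/zeroid_ideal.
have -> : (\sum_j c j *: el j)^`M(i) = - \sum_j (\sum_(l < k.+1) (shift v (h j))`_(k - l) *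
    ((shift v (el j))`_l)^`M(i) - c j *: (el j)^`M(i)).
  rewrite raddf_sum /= sumrB rel' sub0r opprK; apply: eq_bigr => j _; exact: mderivZ.
apply: idealN => //; apply: ideal_sum => // j _.
have [h0|hj] := eqVneq (h j) 0.
  rewrite big1 => [|l _]; last by rewrite h0 rmorph0 coef0 mul0r.
  by rewrite /c h0 meval0 if_same scale0r subrr; exact: ideal0.
have lej := jmax _ hj; have [dj0 djD hjj] := elP j.
have hhj : h j \is (B - dg j).-homog by have := hh j; rewrite (leq_trans lej dB).
rewrite big_ord_recl /= subn0 shift_coef0.
have -> : (shift v (h j))`_k * (el j)^`M(i) + \sum_(l < k) (shift v (h j))`_(k - bump 0 l) *
     ((shift v (el j))`_(bump 0 l))^`M(i) - c j *: (el j)^`M(i) =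
  ((shift v (h j))`_k * (el j)^`M(i) - c j *: (el j)^`M(i)) +
  \sum_(l < k) (shift v (h j))`_(k - bump 0 l) * ((shift v (el j))`_(bump 0 l))^`M(i) by rewrite addrAC.
have inhs (l : nat) : (l < dg j)%N -> (l <= k)%N -> (dg j < d)%N || (0 < l)%N -> J ((shift v (h j))`_(k - l)).
  move=> h1 h2 h3; apply: idadd_gen; first exact: zeroid_ideal.
  have lD : (l < D)%N by rewrite (leq_trans h1).
  apply/mapP; exists ((d - dg j + l)%N, (shift v (h j))`_(k - l)) => //.
  apply/mapP; exists (j, Ordinal lD) => //; rewrite mem_enum inE /ok /= hj h1 h2; exact: h3.
apply: idealD => //.
  rewrite /c; have [ej|nej] := eqVneq (dg j) d.
    rewrite -mul_mpolyC -mulrBl.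
    have -> : (shift v (h j))`_k = ((h j).@[v])%:MP by rewrite /k -ej (shift_coef_top v hhj).
    by rewrite subrr mul0r; exact: ideal0.
  rewrite scale0r subr0; apply: idealMr => //; rewrite -[X in _`_X]subn0.
  by apply: inhs => //; rewrite ltn_neqAle nej lej.
apply: ideal_sum => // l _; rewrite /bump leq0n add1n.
have [lt|ge] := ltnP l.+1 (dg j).
  by apply: idealMr => //; apply: inhs; rewrite ?orbT // ltn_ord.
suff -> : ((shift v (el j))`_l.+1)^`M(i) = 0 by rewrite mulr0; exact: ideal0.
have := shift_homog v l.+1 hjj; case: (leqP l.+1 (dg j)) => [le _|_ /eqP ->]; last by rewrite mderiv0.
have -> : l.+1 = dg j by apply/eqP; rewrite eqn_leq le ge.
by rewrite (shift_coef_top v hjj) mderivC.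
Qed.

Lemma sepind_ord (h : 'I_m -> R) : (forall i, \sum_j h j * (el j)^`M(i) = 0) -> forall j, h j = 0.
Proof.
move=> rel j0; apply/mpolyP => mm; rewrite mcoeff0.
(* Chosen so that the component of [h j0] selected in [h'] is the one containing the monomial
   [mm]. *)
pose B := (mdeg mm + dg j0)%N.
pose h' j := if (dg j <= B)%N then pihomog mdeg (B - dg j) (h j) else 0.
have h'0 : h' j0 = 0.
  apply: (@sepind_homog B h') => [j|i]; rewrite /h'.
    by case: (dg j <= B)%N; [exact: pihomogP | exact: eqxx].
  have [B0|B0] := posnP B.
    by rewrite big1 // => j _; have [h1 _ _] := elP j; rewrite B0 leqNgt h1 mul0r.
  have := congr1 (pihomog mdeg B.-1) (rel i); rewrite raddf0 raddf_sum /= => e; rewrite -[RHS]e.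
  apply: eq_bigr => j _; have [h1 _ h2] := elP j; have h3 := homog_mderiv i h2.
  case: leqP => h4; last by rewrite mul0r (pihomogM_lt _ h3) // -ltnS !prednK.
  by rewrite -(pihomogM_homog _ _ h3); congr (pihomog _ _ _); apply: succn_inj; rewrite -addnS !prednK // subnK.
have : (h' j0)@_mm = 0 by rewrite h'0 mcoeff0.
rewrite /h' leq_addl addnK => e; rewrite -[RHS]e.
by rewrite mcoeff_pihomog eqxx.
Qed.

End SepInd.

Section Pth.
Variables (K : closedFieldType) (n : nat).
Local Notation R := {mpoly K[n]}.

Lemma pchar_mpoly p : p \in [pchar K] -> p \in [pchar R].
Proof.
move=> pK; rewrite inE /= (pcharf_prime pK) /= -mpolyC_nat mpolyC_eq0.
by rewrite (pcharf0 pK).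
Qed.

Lemma closed_pth_root p (a : K) : (0 < p)%N -> exists b, b ^+ p = a.
Proof.
move=> p0; have [b hb] := @solve_monicpoly K p (fun i => if i == 0%N then a else 0) p0.
exists b; rewrite hb; case: p p0 {hb} => // p _.
by rewrite big_ord_recl expr0 mulr1 big1 ?addr0 // => i _; rewrite mul0r.
Qed.

Lemma const_or_dvd (f : R) : (forall i, f^`M(i) = 0) ->
  forall m i, m \in msupp f -> (m i)%:R = 0 :> K.
Proof.
move=> h m i hm; have [m0|m0] := posnP (m i); first by rewrite m0.
have := congr1 (mcoeff (m - U_(i))%MM) (h i); rewrite mcoeff_deriv mcoeff0.
have lem : (U_(i) <= m)%MM by rewrite lep1mP -lt0n.
rewrite submK // mnmBE mnm1E eqxx subn1 prednK // => /eqP.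
by rewrite -[f@_m *+ _]mulr_natr mulf_eq0; move: hm; rewrite mcoeff_msupp => /negbTE -> /= /eqP.
Qed.

Lemma pth_power p (f : R) : p \in [pchar K] -> (forall i, f^`M(i) = 0) ->
  exists g, f = g ^+ p /\ forall m, m \in msupp g -> (m *+ p)%MM \in msupp f.
Proof.
move=> pK h; have p0 : (0 < p)%N by rewrite prime_gt0 // (pcharf_prime pK).
have rt (a : K) : exists b, b ^+ p = a by apply: closed_pth_root.
pose root a := epsilon (inhabits 0) (fun b : K => b ^+ p = a).
have rootE a : root a ^+ p = a by apply: (epsilon_spec (inhabits 0) (fun b : K => b ^+ p = a)).
pose dv (m : 'X_{1..n}) := [multinom (m i %/ p)%N | i < n].
have dvK m : m \in msupp f -> (dv m *+ p)%MM = m.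
  move=> hm; apply/mnmP => i; rewrite mulmnE mnmE divnK //.
  by rewrite (dvdn_pcharf pK) (const_or_dvd h _ hm).
exists (\sum_(m <- msupp f) root f@_m *: 'X_[dv m]); split.
  have := pFrobenius_autE (pchar_mpoly pK); rewrite /= => <-.
  rewrite rmorph_sum {1}[f]mpolyE big_seq [RHS]big_seq; apply: eq_bigr => m hm.
  by rewrite /= pFrobenius_autE exprZn rootE mpolyXn dvK.
move=> m /msupp_sum_le /flattenP[s /mapP[m' hm' ->]] /msuppZ_le.
by rewrite mem_filter /= in hm'; rewrite msuppX inE => /eqP ->; rewrite dvK.
Qed.

Lemma msize_mderiv (f : R) i : f != 0 -> (msize f^`M(i) < msize f)%N.
Proof.
move=> f0; have s0 : (0 < msize f)%N by rewrite lt0n msize_poly_eq0.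
rewrite msizeE -[X in (_ < X)%N](prednK s0) ltnS.
apply/bigmax_leqP_seq => m; rewrite mcoeff_msupp mcoeff_deriv => h _.
have hm : (m + U_(i))%MM \in msupp f.
  by rewrite mcoeff_msupp; apply: contra h => /eqP ->; rewrite mul0rn.
by rewrite -ltnS (prednK s0); have := msize_mdeg_lt hm; rewrite mdegD mdeg1 addn1.
Qed.

End Pth.

Section AlgIndep.
Variables (K : closedFieldType) (n m : nat) (e : 'I_m -> {mpoly K[n]}).
Hypothesis sep : forall h : 'I_m -> {mpoly K[n]},
  (forall i, \sum_j h j * (e j)^`M(i) = 0) -> forall j, h j = 0.

(** By the chain rule and separable independence, the partial derivatives of a relation are
    relations of smaller size, hence zero. So the relation is constant, or in characteristic [p] the
    [p]-th power of a smaller relation, and induction applies again. *)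
Lemma alg_independent (F : {mpoly K[m]}) : mmap (@mpolyC n K) e F = 0 -> F = 0.
Proof.
have [N] := ubnP (msize F); elim: N F => // N IH F ltN hF.
have [//|F0] := eqVneq F 0.
have dF j : F^`M(j) = 0.
  apply: IH; first by rewrite -ltnS; apply: leq_trans ltN; rewrite ltnS; exact: msize_mderiv.
  move: j; apply: sep => i.
  have := @chain_rule _ _ _ (mmap (@mpolyC n K) e) (fun F => (mmap (@mpolyC n K) e F)^`M(i)) _ _ _ F.
  rewrite hF mderiv0 => ch; rewrite [RHS]ch.
  - by apply: eq_bigr => j _; rewrite mmapX mmap1U.
  - by move=> f g; rewrite raddfD mderivD.
  - by move=> f g; rewrite rmorphM mderivM.
  - by move=> a; rewrite mmapC mderivC.
have key := const_or_dvd dF.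
case: (classic (exists p, p \in [pchar K])) => [[p pK]|noc].
  have [G [eF hG]] := pth_power pK dF.
  have p1 : (1 < p)%N by rewrite prime_gt1 // (pcharf_prime pK).
  have G0 : mmap (@mpolyC n K) e G = 0.
    by move/eqP: hF; rewrite eF rmorphXn expf_eq0 => /andP[_ /eqP].
  case: (leqP (msize F) 1) => szF.
    move: hF; rewrite (msize1_polyC szF) mmapC => /eqP; rewrite mpolyC_eq0 => /eqP ->.
    by rewrite mpolyC0.
  suff G0' : G = 0 by rewrite eF G0' expr0n gtn_eqF // ltnW.
  apply: IH => //.
  have s0 : (0 < msize F)%N by apply: ltnW.
  apply: leq_trans (_ : (msize F <= N)%N); last by rewrite -ltnS.
  rewrite -(prednK s0) ltnS msizeE; apply/bigmax_leqP_seq => mm hmm _.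
  have := msize_mdeg_lt (hG _ hmm); rewrite mdegMn.
  have [->|m0] := posnP (mdeg mm); first by move: szF; case: (msize F).
  have : (mdeg mm < mdeg mm * p)%N by rewrite -{1}[mdeg mm]muln1 ltn_pmul2l.
  by move=> h1 h2; rewrite -ltnS (prednK s0); exact: leq_ltn_trans h1 h2.
have ch0 : [pchar K] =i pred0 by move=> p; apply/negbTE/negP => h; apply: noc; exists p.
have szF : (msize F <= 1)%N.
  rewrite msizeE; apply/bigmax_leqP_seq => mm hmm _.
  rewrite ltnS leqn0 mdegE big1 // => j _; apply/eqP.
  by rewrite -((pcharf0P K).1 ch0) (key _ _ hmm).
move: hF; rewrite (msize1_polyC szF) mmapC => /eqP; rewrite mpolyC_eq0 => /eqP ->.
by rewrite mpolyC0.
Qed.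

End AlgIndep.

(** The number [r * D] bounds the multipliers that [sepind_homog] collects: one for each form and
    each order below [D]. *)
Lemma strong_alg_indep D r : (forall d, (d <= D)%N -> star d) -> exists s,
  forall (K : closedFieldType) n (E : seq (nat * {mpoly K[n]})),
  (size E <= r)%N -> wf D E -> strong s E -> 
  (forall h : 'I_(size E) -> {mpoly K[n]},
     (forall i, \sum_j h j * ((nth (0%N, 0) E (nat_of_ord j)).2)^`M(i) = 0) -> forall j, h j = 0) /\
  forall F : {mpoly K[size E]},
    mmap (@mpolyC n K) (fun j => (nth (0%N, 0) E (nat_of_ord j)).2) F = 0 -> F = 0.
Proof.
move=> hstar.
have [||s [N h]] := @fin_uniform _ (fun (d : 'I_D.+1) s _ =>
  forall (K : closedFieldType) n (f : {mpoly K[n]}),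
  (0 < d)%N -> f \is d.-homog -> gradweak (r * D) d f -> weak s d f).
- by move=> d s s' _ _ hs _ h K n f h0 h1 h2; apply: weak_le (h K n f h0 h1 h2).
- by move=> d; have [|s h] := hstar d _ (r * D)%N; [rewrite -ltnS | exists s, 0%N].
exists s => K n E hE wE sE.
have sep := @sepind_ord K n E D r s hE wE sE (fun d f hd => h (Ordinal (hd : (d < D.+1)%N)) K n f).
by split=> // F; apply: alg_independent.
Qed.

(** * Regularity of forms with generic coefficients *)

Lemma mpoly_ring_ind (A : comNzRingType) n (Q : {mpoly A[n]} -> Prop) :
  (forall f g, Q f -> Q g -> Q (f + g)) -> (forall f g, Q f -> Q g -> Q (f * g)) ->
  (forall a, Q a%:MP) -> (forall i, Q 'X_i) -> forall f, Q f.
Proof.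
move=> QD QM QC QX f; apply: (@mpoly_scale_ind _ _ Q) => //.
- by rewrite -(mpolyC0 n A).
- by move=> a g hg; rewrite -mul_mpolyC; apply: QM.
move=> m _; rewrite mpolyXE_id; apply: (big_ind Q) => // [|i _]; first by rewrite -mpolyC1.
by elim: (m i) => [|k IH]; rewrite ?expr0 -?mpolyC1 // exprS; apply: QM.
Qed.

Section Fresh.
Variables (R : comNzRingType) (psi : {rmorphism R -> {poly R}}).
Hypothesis psi0 : forall x, (psi x)`_0 = x.

Lemma psi_ideal s x : (forall a, a \in s -> psi a = a%:P) -> idadd (@zeroid R) s x ->
  polyid (idadd (@zeroid R) s) (psi x).
Proof.
have idI : is_ideal (idadd (@zeroid R) s) by apply/idadd_ideal/zeroid_ideal.
move=> hs /idadd0P [cs [_ ->]]; rewrite /lcomb rmorph_sum big_seq.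
apply: ideal_sum; first exact: polyid_ideal.
move=> [c a] /mem_zip /andP[_ ha] /=; rewrite rmorphM (hs a) // => i.
by rewrite coefMC; apply: idealM => //; apply: idadd_gen => //; exact: zeroid_ideal.
Qed.

(* [F] is linear in a variable that the generators do not involve. *)
Lemma fresh_nzd s (F c z : R) : (forall a, a \in s -> psi a = a%:P) ->
  psi F = c%:P + z%:P * 'X -> nzd (fun u => u = 1) (idadd (@zeroid R) s) z ->
  nzd (fun u => u = 1) (idadd (@zeroid R) s) F.
Proof.
move=> hs eF hz x; rewrite !sat1 => hx.
set I := idadd _ s in hz hx *.
have idI : is_ideal I by apply/idadd_ideal/zeroid_ideal.
have hG := psi_ideal hs hx; rewrite rmorphM eF -/I in hG.
suff G : polyid I (psi x).
  by have := G 0%N; rewrite psi0.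
apply: NNPP => hno.
have [i hi] : exists i, ~ I (psi x)`_i.
  by apply: NNPP => hn; apply: hno => i; apply: NNPP => h; apply: hn; exists i.
have [|j [hj jmax]] := @exists_min _ (fun i => (size (psi x) - i)%N) (fun i => ~ I (psi x)`_i).
  by exists i.
apply: hj; have := hG j.+1; rewrite mulrDl coefD coefCM -mulrA coefCM -[_ * psi x]commr_polyX coefMX /=.
have hj1 : I (psi x)`_j.+1.
  have [lt|ge] := leqP (size (psi x)) j.+1.
    by rewrite nth_default //; exact: ideal0.
  by apply: NNPP => hn; have := jmax _ hn; lia.
rewrite (idealDl idI _ (idealM idI c hj1)) => h.
by have := hz ((psi x)`_j); rewrite !sat1; apply.
Qed.

End Fresh.

(** The endomorphism [theta] identifies the quotient by [s] with a subring of a domain, in which a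
    nonzero element is regular. *)
Lemma retract_nzd (R : idomainType) (theta : {rmorphism R -> R}) s v :
  (forall a, a \in s -> theta a = 0) -> (forall x, idadd (@zeroid R) s (x - theta x)) ->
  theta v != 0 -> nzd (fun u => u = 1) (idadd (@zeroid R) s) v.
Proof.
move=> hs hth hv x; rewrite !sat1 => hx.
have idI : is_ideal (idadd (@zeroid R) s) by apply/idadd_ideal/zeroid_ideal.
have : theta (v * x) = 0.
  move: hx => /idadd0P [cs [_ ->]]; rewrite /lcomb rmorph_sum big_seq big1 //.
  by move=> [c a] /mem_zip /andP[_ ha] /=; rewrite rmorphM (hs a ha) mulr0.
move/eqP; rewrite rmorphM mulf_eq0 (negbTE hv) /= => /eqP e.
by have := hth x; rewrite e subr0.
Qed.

(** * Base change to a larger domain of coefficients *)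

Section Base.
Variables (A L : idomainType) (io : {rmorphism A -> L}) (r : nat).
Hypothesis ioI : forall a, io a = 0 -> a = 0.

Definition indepL (w : seq L) := forall bs : seq A, size bs = size w ->
  \sum_(p <- zip bs w) io p.1 * p.2 = 0 -> forall b, b \in bs -> b = 0.

Definition repL (a : A) w (l : L) := exists bs : seq A, size bs = size w /\
  io a * l = \sum_(p <- zip bs w) io p.1 * p.2.

Lemma zip_scale (b : A) (bs : seq A) (w : seq L) :
  \sum_(p <- zip [seq b * x | x <- bs] w) io p.1 * p.2 = io b * \sum_(p <- zip bs w) io p.1 * p.2.
Proof.
elim: bs w => [|x bs IH] [|y w]; rewrite /= ?big_nil ?mulr0 //.
by rewrite !big_cons IH rmorphM mulrDr mulrA.
Qed.

Lemma repL_basis (ls : seq L) : exists w a, [/\ indepL w, a != 0 & forall l, l \in ls -> repL a w l].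
Proof.
elim: ls => [|l ls [w [a [hw a0 hl]]]].
  by exists [::], 1; split=> //; [move=> [|b bs] | exact: oner_neq0].
case: (classic (indepL (l :: w))) => hlw.
  exists (l :: w), a; split=> // x; rewrite inE => /orP[/eqP->|/hl [bs [hbs e]]].
    exists (a :: nseq (size w) 0); rewrite /= size_nseq big_cons /=; split=> //.
    have -> : \sum_(p <- zip (nseq (size w) 0) w) io p.1 * p.2 = 0; last by rewrite addr0.
    by elim: (w) => [|y w' IH]; rewrite /= ?big_nil // big_cons IH rmorph0 mul0r addr0.
  by exists (0 :: bs); rewrite /= hbs big_cons rmorph0 mul0r add0r.
have [[|b bs] [hbs e hne]] : exists bs, [/\ size bs = size (l :: w),
    \sum_(p <- zip bs (l :: w)) io p.1 * p.2 = 0 & exists2 b, b \in bs & b <> 0].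
  apply: NNPP => hno; apply: hlw => bs h1 h2 b hb; apply: NNPP => hb0.
  by apply: hno; exists bs; split=> //; exists b.
- by [].
move: hbs e; rewrite /= => -[hbs]; rewrite big_cons /= => e.
have b0 : b != 0.
  apply/eqP => b0; move: e hne; rewrite b0 rmorph0 mul0r add0r => /(hw _ hbs) h0 [x].
  by rewrite inE => /orP[/eqP->|/h0].
exists w, (a * b); split=> //; first by rewrite mulf_neq0.
move=> x; rewrite inE => /orP[/eqP->|/hl [cs [hcs ex]]].
  exists [seq (- a) * y | y <- bs]; rewrite size_map zip_scale; split=> //.
  rewrite rmorphM rmorphN -mulrA; move/eqP: e; rewrite addr_eq0 => /eqP ->.
  by rewrite mulrN mulNr.
exists [seq b * y | y <- cs]; rewrite size_map zip_scale; split=> //.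
by rewrite rmorphM -ex mulrAC mulrC.
Qed.

Local Notation mio := (map_mpoly io : {mpoly A[r]} -> {mpoly L[r]}).

Definition repM (a : A) (w : seq L) (g : {mpoly L[r]}) := exists hs : seq {mpoly A[r]},
  size hs = size w /\ (io a)%:MP * g = \sum_(p <- zip hs w) mio p.1 * p.2%:MP.

Lemma repM_of a w g : (forall m, m \in msupp g -> repL a w g@_m) -> repM a w g.
Proof.
have rep0 : repM a w 0.
  exists (nseq (size w) 0); rewrite size_nseq mulr0; split=> //.
  by elim: (w) => [|y w' IH]; rewrite /= ?big_nil // big_cons raddf0 mul0r add0r -IH.
have repD g1 g2 : repM a w g1 -> repM a w g2 -> repM a w (g1 + g2).
  move=> [h1 [s1 e1]] [h2 [s2 e2]]; exists [seq p.1 + p.2 | p <- zip h1 h2].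
  rewrite size_map size_zip s1 s2 minnn mulrDr e1 e2; split=> //.
  elim: (w) h1 h2 s1 s2 {e1 e2} => [|y w' IH] [|x h1] [|z h2] //=; rewrite ?big_nil ?addr0 //.
  move=> [s1] [s2]; rewrite !big_cons -IH // raddfD /= mulrDl; ring.
move=> h; rewrite [g]mpolyE big_seq; apply: (big_ind (repM a w)) => // m /h [bs [hbs e]].
exists [seq b *: 'X_[m] | b <- bs]; rewrite size_map; split=> //.
rewrite -mul_mpolyC mulrA -mpolyCM e.
elim: bs (w) {hbs e} => [|b bs IH] [|y w'] /=; rewrite ?big_nil ?mpolyC0 ?mul0r //.
rewrite !big_cons mpolyCD mulrDl IH; congr (_ + _).
by rewrite map_mpolyZ map_mpolyX /= -mul_mpolyC mpolyCM mulrAC.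
Qed.

Lemma repM_basis (gs : seq {mpoly L[r]}) : exists w a,
  [/\ indepL w, a != 0 & forall g, g \in gs -> repM a w g].
Proof.
have [w [a [h1 h2 h3]]] := repL_basis (flatten [seq [seq g@_m | m <- msupp g] | g <- gs]).
exists w, a; split=> // g hg; apply: repM_of => m hm; apply: h3.
by apply/flatten_mapP; exists g => //; apply: map_f.
Qed.

Lemma indepM w (hs : seq {mpoly A[r]}) : indepL w -> size hs = size w ->
  \sum_(p <- zip hs w) mio p.1 * p.2%:MP = 0 -> forall h, h \in hs -> h = 0.
Proof.
move=> hw hsz e h hh; apply/mpolyP => m; rewrite mcoeff0.
apply: (hw [seq h@_m | h <- hs]); rewrite ?size_map //; last exact: (map_f (fun h : {mpoly A[r]} => h@_m)).
have := congr1 (mcoeff m) e; rewrite mcoeff0 raddf_sum /= => e'; rewrite -[RHS]e'.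
elim: hs (w) {hsz e hh e'} => [|x hs IH] [|y w'] /=; rewrite ?big_nil //.
by rewrite !big_cons IH [mio x * _]mulrC mcoeffCM mcoeff_map_mpoly mulrC.
Qed.

Definition neq0 (S : nzRingType) : S -> Prop := fun a => a <> 0.

(** This is flatness of an extension of fraction fields, done with denominators. The finitely many
    coefficients in a relation over [L] are expanded in a family [w] independent over [A], after
    multiplication by a common denominator [a]. Comparing coefficients of [w] gives relations over
    [A], to which regularity of [s] applies. *)
Lemma regT_base (s : seq {mpoly A[r]}) : reg (@zeroid _) s ->
  regT (cstT (@neq0 L)) (@zeroid _) (map mio s).
Proof.
elim/last_ind: s => [//|s b IH]; rewrite /reg -cats1 map_cat !regT_cat => -[/IH hs [hb _]].
split=> //; split=> // x [u [[l [l0 ->]]] /idadd0P [cs [hcs e]]].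
have [w [a [hw a0 hrep]]] := repM_basis (l%:MP * x :: cs).
exists ((io a * l)%:MP); split.
  exists (io a * l); split=> //; apply/eqP; rewrite mulf_neq0 //; last exact/eqP.
  by apply: contra a0 => /eqP /ioI ->.
have [xs [sxs ex]] := hrep _ (mem_head _ _).
have hcs' c : c \in cs -> repM a w c by move=> hc; apply: hrep; rewrite inE hc orbT.
have [ys [sys hys ey]] : exists ys : seq {mpoly A[r]},
    [/\ size ys = size w, forall y, y \in ys -> idadd (@zeroid _) s y &
     (io a)%:MP * lcomb cs (map mio s) = \sum_(p <- zip ys w) mio p.1 * p.2%:MP].
  have z0 : is_ideal (@zeroid {mpoly A[r]}) by exact: zeroid_ideal.
  elim: (s) cs hcs hcs' {e IH hs hb hrep ex} => [|c s' IH] [|d cs] //= hcs hcs'.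
    exists (nseq (size w) 0); rewrite size_nseq; split=> // [y|].
      by rewrite mem_nseq => /andP[_ /eqP ->].
    rewrite /lcomb /= big_nil mulr0.
    by elim: (w) => [|y w' IH]; rewrite /= ?big_nil // big_cons raddf0 mul0r add0r -IH.
  have [||ys [h1 h2 h3]] := IH cs; first by case: hcs.
    by move=> x' hx'; apply: hcs'; rewrite inE hx' orbT.
  have [ds [h4 h5]] := hcs' d (mem_head _ _).
  exists [seq c * p.1 + p.2 | p <- zip ds ys]; rewrite size_map size_zip h4 h1 minnn; split=> //.
    move=> _ /mapP[[p q] /mem_zip /andP[_ hq] ->] /=.
    have idc : is_ideal (idadd (isum (@zeroid _) c) s') by apply/idadd_ideal/isum_ideal.
    rewrite /= ; apply: (idealD idc).
      by apply: (idealMr idc); apply: idadd_sub; [exact: isum_ideal | exact: isum_gen].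
    by apply: idadd_mono (h2 _ hq) => z ->; apply: ideal0; exact: isum_ideal.
  rewrite lcomb_cons mulrDr h3 mulrA h5.
  elim: (w) ds ys h1 h4 {h2 h3 h5 hcs' hw sxs} => [|y w' IHw] [|p ds] [|q ys] //=;
    rewrite ?big_nil ?mul0r ?addr0 // => -[h1] [h4].
  rewrite !big_cons -(IHw ds ys h1 h4) /= raddfD /= rmorphM; ring.
have key : \sum_(p <- zip [seq b * p.1 - p.2 | p <- zip xs ys] w) mio p.1 * p.2%:MP = 0.
  have -> : \sum_(p <- zip [seq b * p.1 - p.2 | p <- zip xs ys] w) mio p.1 * p.2%:MP =
    mio b * (\sum_(p <- zip xs w) mio p.1 * p.2%:MP) - \sum_(p <- zip ys w) mio p.1 * p.2%:MP.
    elim: (w) xs ys sxs sys {hw ex hys ey hrep hcs'} => [|y w' IHw] [|p xs] [|q ys] //=;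
      rewrite ?big_nil ?mulr0 ?subr0 // => -[h1] [h4].
    rewrite !big_cons (IHw xs ys h1 h4) /= raddfB /= rmorphM; ring.
  rewrite -ex -ey -e; ring.
have zs y : y \in [seq b * p.1 - p.2 | p <- zip xs ys] -> y = 0.
  by apply: (indepM hw _ key); rewrite size_map size_zip sxs sys minnn.
have xin y : y \in xs -> idadd (@zeroid _) s y.
  move=> hy; have := hb y; rewrite !sat1; apply.
  pose i := index y xs; have lti : (i < size xs)%N by rewrite index_mem.
  have lti' : (i < size ys)%N by rewrite sys -sxs.
  have : b * y - nth 0 ys i = 0.
    apply: zs; apply/mapP; exists (y, nth 0 ys i) => //.
    rewrite -{1}(nth_index 0 hy) -/i -nth_zip ?sxs ?sys //.
    by apply: mem_nth; rewrite size_zip sxs sys minnn -sxs.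
  by move/eqP; rewrite subr_eq0 => /eqP ->; apply: hys; apply: mem_nth.
rewrite mpolyCM -mulrA ex big_seq.
have idI : is_ideal (idadd (@zeroid {mpoly L[r]}) (map mio s)) by apply/idadd_ideal/zeroid_ideal.
apply: (ideal_sum idI) => -[y w'] /mem_zip /andP[hy _] /=.
apply: (idealMr idI); move: (xin _ hy) => /idadd0P [ds [hds ->]]; apply/idadd0P.
exists (map mio ds); rewrite !size_map hds; split=> //.
rewrite /lcomb raddf_sum /=.
by elim: (s) (ds) => [|p s' IHs] [|q ds'] /=; rewrite ?big_nil // !big_cons IHs rmorphM.
Qed.

End Base.

Lemma mmapU n (A S : nzRingType) (g : {rmorphism A -> S}) (h : 'I_n -> S) i :
  mmap g h 'X_i = h i.
Proof. by rewrite mmapX mmap1U. Qed.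

Lemma idadd_morph (R S : comNzRingType) (g : {rmorphism R -> S}) s x :
  idadd (@zeroid R) s x -> idadd (@zeroid S) (map g s) (g x).
Proof.
move=> /idadd0P [cs [hcs ->]]; apply/idadd0P; exists (map g cs); rewrite !size_map; split=> //.
by rewrite /lcomb rmorph_sum; elim: cs s {hcs} => [|c cs IH] [|a s] /=; rewrite ?big_nil // !big_cons IH rmorphM.
Qed.

Lemma vars_retract (A : comNzRingType) n (P : pred 'I_n) (f : {mpoly A[n]}) s :
  (forall i, P i -> 'X_i \in s) ->
  idadd (@zeroid _) s (f - mmap (@mpolyC n A) (fun i => if P i then 0 else 'X_i) f).
Proof.
move=> hs; set th := mmap _ _; have idI : is_ideal (idadd (@zeroid {mpoly A[n]}) s).
  by apply/idadd_ideal/zeroid_ideal.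
apply: (mpoly_ring_ind (Q := fun f => idadd (@zeroid _) s (f - th f))) => [g h hg hh|g h hg hh|a|i].
- rewrite /th rmorphD -/th; have -> : g + h - (th g + th h) = (g - th g) + (h - th h) by ring.
  exact: idealD.
- rewrite /th rmorphM -/th; have -> : g * h - th g * th h = g * (h - th h) + (g - th g) * th h by ring.
  by apply: idealD; [|apply: idealM |apply: idealMr].
- by rewrite /th mmapC subrr; apply: ideal0.
rewrite /th mmapU; case: ifP => [/hs hi|_]; last by rewrite subrr; apply: ideal0.
by rewrite subr0; apply: idadd_gen => //; exact: zeroid_ideal.
Qed.

Lemma vars_reg (A : idomainType) n (l : seq 'I_n) : uniq l ->
  reg (@zeroid {mpoly A[n]}) [seq 'X_i | i <- l].
Proof.
elim/last_ind: l => [//|l i IH]; rewrite rcons_uniq map_rcons -cats1 => /andP[il ul].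
rewrite /reg regT_cat; split; first exact: IH.
split=> //; apply: (@retract_nzd _ (mmap (@mpolyC n A) (fun i => if i \in l then 0 else 'X_i))).
- by move=> _ /mapP[j jl ->] /=; rewrite mmapU jl.
- by move=> x; apply: vars_retract => j hj; apply: map_f.
by rewrite /= mmapU (negbTE il) -msupp_eq0 msuppX.
Qed.

(** * Descent of regularity from a generic subspace *)

Section Descent.
Variables (K : closedFieldType) (n N r : nat).
Local Notation L := {mpoly K[N]}.
Variable X : 'I_r -> 'I_n -> L.

Definition spread : {rmorphism {mpoly K[n]} -> {mpoly L[r]}} :=
  mmap (@mpolyC r L \o @mpolyC N K) (fun i => \sum_a (X a i)%:MP * 'X_a).

Lemma spread_homog d f : f \is d.-homog -> spread f \is d.-homog.
Proof.
apply: (mmap_graded (H := fun d (x : {mpoly L[r]}) => x \is d.-homog)).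
- by move=> e; apply: rpred0.
- by move=> e x y hx hy; apply: rpredD.
- by move=> e a x hx; rewrite mul_mpolyC; apply: rpredZ.
- exact: dhomog1.
- move=> i; apply: rpred_sum => a _; rewrite mul_mpolyC; apply: rpredZ.
  by rewrite dhomogX /= mdeg1.
by move=> e e' x y; apply: dhomogM.
Qed.

(** Let [tau f] be [f] at the sum of the point [x] and a generic point of the subspace. Modulo the
    coordinates of [x] it becomes [spread f], so these coordinates followed by the [tau f] form a
    regular sequence, and the grading allows the coordinates to be dropped. A relation for the
    [tau f] with constant denominator [l] is specialized at a point where [l] does not vanish, with
    the parameters of the subspace set to 0; there [tau f] becomes [f]. *)
Lemma spread_reg fs : (forall f, f \in fs -> posform f) ->
  regT (cstT (@neq0 L)) (@zeroid _) (map spread fs) -> reg (@zeroid _) fs.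
Proof.
move=> hfs hreg.
pose W := {mpoly L[n + r]}.
pose tau : {mpoly K[n]} -> W := mmap (@mpolyC (n + r) L \o @mpolyC N K)
  (fun i => 'X_(lshift r i) + \sum_a (X a i)%:MP * 'X_(rshift n a)).
pose pr : W -> {mpoly L[r]} := mmap (@mpolyC r L)
  (fun k => match fintype.split k with inl _ => 0 | inr a => 'X_a end).
pose io : {mpoly L[r]} -> W := mmap (@mpolyC (n + r) L) (fun a => 'X_(rshift n a)).
have prio g : pr (io g) = g.
  apply: (@mpoly_rmorph_ext _ _ _ (pr \o io : {rmorphism _ -> _}) idfun) => [a|i] /=.
    by rewrite /io /pr !mmapC.
  by rewrite /io /pr !mmapU (unsplitK (inr i : 'I_n + 'I_r)%type).
have prtau f : pr (tau f) = spread f.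
  apply: (@mpoly_rmorph_ext _ _ _ (pr \o tau : {rmorphism _ -> _}) spread) => [a|i] /=.
    by rewrite /tau /pr /spread /= !mmapC /= ?mmapC.
  rewrite /tau /spread !mmapU /pr rmorphD rmorph_sum /= mmapU (unsplitK (inl i : 'I_n + 'I_r)%type) add0r.
  by apply: eq_bigr => a _; rewrite rmorphM /= mmapC mmapU (unsplitK (inr a : 'I_n + 'I_r)%type).
pose xs : seq W := [seq 'X_i | i <- [seq lshift r i | i <- enum 'I_n]].
have T1 : neq0 (1 : L) by apply/eqP/oner_neq0.
have TM (u v : L) : neq0 u -> neq0 v -> neq0 (u * v).
  by move=> /eqP u0 /eqP v0; apply/eqP; rewrite mulf_neq0.
have ker : (fun x => zeroid (pr x)) = idadd (@zeroid W) xs.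
  apply: predext => x; split=> [e|/(idadd_morph pr)].
    have -> : x = x - mmap (@mpolyC (n + r) L) 
        (fun k => if fintype.split k is inl _ then 0 else 'X_k) x.
      rewrite (_ : mmap _ _ x = 0) ?subr0 //.
      suff <- : io (pr x) = mmap (@mpolyC (n + r) L) 
        (fun k => if fintype.split k is inl _ then 0 else 'X_k) x by rewrite e /io rmorph0.
      apply: (@mpoly_rmorph_ext _ _ _ (io \o pr : {rmorphism _ -> _}) (mmap (@mpolyC (n + r) L) 
        (fun k => if fintype.split k is inl _ then 0 else 'X_k))) => [a|k] /=.
        by rewrite /io /pr !mmapC.
      rewrite /io /pr !mmapU; case: fintype.splitP => j hj; rewrite ?rmorph0 // mmapU.
      by congr 'X_ _; apply: val_inj.
    have := @vars_retract L (n + r) (fun k => if fintype.split k is inl _ then true else false) x xs.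
    rewrite [X in mmap _ X](_ : _ = fun k => if fintype.split k is inl _ then 0 else 'X_k); last first.
      by apply: functional_extensionality => k; case: fintype.split.
    apply=> k; case: fintype.splitP => // j hj _; apply: map_f; apply/mapP; exists j; rewrite ?mem_enum //.
    exact: val_inj.
  apply: (idadd_min (zeroid_ideal _)) => // y /mapP[_ /mapP[_ /mapP[i _ ->] ->] ->].
  by rewrite /zeroid /= /pr mmapU (unsplitK (inl i : 'I_n + 'I_r)%type).
have rtau : regT (cstT (@neq0 L)) (@zeroid W) (map tau fs).
  apply: (regT_graded_dropl T1 TM (t := xs)).
    move=> z; rewrite mem_cat => /orP[/mapP[i _ ->]|/mapP[f /hfs [d d0 hd] ->]].
      by exists 1%N => //; rewrite dhomogX /= mdeg1.
    exists d => //; move: hd; apply: (mmap_graded (H := fun d (x : W) => x \is d.-homog)).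
    - by move=> e; apply: rpred0.
    - by move=> e x y hx hy; apply: rpredD.
    - by move=> e a x hx; rewrite mul_mpolyC; apply: rpredZ.
    - exact: dhomog1.
    - move=> i; apply: rpredD; first by rewrite dhomogX /= mdeg1.
      apply: rpred_sum => a _; rewrite mul_mpolyC; apply: rpredZ.
      by rewrite dhomogX /= mdeg1.
    by move=> e e' x y; apply: dhomogM.
  rewrite regT_cat; split.
    apply: (@regT_T _ (fun u => u = 1)) => //; first exact: zeroid_ideal.
    - by move=> u ->; apply: cstT1.
    - by move=> u v; apply: cstTM.
    by apply: vars_reg; rewrite map_inj_uniq ?enum_uniq //; exact: lshift_inj.
  rewrite -ker; apply/(@regT_preim _ _ pr _ (cstT (@neq0 L))) => //; first exact: zeroid_ideal.
  - by move=> y; exists (io y).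
  - by move=> _ [a [a0 ->]]; exists a; rewrite /pr /= mmapC.
  - by move=> _ [a [a0 ->]]; exists a%:MP; rewrite /pr /= mmapC; split=> //; exists a.
  by rewrite -map_comp (eq_map (g := spread)).
elim/last_ind: fs {hfs hreg} rtau => [//|fs f IH]; rewrite map_rcons -!cats1.
rewrite /reg !regT_cat => -[/IH h1 [h2 _]]; split=> //; split=> // g; rewrite !sat1 => hg.
have [|_ [[l [l0 ->]]]] := h2 (tau g).
  exists 1; split; first by exists 1; rewrite mpolyC1.
  by rewrite mul1r -rmorphM; apply: idadd_morph.
have [v hv] := mpoly_nonroot (introN eqP l0).
pose ev : W -> {mpoly K[n]} := mmap (@mpolyC n K \o @meval N K v)
  (fun k => match fintype.split k with inl i => 'X_i | inr a => 0 end).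
have evtau h : ev (tau h) = h.
  apply: (@mpoly_rmorph_ext _ _ _ (ev \o tau : {rmorphism _ -> _}) idfun) => [a|i] /=.
    by rewrite /tau /ev !mmapC /= mevalC.
  rewrite /tau /ev !mmapU rmorphD rmorph_sum /= mmapU (unsplitK (inl i : 'I_n + 'I_r)%type).
  rewrite big1 ?addr0 // => a _.
  by rewrite rmorphM /= mmapU (unsplitK (inr a : 'I_n + 'I_r)%type) mulr0.
move=> H; have := idadd_morph ev H; rewrite -map_comp (eq_map (g := id)) // map_id => hh0.
have hh : idadd (@zeroid _) fs ((l.@[v])%:MP * g).
  have <- : ev (l%:MP * tau g) = (l.@[v])%:MP * g; last exact: hh0.
  by rewrite -[in RHS](evtau g) /ev rmorphM /= mmapC.
have idI : is_ideal (idadd (@zeroid {mpoly K[n]}) fs) by apply/idadd_ideal/zeroid_ideal.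
have := idealM idI ((l.@[v])^-1)%:MP hh; rewrite mulrA -mpolyCM mulVf // mpolyC1 mul1r.
by [].
Qed.

End Descent.

Section StrongTools.
Variable K : fieldType.

Lemma strong_perm n s (E E' : seq (nat * {mpoly K[n]})) : perm_eq E E' -> strong s E -> strong s E'.
Proof.
move=> pE sE c d hc hd hw x xc.
have /(perm_iotaP (0%N, 0)) [Is pI eE] := pE.
have ez : zip [seq nth 0 c i | i <- Is] E = [seq nth (0, (0%N, 0)) (zip c E') i | i <- Is].
  rewrite {1}eE; elim: {pI eE} Is => //= i Is ->; congr (_ :: _).
  by rewrite nth_zip.
have pz : perm_eq (zip [seq nth 0 c i | i <- Is] E) (zip c E').
  by apply/(perm_iotaP (0, (0%N, 0))); exists Is => //; rewrite size_zip hc minnn.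
have sI : size Is = size E by rewrite eE size_map.
have h0 := sE [seq nth 0 c i | i <- Is] d.
have {h0}h0 : forall y, y \in [seq nth 0 c i | i <- Is] -> y = 0.
  apply: h0; rewrite ?size_map //.
    by move=> p hp; apply: hd; rewrite -(perm_mem pz).
  by rewrite /lc (perm_big _ pz).
apply: h0; have lt : (index x c < size E')%N by rewrite -hc index_mem.
rewrite -(nth_index 0 xc); apply: map_f; rewrite (perm_mem pI) mem_iota //.
Qed.

Lemma homog_mmap N n (h : 'I_N -> {mpoly K[n]}) d f : (forall i, h i \is 1.-homog) ->
  f \is d.-homog -> mmap (@mpolyC n K) h f \is d.-homog.
Proof.
move=> hh; apply: (mmap_graded (H := fun d (x : {mpoly K[n]}) => x \is d.-homog)) => //.
- by move=> e; apply: rpred0.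
- by move=> e x y hx hy; apply: rpredD.
- by move=> e a x hx; rewrite mul_mpolyC; apply: rpredZ.
- exact: dhomog1.
by move=> e e' x y; apply: dhomogM.
Qed.

Lemma weak_mmap N n (h : 'I_N -> {mpoly K[n]}) s d f : (forall i, h i \is 1.-homog) ->
  weak s d f -> weak s d (mmap (@mpolyC n K) h f).
Proof.
move=> hh [ps [h1 h2 ->]].
exists [seq (p.1, (mmap (@mpolyC n K) h p.2.1, mmap (@mpolyC n K) h p.2.2)) | p <- ps].
rewrite size_map; split=> // [_ /mapP[p /h2 [p1 p2 p3 p4] ->] /=|].
  by split=> //; apply: homog_mmap.
by rewrite big_map rmorph_sum; apply: eq_bigr => p _; rewrite rmorphM.
Qed.

Lemma lc_enum n (I : finType) (C : I -> K) (g : I -> nat * {mpoly K[n]}) :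
  lc (map C (enum I)) (map g (enum I)) = \sum_i C i *: (g i).2.
Proof.
rewrite /lc; have -> : zip (map C (enum I)) (map g (enum I)) = [seq (C i, g i) | i <- enum I].
  by elim: (enum I) => //= i l ->.
by rewrite big_map big_enum.
Qed.

Lemma seq_enum (T : eqType) (x0 : T) (I : finType) (c : seq T) : size c = #|I| ->
  exists C : I -> T, c = map C (enum I).
Proof.
move=> hc; exists (fun i => nth x0 c (enum_rank i)).
apply: (@eq_from_nth _ x0); first by rewrite size_map -cardE.
move=> i hi.
rewrite hc in hi; rewrite (nth_map (enum_val (Ordinal hi))) -?cardE //.
by rewrite -(enum_val_nth (A := I) _ (Ordinal hi)) enum_valK.
Qed.

Lemma degs_enum n (I : finType) (C : I -> K) (g : I -> nat * {mpoly K[n]}) d :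
  degs_in (map C (enum I)) (map g (enum I)) d -> forall i, C i != 0 -> (g i).1 = d.
Proof.
move=> h i hi; apply: (h (C i, g i)) => //=.
have -> : zip (map C (enum I)) (map g (enum I)) = [seq (C i, g i) | i <- enum I].
  by elim: (enum I) => //= j l ->.
by apply: (map_f (fun i => (C i, g i))); rewrite mem_enum.
Qed.

Lemma lc_mmap0 N n (h : 'I_N -> {mpoly K[n]}) c M :
  (forall m, m \in M -> mmap (@mpolyC n K) h m.2 = 0) -> mmap (@mpolyC n K) h (lc c M) = 0.
Proof.
move=> hM; rewrite /lc rmorph_sum big_seq big1 // => -[a m] /mem_zip /andP[_ hm] /=.
by rewrite mmapZ hM // mulr0.
Qed.

End StrongTools.

Lemma meval_delta (A : comNzRingType) r (a : 'I_r) d (g : {mpoly A[r]}) : g \is d.-homog ->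
  g.@[fun i => (i == a)%:R] = g@_(U_(a) *+ d).
Proof.
move=> hg; rewrite mevalE [in RHS](mpolyE g) raddf_sum /= big_seq [RHS]big_seq.
apply: eq_bigr => m hm; rewrite mcoeffZ mcoeffX; congr (_ * _).
have dm : mdeg m = d := dhomog_mf hg hm.
have [->|ne] := eqVneq m (U_(a) *+ d)%MM.
  rewrite big1 // => i _; rewrite mulmnE mnm1E eq_sym; case: eqP => _; first by rewrite expr1n.
  by rewrite mul0n expr0.
have [i ia mi] : exists2 i, i != a & (m i != 0)%N.
  apply: NNPP => hno; case/eqP: ne; apply/mnmP => i; rewrite mulmnE mnm1E eq_sym.
  have z i' : i' != a -> m i' = 0%N.
    by move=> ia; apply/eqP/negPn/negP => mi; apply: hno; exists i'.
  case: eqP => [->|/eqP ia]; last by rewrite mul0n z.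
  rewrite mul1n -dm mdegE (bigD1 a) //= big1 ?addn0 // => j ja; exact: z.
by rewrite (bigD1 i) //= (negbTE ia) expr0n (negbTE mi) mul0r.
Qed.

(** * Coefficients of the restrictions to generic vectors *)

Section Generic.
Variables (K : closedFieldType) (n r : nat) (d : 'I_r -> nat) (f : 'I_r -> {mpoly K[n]}).
Hypothesis fh : forall j, f j \is (d j).-homog.
Hypothesis d0 : forall j, (0 < d j)%N.
Local Notation N := #|{: 'I_r * 'I_n}|.
Local Notation L := {mpoly K[N]}.

Definition gv (a : 'I_r) (i : 'I_n) : L := 'X_(enum_rank (a, i)).
(** The value of the form [f p.1] at the generic vector with index [p.2]. By [spread_pure] it is the
    coefficient of a pure power in the restriction. *)
Definition pure (p : 'I_r * 'I_r) : nat * L := (d p.1, mmap (@mpolyC N K) (gv p.2) (f p.1)).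
Local Notation sp := (spread gv).
Definition mixed (j : 'I_r) (m : 'X_{1..r}) := (mdeg m == d j) && [forall a, m != (U_(a) *+ d j)%MM].

Lemma spread_coef_homog j m : (sp (f j))@_m \is (d j).-homog.
Proof.
move: (fh j) m; apply: (mmap_graded (H := fun d (x : {mpoly L[r]}) => forall m, x@_m \is d.-homog)).
- by move=> e m; rewrite mcoeff0 rpred0.
- by move=> e x y hx hy m; rewrite mcoeffD rpredD.
- by move=> e a x hx m; rewrite mcoeffCM mul_mpolyC rpredZ.
- by move=> m; rewrite mcoeff1; case: eqP => _; [exact: dhomog1 | exact: rpred0].
- move=> i m; rewrite raddf_sum; apply: rpred_sum => a _ /=; rewrite mcoeffCM mcoeffX.
  by case: eqP => _; rewrite ?mulr1 ?mulr0 ?rpred0 // dhomogX /= mdeg1.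
move=> e e' x y hx hy m; rewrite mcoeffM; apply: rpred_sum => k _; exact: dhomogM.
Qed.

Lemma spread_pure j a : (sp (f j))@_(U_(a) *+ d j) = (pure (j, a)).2.
Proof.
rewrite -(meval_delta a (spread_homog gv (fh j))) /pure /=.
apply: (@mpoly_rmorph_ext _ _ _ (meval (fun i => (i == a)%:R) \o sp : {rmorphism _ -> _})
  (mmap (@mpolyC N K) (gv a))) => [c|i] /=.
  by rewrite /spread /= !mmapC /= mevalC.
rewrite /spread /= !mmapU rmorph_sum /= (bigD1 a) //= big1 => [|b ba].
  by rewrite addr0 rmorphM /= mevalC mevalXU eqxx mulr1.
by rewrite rmorphM /= mevalC mevalXU (negbTE ba) mulr0.
Qed.

(** The specialization that makes the vector [a] the tautological point of the original space and
    all other vectors zero. It kills mixed coefficients and the values at other vectors, and returns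
    [f j] from its value at [a]. *)
Definition rho_var (a : 'I_r) (k : 'I_N) : {mpoly K[n]} :=
  if (enum_val k).1 == a then 'X_((enum_val k).2) else 0.
Local Notation rho a := (mmap (@mpolyC n K) (rho_var a)).

Lemma rho_var_homog a k : rho_var a k \is 1.-homog.
Proof. by rewrite /rho_var; case: ifP => _; rewrite ?rpred0 // dhomogX /= mdeg1. Qed.

Lemma rho_gv a b i : rho a (gv b i) = if b == a then 'X_i else 0.
Proof. by rewrite /gv mmapU /rho_var enum_rankK. Qed.

Lemma rho_pure a p : rho a (pure p).2 = if p.2 == a then f p.1 else 0.
Proof.
case: p => j b /=.
have -> : rho a (mmap (@mpolyC N K) (gv b) (f j)) =
    mmap (@mpolyC n K) (fun i => if b == a then 'X_i else 0) (f j).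
  apply: (@mpoly_rmorph_ext _ _ _ (rho a \o mmap (@mpolyC N K) (gv b) : {rmorphism _ -> _})
    (mmap (@mpolyC n K) (fun i => if b == a then 'X_i else 0))) => [c|i] /=; first by rewrite !mmapC.
  by rewrite [mmap _ (gv b) _]mmapU rho_gv mmapU.
case: eqP => _.
  apply: (@mpoly_rmorph_ext _ _ _ (mmap (@mpolyC n K) (fun i => 'X_i)) idfun) => [c|i] /=.
    by rewrite mmapC.
  by rewrite mmapU.
move: (d0 j); have := fh j; move: (d j) (f j); apply: (mmap_graded (H := fun d (x : {mpoly K[n]}) => (0 < d)%N -> x = 0)) => //.
- by move=> e x y hx hy he; rewrite hx // hy // addr0.
- by move=> e c x hx he; rewrite hx // mulr0.
move=> e e' x y hx hy; case: e hx => [|e] hx he; last by rewrite hx // mul0r.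
by rewrite hy // mulr0.
Qed.

Lemma rho_mixed a j m : mixed j m -> rho a (sp (f j))@_m = 0.
Proof.
move=> /andP[/eqP dm /forallP hm].
pose bad (k : 'X_{1..r}) := exists2 b, b != a & (k b != 0)%N.
have Q (phi : {rmorphism {mpoly K[n]} -> {mpoly L[r]}}) (th : {rmorphism L -> {mpoly K[n]}}) :
    (forall c k, bad k -> th (phi c%:MP)@_k = 0) -> (forall i k, bad k -> th (phi 'X_i)@_k = 0) ->
    forall g k, bad k -> th (phi g)@_k = 0.
  move=> hC hX; apply: mpoly_ring_ind => //.
    by move=> g h hg hh k hk; rewrite rmorphD mcoeffD rmorphD hg // hh // addr0.
  move=> g h hg hh k [b ba hk]; rewrite rmorphM mcoeffM rmorph_sum big1 // => -[k1 k2] /= /eqP ek.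
  rewrite rmorphM; have : ((k1 + k2)%MM b != 0)%N by rewrite -ek.
  rewrite mnmDE addn_eq0 negb_and => /orP[h1|h2].
    by rewrite hg ?mul0r //; exists b.
  by rewrite hh ?mulr0 //; exists b.
apply: (Q sp (rho a)) => [c k [b ba hk]|i k [b ba hk]|].
- rewrite /spread /= mmapC /= mcoeffC; case: (eqVneq k 0%MM) hk => [->|_ _]; first by rewrite mnm0E.
  by rewrite mulr0 rmorph0.
- rewrite /spread /= mmapU !raddf_sum /= big1 // => b' _.
  rewrite mcoeffCM mcoeffX rmorphM /= rho_gv; case: (eqVneq b' a) => [->|_]; last by rewrite mul0r.
  case: (eqVneq U_(a)%MM k) hk => [<-|_ _]; last by rewrite rmorph0 mulr0.
  by rewrite mnm1E [a == b]eq_sym (negbTE ba).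
apply: NNPP => hno; case/eqP: (hm a); apply/mnmP => i; rewrite mulmnE mnm1E eq_sym.
have z i' : i' != a -> m i' = 0%N.
  by move=> ia; apply/eqP/negPn/negP => mi; apply: hno; exists i'.
case: eqP => [->|/eqP ia]; last by rewrite mul0n z.
rewrite mul1n -dm mdegE (bigD1 a) //= big1 ?addn0 // => k ka; exact: z.
Qed.

(** Applying [rho] for the index [a] to a weak combination leaves a weak combination of the [f j]
    alone, whose coefficients are those of the values at the vector [a]. This is the condition under
    which [soft_refine] may sacrifice mixed coefficients. *)
Lemma pure_base s (M : seq (nat * L)) : strong s [seq (d j, f j) | j <- enum 'I_r] ->
  (forall m, m \in M -> exists j k, mixed j k /\ m.2 = (sp (f j))@_k) ->
  forall c1 c2 e, size c1 = size (map pure (enum {: 'I_r * 'I_r})) -> size c2 = size M ->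
     degs_in c1 (map pure (enum {: 'I_r * 'I_r})) e -> degs_in c2 M e ->
     weak s e (lc c1 (map pure (enum {: 'I_r * 'I_r})) + lc c2 M) ->
     forall x, x \in c1 -> x = 0.
Proof.
move=> hs hM c1 c2 e; rewrite size_map -cardE => /(seq_enum 0) [C ->] _ /degs_enum hd _.
rewrite lc_enum => hw _ /mapP[[j a] _ ->].
have hw' : weak s e (lc [seq C (i, a) | i <- enum 'I_r] [seq (d j, f j) | j <- enum 'I_r]).
  move: (weak_mmap (rho_var_homog a) hw); rewrite rmorphD /= lc_mmap0 ?addr0 => [|m hm]; last first.
    by have [j' [k [h1 ->]]] := hM m hm; apply: rho_mixed.
  rewrite lc_enum; congr weak; rewrite rmorph_sum /=.
  transitivity (\sum_i \sum_b (if b == a then C (i, b) *: f i else 0)).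
    rewrite pair_bigA /=; apply: eq_bigr => -[i b] _.
    by rewrite mmapZ rho_pure mul_mpolyC /=; case: ifP => _ //; rewrite scaler0.
  by apply: eq_bigr => i _; rewrite -big_mkcond big_pred1_eq.
apply: (hs _ e _ _ hw'); rewrite ?size_map //; last by apply: (map_f (fun i => C (i, a))); rewrite mem_enum.
rewrite /degs_in; have -> : zip [seq C (i, a) | i <- enum 'I_r] [seq (d j, f j) | j <- enum 'I_r] =
   [seq (C (i, a), (d i, f i)) | i <- enum 'I_r] by elim: (enum 'I_r) => //= i l ->.
by move=> _ /mapP[i _ ->] /= hC; apply: (hd (i, a)).
Qed.

End Generic.

Section Lift.
Variables (K : closedFieldType) (N r t : nat) (x : 'I_t -> {mpoly K[N]}).
Local Notation A := {mpoly K[t]}.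
Local Notation B := {mpoly A[r]}.

(** Translation of the variable [v] by a new indeterminate. That an element is sent to a constant
    polynomial expresses that it does not involve [v]. *)
Definition transA (v : 'I_t) : A -> {poly B} :=
  mmap (polyC \o (@mpolyC r A \o @mpolyC t K))
    (fun i => (('X_i)%:MP)%:P + (if i == v then 'X else 0)).
Lemma transA_is_additive v : zmod_morphism (transA v).
Proof. exact: raddfB. Qed.
HB.instance Definition _ v := GRing.isZmodMorphism.Build A {poly B} (transA v) (transA_is_additive v).
Lemma transA_is_multiplicative v : monoid_morphism (transA v).
Proof. by split; [exact: rmorph1 | exact: rmorphM]. Qed.
HB.instance Definition _ v := GRing.isMonoidMorphism.Build A {poly B} (transA v)
  (transA_is_multiplicative v).

Definition transB (v : 'I_t) : B -> {poly B} := mmap (transA v) (fun i => ('X_i)%:P).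
Lemma transB_is_additive v : zmod_morphism (transB v).
Proof. exact: raddfB. Qed.
HB.instance Definition _ v := GRing.isZmodMorphism.Build B {poly B} (transB v) (transB_is_additive v).
Lemma transB_is_multiplicative v : monoid_morphism (transB v).
Proof. by split; [exact: rmorph1 | exact: rmorphM]. Qed.
HB.instance Definition _ v := GRing.isMonoidMorphism.Build B {poly B} (transB v)
  (transB_is_multiplicative v).

Lemma transB0 v b : (transB v b)`_0 = b.
Proof.
rewrite -horner_coef0.
apply: (@mpoly_rmorph_ext _ _ _ (horner_eval 0 \o transB v : {rmorphism _ -> _}) idfun) => [a|i] /=;
  last by rewrite /transB mmapU /horner_eval hornerC.
rewrite /transB mmapC.
apply: (@mpoly_rmorph_ext _ _ _ (horner_eval 0 \o transA v : {rmorphism _ -> _}) (@mpolyC r A)) => [c|i] /=.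
  by rewrite /transA mmapC /horner_eval /= hornerC.
by rewrite /transA mmapU /horner_eval; case: ifP => _; rewrite !hornerE.
Qed.

Definition io : {rmorphism A -> {mpoly K[N]}} := mmap (@mpolyC N K) x.

Lemma ioU i : io 'X_i = x i.
Proof. by rewrite /io /= mmapU. Qed.

Lemma transAU v i : i != v -> transA v 'X_i = (('X_i)%:MP)%:P.
Proof. by move=> iv; rewrite /transA mmapU (negbTE iv) addr0. Qed.

Lemma transAUv v : transA v 'X_v = (('X_v)%:MP)%:P + 'X.
Proof. by rewrite /transA mmapU eqxx. Qed.

Lemma alg_lift (S : {mpoly K[N]} -> Prop) (Bad : pred 'I_t) g : alg S g ->
  (forall h, S h -> exists i, ~~ Bad i /\ x i = h) ->
  exists a, io a = g /\ forall v, Bad v -> transA v a = (a%:MP)%:P.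
Proof.
move=> hg hS; elim: hg => {g} [c|h /hS [i [hi e]]|g h _ [a [ea ha]] _ [b [eb hb]]|g h _ [a [ea ha]] _ [b [eb hb]]].
- exists c%:MP; split=> [|v _]; first by rewrite /io /= mmapC.
  by rewrite /transA mmapC.
- exists 'X_i; rewrite ioU; split=> // v hv; apply: transAU.
  by apply: contra hi => /eqP ->.
- exists (a + b); rewrite rmorphD ea eb; split=> // v hv.
  by rewrite rmorphD /= ha // hb // -polyCD -mpolyCD.
exists (a * b); rewrite rmorphM ea eb; split=> // v hv.
by rewrite rmorphM /= ha // hb // -polyCM -mpolyCM.
Qed.

Variables (D : nat) (d : 'I_r -> nat) (pv : 'I_r -> 'I_t) (c : 'I_r -> 'X_{1..r < D.+1} -> A).
Hypothesis d0 : forall j, (0 < d j <= D)%N.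
Hypothesis c_avoid : forall (j : 'I_r) m (k : 'I_r), (j <= k)%N -> ~ (k = j /\ bmnm m = (U_(j) *+ d j)%MM) ->
  transA (pv k) (c j m) = ((c j m)%:MP)%:P.
Hypothesis c_pure : forall j m, bmnm m = (U_(j) *+ d j)%MM -> c j m = 'X_(pv j).

(** A restricted form with coefficients lifted to the polynomial ring [A], where the members of the
    refined system have become independent variables. *)
Definition lift_form j : B := \sum_(m : 'X_{1..r < D.+1}) (c j m)%:MP * 'X_[m].

Lemma transBX v m : transB v 'X_[m] = ('X_[m])%:P.
Proof.
rewrite mpolyXE_id !rmorph_prod; apply: eq_bigr => i _.
by rewrite !rmorphXn /= /transB mmapU.
Qed.

Lemma trans_lift (j k : 'I_r) : (j < k)%N -> transB (pv k) (lift_form j) = (lift_form j)%:P.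
Proof.
move=> jk; rewrite /lift_form !rmorph_sum; apply: eq_bigr => m _.
rewrite !rmorphM /= transBX /transB mmapC; congr (_ * _); apply: c_avoid; first exact: ltnW.
by move=> [e]; move: jk; rewrite e ltnn.
Qed.

Lemma trans_lift_self k : transB (pv k) (lift_form k) = (lift_form k)%:P + ('X_k ^+ d k)%:P * 'X.
Proof.
have hm : (mdeg (U_(k) *+ d k)%MM < D.+1)%N by rewrite mdegMn mdeg1 mul1n; case/andP: (d0 k).
rewrite /lift_form (bigD1 (BMultinom hm)) //= !rmorphD [RHS]addrAC; congr (_ + _).
  rewrite !rmorphM /= transBX /transB mmapC c_pure //= transAUv mpolyXn; ring.
rewrite !rmorph_sum; apply: eq_bigr => m ne; rewrite !rmorphM /= transBX /transB mmapC.
congr (_ * _); apply: c_avoid => // -[_ e]; case/eqP: ne; exact: val_inj.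
Qed.

(** The form with index [k] is linear in the variable [pv k], which the earlier forms avoid, with
    coefficient a power of ['X_k]. To know that ['X_k] is regular modulo the earlier forms, the
    induction carries an arbitrary list of variables of index at least [k] in front of them. *)
Lemma lift_reg k (l : seq 'I_r) : (k <= r)%N -> uniq l -> (forall i, i \in l -> (k <= i)%N) ->
  reg (@zeroid B) ([seq 'X_i | i <- l] ++ [seq lift_form j | j <- take k (enum 'I_r)]).
Proof.
elim: k l => [|k IH] l hk ul hl; first by rewrite take0 cats0; apply: vars_reg.
pose kk := Ordinal hk.
have ek : take k.+1 (enum 'I_r) = rcons (take k (enum 'I_r)) kk.
  rewrite (take_nth kk) ?size_enum_ord //; congr rcons; apply: val_inj; exact: nth_enum_ord.
rewrite ek map_rcons -cats1 catA /reg regT_cat; split.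
  by apply: IH => //; [exact: ltnW | move=> i /hl /ltnW].
have z0 := zeroid_ideal B.
split=> //.
have h1 : nzd (fun u => u = 1) (idadd (@zeroid B)
    ([seq 'X_i | i <- l] ++ [seq lift_form j | j <- take k (enum 'I_r)])) 'X_kk.
  have T1 : (fun u : B => u = 1) 1 by [].
  have TM (u v : B) : u = 1 -> v = 1 -> u * v = 1 by move=> -> ->; rewrite mulr1.
  apply: (regT_nzd_last T1 TM z0).
  apply: (IH (kk :: l)); first exact: ltnW.
    by rewrite /= ul andbT; apply/negP => /hl; rewrite ltnn.
  by move=> i; rewrite inE => /orP[/eqP -> //|/hl /ltnW].
apply: (@fresh_nzd _ (transB (pv kk)) (transB0 _) _ _ (lift_form kk) ('X_kk ^+ d kk)).
- move=> y; rewrite mem_cat => /orP[/mapP[i _ ->]|/mapP[j hj ->]]; first by rewrite /= /transB mmapU.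
  apply: trans_lift; have /(nthP kk) [i] := hj; rewrite size_take size_enum_ord hk => hi <-.
  by rewrite nth_take // nth_enum_ord // (ltn_trans hi hk).
- exact: trans_lift_self.
by apply: nzdX => //; exact/idadd_ideal.
Qed.

End Lift.

Section StrongRegular.
Variable D : nat.
Hypothesis hstar : forall d, (d <= D)%N -> star d.

(** The system of values and mixed coefficients is refined until it is algebraically independent, so
    that the restrictions can be lifted to forms over a polynomial ring and [lift_reg] applies;
    [regT_base] and [spread_reg] lead back to [E]. *)
Lemma strong_reg_sorted r : exists s, forall (K : closedFieldType) n (E : seq (nat * {mpoly K[n]})),
  size E = r -> wf D E -> sorted leq [seq e.1 | e <- E] -> strong s E ->
  reg (@zeroid _) [seq e.2 | e <- E].
Proof.
have [sigma hsig] : exists sigma, forall t (K : closedFieldType) n (E : seq (nat * {mpoly K[n]})),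
    (size E <= t)%N -> wf D E -> strong (sigma t) E -> forall F : {mpoly K[size E]},
    mmap (@mpolyC n K) (fun j => (nth (0%N, 0) E (nat_of_ord j)).2) F = 0 -> F = 0.
  have h t : exists s, forall (K : closedFieldType) n (E : seq (nat * {mpoly K[n]})),
    (size E <= t)%N -> wf D E -> strong s E -> forall F : {mpoly K[size E]},
    mmap (@mpolyC n K) (fun j => (nth (0%N, 0) E (nat_of_ord j)).2) F = 0 -> F = 0.
    have [s hs] := strong_alg_indep t hstar; exists s => K n E h1 h2 h3; exact: (hs K n E h1 h2 h3).2.
  exists (fun t => proj1_sig (constructive_indefinite_description _ (h t))) => t.
  by case: constructive_indefinite_description.
have [s [Nb hsoft]] := soft_refine D sigma (r * r) #|{: 'I_r * 'X_{1..r < D.+1}}| 0.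
exists s => K n E hE wE sE stE.
pose d (j : 'I_r) := (nth (0%N, 0) E j).1; pose f (j : 'I_r) : {mpoly K[n]} := (nth (0%N, 0) E j).2.
have jE (j : 'I_r) : nth (0%N, 0) E j \in E by rewrite mem_nth // hE.
have fh j : f j \is (d j).-homog by case: (wE _ (jE j)).
have d0 j : (0 < d j)%N by case: (wE _ (jE j)).
have dD j : (d j <= D)%N by case: (wE _ (jE j)).
have eE : E = [seq (d j, f j) | j <- enum 'I_r].
  apply: (@eq_from_nth _ (0%N, 0)); first by rewrite size_map size_enum_ord.
  move=> i; rewrite hE => hi.
  rewrite (nth_map (Ordinal hi)) ?size_enum_ord // /d /f nth_enum_ord //.
  by case: (nth _ _ _).
have dmono (j k : 'I_r) : (j <= k)%N -> (d j <= d k)%N.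
  move=> jk; have := sorted_leq_nth leq_trans leqnn 0%N sE.
  move=> /(_ j k); rewrite !inE size_map hE !ltn_ord => /(_ isT isT jk).
  by rewrite !(nth_map (0%N, 0)) ?hE.
set EE := map (pure d f) (enum {: 'I_r * 'I_r}).
set sp := spread (@gv K n r).
pose M := [seq (d p.1, (sp (f p.1))@_(bmnm p.2)) | p : 'I_r * 'X_{1..r < D.+1} <- enum {: 'I_r * 'X_{1..r < D.+1}} & mixed d p.1 (bmnm p.2)].
have hbase := @pure_base K n r d f fh d0 s M.
rewrite -eE in hbase.
have {}hbase := hbase stE.
have hMm m : m \in M -> exists j k, mixed d j k /\ m.2 = (sp (f j))@_k.
  move=> /mapP[[j k]]; rewrite mem_filter /= => /andP[h1 _] ->.
  by exists j, (bmnm k).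
have {}hbase := hbase hMm.
have sEE : size EE = (r * r)%N by rewrite size_map -cardE card_prod card_ord.
have wEE : wf D EE.
  move=> _ /mapP[[j a] _ ->] /=; split=> //.
  by have := spread_coef_homog fh j (U_(a) *+ d j); rewrite (spread_pure fh).
have wM : wf D M.
  move=> _ /mapP[[j k] _ ->] /=; split=> //; exact: spread_coef_homog.
have stEE : strong s EE.
  move=> c e h1 h2 h3; apply: (hbase c (nseq (size M) 0) e) => //; rewrite ?size_nseq //.
    by apply: degs_in0 => x; rewrite mem_nseq => /andP[_ /eqP].
  by rewrite (lc0 (c := nseq _ _)) ?addr0 // => x; rewrite mem_nseq => /andP[_ /eqP].
have sM : (size M <= #|{: 'I_r * 'X_{1..r < D.+1}}|)%N.
  by rewrite size_map size_filter (leq_trans (count_size _ _)) // -cardE.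
have sEE' : (size EE <= r * r)%N by rewrite sEE.
have w0 : wf D ([::] : seq (nat * {mpoly K[#|{: 'I_r * 'I_n}|]})) by [].
have [M' [F' [w1 w2 st' hM' _]]] := hsoft K _ EE M [::] sEE' sM (leqnn _) wEE wM w0 stEE hbase.
set Sys := EE ++ M' ++ F' in st' hM' *.
have wSys : wf D Sys by move=> e; rewrite mem_cat => /orP[/wEE|/w1].
have szS : size Sys = (size EE + size (M' ++ F'))%N by exact: size_cat.
rewrite -szS in st'.
have ind := hsig _ K _ Sys (leqnn _) wSys st'.
pose x (j : 'I_(size Sys)) : {mpoly K[#|{: 'I_r * 'I_n}|]} := (nth (0%N, 0) Sys j).2.
have posP (p : 'I_r * 'I_r) : (enum_rank p < size Sys)%N.
  by rewrite size_cat size_map -cardE; apply: ltn_addr.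
pose pos p := Ordinal (posP p).
have posE p : nth (0%N, 0) Sys (pos p) = pure d f p.
  rewrite nth_cat size_map -cardE /= ltn_ord (nth_map p) -?cardE //.
  by rewrite nth_enum_rank.
have posI p q : pos p = pos q -> p = q.
  by move=> e; apply: enum_rank_inj; apply: val_inj; move: (congr1 val e).
pose pv k := pos (k, k).
have hc (p : 'I_r * 'X_{1..r < D.+1}) : exists a, [/\ io x a = (sp (f p.1))@_(p.2),
    forall k : 'I_r, (p.1 <= k)%N -> ~ (k = p.1 /\ bmnm p.2 = (U_(p.1) *+ d p.1)%MM) ->
      transA r (pv k) a = (a%:MP)%:P &
    bmnm p.2 = (U_(p.1) *+ d p.1)%MM -> a = 'X_(pv p.1)].
  case: p => j [m hm] /=.
  have [dm|dm] := eqVneq (mdeg m) (d j); last first.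
    exists 0; split=> [|k _ _|e].
    - rewrite rmorph0; symmetry; apply: memN_msupp_eq0; apply: contra dm => hm'.
      apply/eqP; exact: (dhomog_mf (spread_homog _ (fh j)) hm').
    - by rewrite rmorph0 mpolyC0 polyC0.
    by move: dm; rewrite e mdegMn mdeg1 mul1n eqxx.
  have [/existsP[a /eqP ea]|] := boolP [exists a, m == (U_(a) *+ d j)%MM].
    have aj : m = (U_(j) *+ d j)%MM -> a = j.
      rewrite ea => /mnmP /(_ a); rewrite !mulmnE !mnm1E eqxx mul1n.
      case: (eqVneq j a) => [-> //|_]; rewrite mul0n => e.
      by move: (d0 j); rewrite e.
    exists 'X_(pos (j, a)); split=> [|k jk hk|/aj -> //].
      by rewrite ioU /x posE ea spread_pure.
    apply: transAU; apply/eqP => /posI [jk' ak]; apply: hk; split=> //.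
    by rewrite ea ak jk'.
  rewrite negb_exists => hmix.
  have hmix' : mixed d j m by rewrite /mixed dm eqxx.
  have mM : (d j, (sp (f j))@_m) \in M.
    apply/mapP; exists (j, BMultinom hm) => //; by rewrite mem_filter /= hmix' mem_enum.
  (* A mixed coefficient of the form [j] is a polynomial in [M'] and in members of degree below
     [d j]. For [k >= j] the value at position [pv k] has degree [d k >= d j] because [E] is sorted,
     so it does not occur. *)
  have [a [ea ha]] : exists a, io x a = (sp (f j))@_m /\
      forall v, [exists k : 'I_r, (j <= k)%N && (v == pv k)] -> transA r v a = (a%:MP)%:P.
    apply: (@alg_lift K _ r _ x _ (fun v => [exists k : 'I_r, (j <= k)%N && (v == pv k)]) _
      (hM' _ mM)) => h /= [[e [he dh]]|[e [he dh]]].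
      have li : (size EE + index (e, h) M' < size Sys)%N.
        by rewrite szS ltn_add2l size_cat (leq_trans _ (leq_addr _ _)) // index_mem.
      exists (Ordinal li); split.
        apply/negP => /existsP[k /andP[_ /eqP /(congr1 val) /= ek]].
        have : (enum_rank (k, k) < size EE)%N by rewrite size_map -cardE.
        by rewrite -ek ltnNge leq_addr.
      by rewrite /x /= !nth_cat ltnNge leq_addr /= addKn index_mem he nth_index.
    have li : (index (e, h) Sys < size Sys)%N by rewrite index_mem.
    exists (Ordinal li); split; last by rewrite /x /= nth_index.
    apply/negP => /existsP[k /andP[jk /eqP ek]].
    have := posE (k, k); rewrite -/(pv k) -ek /= nth_index // => -[e1 _].
    have := dmono _ _ jk; have := d0 j; move: dh; rewrite e1; clear; lia.
  exists a; split=> [//|k jk _|e]; first by apply: ha; apply/existsP; exists k; rewrite jk eqxx.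
  by move/forallP: hmix => /(_ j); rewrite e eqxx.
pose c j m := proj1_sig (constructive_indefinite_description _ (hc (j, m))).
have cP j m := proj2_sig (constructive_indefinite_description _ (hc (j, m))).
have hreg := @lift_reg K r (size Sys) D d pv c _ _ _ r [::] (leqnn r) isT.
have {}hreg : reg (@zeroid _) [seq lift_form c j | j <- enum 'I_r].
  rewrite -[enum _](@take_oversize _ r) ?size_enum_ord //; apply: hreg => //.
  - by move=> j; rewrite d0 dD.
  - by move=> j m k h1 h2; case: (cP j m) => _ + _; apply.
  by move=> j m h; case: (cP j m) => _ _; apply.
rewrite [in E in reg _ E]eE -map_comp; apply: (@spread_reg _ _ _ _ (@gv K n r)).
  by move=> _ /mapP[j _ ->] /=; exists (d j).
have hio a : io x a = 0 -> a = 0 by apply: ind.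
have := regT_base hio hreg; congr regT; rewrite -!map_comp; apply: eq_map => j /=.
rewrite /lift_form rmorph_sum /= [RHS](mpolywE (k := D.+1)); last first.
  rewrite msizeE; apply/bigmax_leqP_seq => m hm _; rewrite ltnS.
  by rewrite (dhomog_mf (spread_homog _ (fh j)) hm : mdeg m = d j).
apply: eq_bigr => m _; rewrite rmorphM /= map_mpolyC map_mpolyX mul_mpolyC.
by have [e _ _] := cP j m; congr (_ *: _); exact: e.
Qed.

End StrongRegular.

Lemma regT_one_perm (K : fieldType) n (s t : seq {mpoly K[n]}) : (forall z, z \in s -> posform z) ->
  perm_eq s t -> reg (@zeroid _) s -> reg (@zeroid _) t.
Proof.
have e : (fun u : {mpoly K[n]} => u = 1) = cstT (fun a : K => a = 1).
  apply: predext => u; split=> [->|[a [-> ->]]]; last by rewrite mpolyC1.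
  by exists 1; rewrite mpolyC1.
rewrite /reg e; apply: regT_graded_perm => // u v -> ->; exact: mulr1.
Qed.

Lemma regT_one_dropl (K : fieldType) n (s t : seq {mpoly K[n]}) :
  (forall z, z \in t ++ s -> posform z) -> reg (@zeroid _) (t ++ s) -> reg (@zeroid _) s.
Proof.
have e : (fun u : {mpoly K[n]} => u = 1) = cstT (fun a : K => a = 1).
  apply: predext => u; split=> [->|[a [-> ->]]]; last by rewrite mpolyC1.
  by exists 1; rewrite mpolyC1.
rewrite /reg e; apply: regT_graded_dropl => // u v -> ->; exact: mulr1.
Qed.

Lemma strong_reg D r : (forall d, (d <= D)%N -> star d) -> exists s,
  forall (K : closedFieldType) n (E : seq (nat * {mpoly K[n]})),
  (size E <= r)%N -> wf D E -> strong s E -> reg (@zeroid _) [seq e.2 | e <- E].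
Proof.
move=> hstar.
have [||s [_ h]] := @fin_uniform _ (fun (k : 'I_r.+1) s _ =>
  forall (K : closedFieldType) n (E : seq (nat * {mpoly K[n]})),
  size E = k -> wf D E -> sorted leq [seq e.1 | e <- E] -> strong s E ->
  reg (@zeroid _) [seq e.2 | e <- E]).
- by move=> k s s' _ _ hs _ h K n E h1 h2 h3 h4; apply: (h K n E) => //; apply: strong_le h4.
- by move=> k; have [s h] := strong_reg_sorted hstar k; exists s, 0%N.
exists s => K n E hE wE sE.
pose E' := sort (fun x y : nat * {mpoly K[n]} => (x.1 <= y.1)%N) E.
have pE : perm_eq E E' by rewrite perm_sym perm_sort.
have hE' : (size E' < r.+1)%N by rewrite size_sort.
have wE' : wf D E' by move=> e; rewrite mem_sort; apply: wE.
apply: (@regT_one_perm _ _ [seq e.2 | e <- E']).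
- by move=> _ /mapP[e /wE' [h1 h2 h3] ->]; exists e.1.
- by apply: perm_map; rewrite perm_sym.
apply: (h (Ordinal hE')) => //; last exact: strong_perm sE.
rewrite sorted_map; apply: sort_sorted => x y; exact: leq_total.
Qed.

(** * Specialization of variables preserving regularity *)

Section Avoid.
Variables (K : closedFieldType) (R : comNzRingType) (g : {rmorphism K -> R}).
Hypothesis nR : noeth R.

(** Says that [P] fails only finitely often, in the form in which [generic_value_nzd] delivers
    it. *)
Definition cofinal (P : K -> Prop) := forall t : nat -> K, injective t -> exists i, P (t i).

Lemma cofinalI P Q : cofinal P -> cofinal Q -> cofinal (fun x => P x /\ Q x).
Proof.
move=> hP hQ t ti.
have h m : exists i, (m <= i)%N /\ P (t i).
  have [|i hi] := hP (fun i => t (m + i)%N); first by move=> i j /ti /addnI.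
  by exists (m + i)%N; rewrite leq_addr.
pose u m := proj1_sig (constructive_indefinite_description _ (h m)).
have uP m : (m <= u m)%N /\ P (t (u m)).
  by rewrite /u; case: constructive_indefinite_description.
pose w := fix w k := if k is k'.+1 then u (w k').+1 else u 0%N.
have wS k : (w k < w k.+1)%N by case: (uP (w k).+1).
have wP k : P (t (w k)) by case: k => [|k]; [case: (uP 0%N) | case: (uP (w k).+1)].
have wlt i j : (i < j)%N -> (w i < w j)%N.
  by elim: j => // j IH; rewrite ltnS leq_eqVlt => /orP[/eqP -> //|/IH /ltn_trans]; apply.
have [|i hi] := hQ (fun i => t (w i)); last by exists (w i).
move=> i j /ti e; case: (ltngtP i j) => // /wlt; by rewrite e ltnn.
Qed.

Lemma cofinal_nzd (J : R -> Prop) (z : R) : is_ideal J ->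
  cofinal (fun t => nzd (fun u => u = 1) J (z - g t)).
Proof.
move=> idJ t ti.
have [||i hi] := @generic_value_nzd R nR J (z%:P - 'X) (fun i => g (t i)) idJ.
- move=> i j ne; exists (g (t i - t j)^-1); rewrite -rmorphB -rmorphM mulVf ?rmorph1 //.
  by rewrite subr_eq0; apply: contra ne => /eqP /ti ->.
- move=> c /(_ 1%N); rewrite coefB coefC coefX /= sub0r mulrN1 => h.
  by have := idealN idJ h; rewrite opprK.
by exists i => x; rewrite !sat1; have := hi x; rewrite !hornerE.
Qed.

Lemma nzd_insert (J : R -> Prop) f s : is_ideal J -> reg J s ->
  (forall i, (i <= size s)%N -> nzd (fun u => u = 1) (idadd J (take i s)) f) -> reg (isum J f) s.
Proof.
elim: s J => [//|a s IH] J idJ [ha hs] hf; split.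
  apply: nzd_swap => // [u v -> ->|]; first exact: mulr1.
  by have := hf 1%N isT; rewrite /= take0.
rewrite isumC; apply: IH => //; first exact: isum_ideal.
by move=> i hi; apply: (hf i.+1).
Qed.

Lemma avoid_reg (J : R -> Prop) z s : is_ideal J -> reg J s -> exists t, reg (isum J (z - g t)) s.
Proof.
move=> idJ hs.
have h : cofinal (fun t => forall i, (i <= size s)%N ->
    nzd (fun u => u = 1) (idadd J (take i s)) (z - g t)).
  elim: (size s) => [|k IH].
    move=> t ti; have [i hi] := cofinal_nzd z (idadd_ideal (take 0 s) idJ) ti.
    by exists i => j; rewrite leqn0 => /eqP ->.
  move=> t ti; have [i [h1 h2]] := cofinalI IH (cofinal_nzd z (idadd_ideal (take k.+1 s) idJ)) ti.
  by exists i => j; rewrite leq_eqVlt => /orP[/eqP -> //|]; rewrite ltnS; apply: h1.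
have [t ti] := infinite_closed K; have [i hi] := h t ti.
by exists (t i); apply: nzd_insert.
Qed.

End Avoid.

(** The variables receive their values one at a time. For all but finitely many [t], the element
    ['X_(rshift n a) - t] is regular modulo each initial segment of the sequence, and adding it to
    the ideal then preserves regularity of the sequence. *)
Lemma specialize_reg (K : closedFieldType) n m (s : seq {mpoly K[n + m]}) : reg (@zeroid _) s ->
  exists v : 'I_m -> K, reg (@zeroid {mpoly K[n]}) [seq mmap (@mpolyC n K)
    (fun k => match fintype.split k with inl i => 'X_i | inr a => (v a)%:MP end) f | f <- s].
Proof.
move=> hs; have z0 := zeroid_ideal {mpoly K[n + m]}.
have h (l : seq 'I_m) : exists v : 'I_m -> K,
    reg (idadd (@zeroid _) [seq 'X_(rshift n a) - (v a)%:MP | a <- l]) s.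
  elim/last_ind: l => [|l a [v hv]]; first by exists (fun=> 0).
  have [al|al] := boolP (a \in l).
    exists v; rewrite map_rcons idadd_rcons isum_in //; first exact: idadd_ideal.
    by apply: idadd_gen => //; apply: (map_f (fun a => 'X_(rshift n a) - (v a)%:MP)).
  have [|t ht] := @avoid_reg K _ (@mpolyC (n + m) K) (@noeth_mpolyK K (n + m)) _ 'X_(rshift n a) s _ hv.
    exact: idadd_ideal.
  exists (fun b => if b == a then t else v b); rewrite map_rcons idadd_rcons eqxx.
  move: ht; congr (reg (isum (idadd _ _) _) _); apply/eq_in_map => b bl.
  by case: eqP => // e; rewrite -e bl in al.
have [v hv] := h (enum 'I_m); exists v.
set ev := mmap _ _.
pose io : {mpoly K[n]} -> {mpoly K[n + m]} := mmap (@mpolyC (n + m) K) (fun i => 'X_(lshift m i)).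
have evio f : ev (io f) = f.
  apply: (@mpoly_rmorph_ext _ _ _ (mmap (@mpolyC n K) (fun k => match fintype.split k with
     inl i => 'X_i | inr a => (v a)%:MP end) \o io : {rmorphism _ -> _}) idfun) => [a|i] /=.
    by rewrite /io !mmapC.
  by rewrite /io !mmapU (unsplitK (inl i : 'I_n + 'I_m)%type).
have ker : (fun x => zeroid (ev x)) =
    idadd (@zeroid _) [seq 'X_(rshift n a) - (v a)%:MP | a <- enum 'I_m].
  set I := idadd _ _.
  have idI : is_ideal I by apply: idadd_ideal.
  apply: predext => x; split=> [e|/(idadd_morph (mmap (@mpolyC n K) (fun k => match fintype.split k with
     inl i => 'X_i | inr a => (v a)%:MP end)))].
    rewrite -[x]subr0 -[0](rmorph0 (mmap (@mpolyC (n + m) K) (fun i => 'X_(lshift m i)))) -/io.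
    rewrite -e -/io {e}.
    apply: (@mpoly_ring_ind _ _ (fun x => I (x - io (ev x)))) => [f f' hf hf'|f f' hf hf'|a|k].
    - rewrite /ev /io !rmorphD -/io -/ev; have -> a b c d : a + b - (c + d) = (a - c) + (b - d) :> {mpoly K[n + m]} by ring.
      exact: idealD.
    - rewrite /ev /io !rmorphM -/io -/ev; have -> a b c d : a * b - (c * d) = a * (b - d) + (a - c) * d :> {mpoly K[n + m]} by ring.
      by apply: idealD => //; [apply: idealM|apply: idealMr].
    - by rewrite /ev /io !mmapC subrr; apply: ideal0.
    rewrite /ev mmapU; case: fintype.splitP => a ea; rewrite /io ?mmapU ?mmapC.
      rewrite (_ : k = lshift m a) ?subrr; [exact: ideal0 | exact: val_inj].
    rewrite (_ : k = rshift n a); last exact: val_inj.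
    by apply: idadd_gen => //; apply: (map_f (fun a => 'X_(rshift n a) - (v a)%:MP)); rewrite mem_enum.
  apply: (idadd_min (zeroid_ideal _)) => // y /mapP[_ /mapP[a _ ->] ->].
  by rewrite /zeroid rmorphB /= mmapU mmapC (unsplitK (inr a : 'I_n + 'I_m)%type) subrr.
rewrite -ker in hv.
apply/(@regT_preim _ _ (mmap (@mpolyC n K) (fun k => match fintype.split k with
     inl i => 'X_i | inr a => (v a)%:MP end)) (fun u => u = 1)); last exact: hv.
- exact: zeroid_ideal.
- by move=> y; exists (io y); apply: evio.
- by move=> u ->; apply: rmorph1.
by move=> u ->; exists 1; rewrite rmorph1.
Qed.

(** * Jacobian minors of strong systems *)

Definition dirder (K : fieldType) n (w : 'I_n -> K) (f : {mpoly K[n]}) : {mpoly K[n]} :=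
  \sum_i (w i)%:MP * f^`M(i).

Definition jacdet (K : fieldType) n r (fs : seq {mpoly K[n]}) (w : nat -> 'I_n -> K) : {mpoly K[n]} :=
  \det (\matrix_(j < r, j' < r) dirder (w j') (nth 0 fs j)).

(** Regularity with a product in one place follows from regularity with each factor there. It is
    thus enough to choose a single factor from each block. *)
Lemma regT_blocks (R : comNzRingType) (q r : nat) (del : 'I_q -> 'I_r -> R) (I : R -> Prop) l :
  is_ideal I -> uniq l ->
  (forall ps : seq ('I_q * 'I_r), uniq [seq p.1 | p <- ps] -> {subset [seq p.1 | p <- ps] <= l} ->
     reg I [seq del p.1 p.2 | p <- ps]) ->
  reg I [seq \prod_j del b j | b <- l].
Proof.
elim: l I => [//|b l IH] I idI /= /andP[bl ul] h.
have key ps : uniq [seq p.1 | p <- ps] -> {subset [seq p.1 | p <- ps] <= l} ->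
    reg I (\prod_j del b j :: [seq del p.1 p.2 | p <- ps]).
  move=> u1 u2; rewrite -big_enum; apply: regT_prod => // [u v -> ->||j]; first exact: mulr1.
    by apply: h => // x /u2 hx; rewrite inE hx orbT.
  apply: (h ((b, j) :: ps)) => /=.
    by rewrite u1 andbT; apply: contra bl => /u2.
  by move=> x; rewrite !inE => /orP[->//|/u2 ->]; rewrite orbT.
split; first by case: (key [::]).
apply: IH => //; first exact: isum_ideal.
by move=> ps u1 u2; case: (key ps u1 u2).
Qed.

Lemma det_offdiag (R : comNzRingType) r (I : R -> Prop) (A : 'M[R]_r) : is_ideal I ->
  (forall i j, i != j -> I (A i j)) -> I (\prod_j A j j - \det A).
Proof.
move=> idI hA; rewrite /determinant (bigD1 (1%g : 'S_r)) //= odd_perm1 expr0 mul1r.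
rewrite [X in _ - (X + _)](eq_bigr (fun i => A i i)) => [|i _]; last by rewrite perm1.
rewrite opprD addNKr; apply: idealN => //; apply: ideal_sum => // s s1.
have [i hi] : exists i, s i != i.
  apply: NNPP => hno; case/eqP: s1; apply/permP => i; rewrite perm1.
  by apply/eqP/negPn/negP => hi; apply: hno; exists i.
rewrite (bigD1 i) //=; apply: idealM => //; apply: idealMr => //; apply: hA.
by rewrite eq_sym.
Qed.

Lemma homog_prod (A : comNzRingType) n (I : Type) (l : seq I) (d : I -> nat) (F : I -> {mpoly A[n]}) :
  (forall i, F i \is (d i).-homog) -> \prod_(i <- l) F i \is (\sum_(i <- l) d i)%N.-homog.
Proof.
move=> h; elim: l => [|i l IH]; rewrite ?big_nil ?big_cons; first exact: dhomog1.
exact: dhomogM.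
Qed.

Section Jacobian.
Variables (D : nat) (hstar : forall d, (d <= D)%N -> star d).

Section Sys.
Variables (K : closedFieldType) (n r q : nat) (d : 'I_r -> nat) (f : 'I_r -> {mpoly K[n]}).
Hypothesis fh : forall j, f j \is (d j).-homog.
Hypothesis d0 : forall j, (0 < d j <= D)%N.
Local Notation T := ('I_q * 'I_r * 'I_n)%type.
Local Notation m := #|{: T}|.
Local Notation R := {mpoly K[n + m]}.

Definition xin (g : {mpoly K[n]}) : R := mmap (@mpolyC (n + m) K) (fun i => 'X_(lshift m i)) g.
Definition wv b (j : 'I_r) i : R := 'X_(rshift n (enum_rank ((b, j, i) : T))).
Definition gdir b j' j : R := \sum_i wv b j' i * xin (f j)^`M(i).
Local Notation Idx := ('I_r + ('I_q * 'I_r * 'I_r))%type.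
Definition selt (x : Idx) : nat * R :=
  match x with inl j => (d j, xin (f j)) | inr (b, j', j) => (d j, gdir b j' j) end.

Lemma xin_homog e g : g \is e.-homog -> xin g \is e.-homog.
Proof. by apply: homog_mmap => i; rewrite dhomogX /= mdeg1. Qed.

Lemma selt_homog x : (selt x).2 \is (selt x).1.-homog.
Proof.
case: x => [j|[[b j'] j]] /=; first exact: xin_homog.
apply: rpred_sum => i _.
have -> : d j = (1 + (d j).-1)%N by case/andP: (d0 j); case: (d j).
by apply: dhomogM; [rewrite dhomogX /= mdeg1 | exact/xin_homog/homog_mderiv].
Qed.

Definition evx : R -> {mpoly K[n]} := mmap (@mpolyC n K)
  (fun k => match fintype.split k with inl i => 'X_i | inr a => 0 end).

Lemma evx_xin g : evx (xin g) = g.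
Proof.
apply: (@mpoly_rmorph_ext _ _ _ (mmap (@mpolyC n K) (fun k => match fintype.split k with
  inl i => 'X_i | inr a => 0 end) \o mmap (@mpolyC (n + m) K) (fun i => 'X_(lshift m i)) :
  {rmorphism _ -> _}) idfun) => [a|i] /=; first by rewrite !mmapC.
by rewrite !mmapU (unsplitK (inl i : 'I_n + 'I_m)%type).
Qed.

Lemma evw_xin (v : 'I_m -> K) g : mmap (@mpolyC n K) (fun k => match fintype.split k with
  inl i => 'X_i | inr a => (v a)%:MP end) (xin g) = g.
Proof.
apply: (@mpoly_rmorph_ext _ _ _ (mmap (@mpolyC n K) (fun k => match fintype.split k with
  inl i => 'X_i | inr a => (v a)%:MP end) \o mmap (@mpolyC (n + m) K) (fun i => 'X_(lshift m i)) :
  {rmorphism _ -> _}) idfun) => [a|i] /=; first by rewrite !mmapC.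
by rewrite !mmapU (unsplitK (inl i : 'I_n + 'I_m)%type).
Qed.

Lemma evx_wv b j i : evx (wv b j i) = 0.
Proof. by rewrite /evx /wv mmapU (unsplitK (inr _ : 'I_n + 'I_m)%type). Qed.

Lemma evx_gdir b j' j : evx (gdir b j' j) = 0.
Proof.
by rewrite /evx /gdir rmorph_sum big1 // => i _; rewrite rmorphM /= -!/(evx _) evx_wv mul0r.
Qed.

Lemma deriv_xin a g : (xin g)^`M(rshift n a) = 0.
Proof.
apply: (@mpoly_ring_ind _ _ (fun g => (xin g)^`M(rshift n a) = 0)) => [g1 g2 h1 h2|g1 g2 h1 h2|c|i].
- by rewrite /xin rmorphD mderivD -!/(xin _) h1 h2 addr0.
- by rewrite /xin rmorphM mderivM -!/(xin _) h1 h2 mul0r mulr0 addr0.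
- by rewrite /xin mmapC mderivC.
by rewrite /xin mmapU mderivX mnm1E eq_lrshift scale0r.
Qed.

Lemma deriv_gdir b j' i b1 j1 j :
  evx (gdir b1 j1 j)^`M(rshift n (enum_rank ((b, j', i) : T))) =
  if (b1, j1) == (b, j') then (f j)^`M(i) else 0.
Proof.
rewrite /gdir raddf_sum /evx rmorph_sum /= (bigD1 i) //= big1 ?addr0 => [|i' ne].
  rewrite mderivM deriv_xin mulr0 addr0 rmorphM /= -!/(evx _) evx_xin /wv mderivX mnm1E.
  rewrite eq_rshift (inj_eq enum_rank_inj) xpair_eqE eqxx andbT; case: eqP => [[-> ->]|_]; last first.
    by rewrite scale0r /evx rmorph0 mul0r.
  set u := U_(_)%MM; have -> : (u - u)%MM = 0%MM by apply/mnmP => k; rewrite mnmBE subnn mnm0E.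
  by rewrite scale1r mpolyX0 /evx rmorph1 mul1r.
rewrite mderivM deriv_xin mulr0 addr0 /wv mderivX mnm1E.
rewrite eq_rshift (inj_eq enum_rank_inj) xpair_eqE (negbTE ne) andbF.
by rewrite scale0r mul0r rmorph0.
Qed.

(** Setting the directions to zero in a weak combination leaves a weak combination of the [f j], so
    the coefficients of the forms themselves vanish. For the derivatives in a direction [(b, j')],
    differentiate along the coordinates of that direction and then set the directions to zero. By
    the Leibniz rule all partial derivatives of the corresponding combination of the [f j] lie in
    the ideal of at most [2 * s'] factors, and [hst] makes it weak. *)
Lemma selt_strong s s' : (s' <= s)%N -> strong s [seq (d j, f j) | j <- enum 'I_r] ->
  (forall e (g : {mpoly K[n]}), (e <= D)%N -> (0 < e)%N -> g \is e.-homog -> gradweak (2 * s') e g -> weak s e g) ->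
  strong s' (map selt (enum {: Idx})).
Proof.
move=> ss st hst c e; rewrite size_map -cardE => /(seq_enum 0) [C ->] /degs_enum hd.
rewrite lc_enum big_sumType /= => hw.
have key (C' : 'I_r -> K) : (forall j, C' j != 0 -> d j = e) ->
    weak s e (\sum_j C' j *: f j) -> forall j, C' j = 0.
  move=> h1 h2 j; apply: (st [seq C' j | j <- enum 'I_r] e); rewrite ?size_map //.
  - rewrite /degs_in; have -> : zip [seq C' i | i <- enum 'I_r] [seq (d j, f j) | j <- enum 'I_r] =
      [seq (C' i, (d i, f i)) | i <- enum 'I_r] by elim: (enum 'I_r) => //= i l ->.
    by move=> _ /mapP[i _ ->] /= /h1.
  - by rewrite lc_enum.
  by apply: map_f; rewrite mem_enum.
have hx (k : 'I_(n + m)) :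
    (match fintype.split k with inl i => 'X_i | inr a => 0 end : {mpoly K[n]}) \is 1.-homog.
  by case: fintype.split => i; rewrite ?rpred0 // dhomogX /= mdeg1.
have C1 j : C (inl j) = 0.
  apply: (key (fun j => C (inl j))) => [i hi|]; first exact: (hd (inl i)).
  apply: weak_le ss _; move: (weak_mmap hx hw); congr weak; rewrite rmorphD !rmorph_sum /=.
  rewrite [X in _ + X]big1 ?addr0 => [|[[b j'] i] _]; last by rewrite mmapZ -/(evx _) evx_gdir mulr0.
  by apply: eq_bigr => i _; rewrite mmapZ -/(evx _) evx_xin mul_mpolyC.
move=> _ /mapP[[j|[[b j'] j]] _ ->]; first exact: C1.
apply: NNPP => /eqP hne.
have [e0 eD] : (0 < e)%N /\ (e <= D)%N by rewrite -(hd (inr (b, j', j)) hne) /=; apply/andP/d0.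
case/eqP: hne; apply: (key (fun j => C (inr (b, j', j)))) => [i hi|]; first exact: (hd (inr (b, j', i))).
apply: hst => //.
  apply: rpred_sum => i _; have [->|hi] := eqVneq (C (inr (b, j', i))) 0; first by rewrite scale0r rpred0.
  by apply: rpredZ; rewrite -(hd (inr (b, j', i)) hi); apply: fh.
case: hw => ps [h1 h2 eL].
exists (flatten [seq [:: (p.1, evx p.2.1); ((e - p.1)%N, evx p.2.2)] | p <- ps]); split.
- apply: (@leq_trans (2 * size ps)); last by rewrite leq_mul2l.
  by clear; elim: ps => //= p ps IH; rewrite mulnS.
- move=> h /flatten_mapP [p /h2 [p1 p2 p3 p4]]; rewrite !inE => /orP[/eqP ->|/eqP ->] /=.
    by split=> //; apply: homog_mmap.
  by split; [rewrite subn_gt0 | rewrite ltn_subrL p1 (leq_trans _ p2) | apply: homog_mmap].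
move=> i; set I := idadd _ _.
have idI : is_ideal I by apply/idadd_ideal/zeroid_ideal.
have -> : (\sum_j C (inr (b, j', j)) *: f j)^`M(i) =
    evx (\sum_(p <- ps) p.2.1 * p.2.2)^`M(rshift n (enum_rank ((b, j', i) : T))).
  rewrite -eL mderivD !(raddf_sum (mderiv _)) /evx rmorphD !rmorph_sum /= [X in X + _]big1 ?add0r => [|k _]; last first.
    by rewrite mderivZ deriv_xin scaler0 rmorph0.
  transitivity (\sum_(k : 'I_q * 'I_r) \sum_l if k == (b, j') then C (inr (k, l)) *: (f l)^`M(i) else 0).
    rewrite (bigD1 (b, j')) //= [X in _ + X]big1 ?addr0 => [|k hk]; last first.
      by rewrite big1 // => l _; rewrite (negbTE hk).
    by apply: eq_bigr => l _; rewrite eqxx mderivZ.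
  rewrite pair_bigA /=; apply: eq_bigr => -[[b1 j1] l] _ /=.
  rewrite mderivZ mmapZ -/(evx _) deriv_gdir mul_mpolyC.
  by case: eqP => // _; rewrite scaler0.
rewrite raddf_sum /evx rmorph_sum /= big_seq; apply: ideal_sum => // p hp.
rewrite mderivM rmorphD !rmorphM /= -!/(evx _); apply: idealD => //.
  apply: idealM => //; apply: idadd_gen; first exact: zeroid_ideal.
  apply/mapP; exists ((e - p.1)%N, evx p.2.2) => //; apply/flatten_mapP; exists p => //.
  by rewrite !inE eqxx orbT.
apply: idealMr => //; apply: idadd_gen; first exact: zeroid_ideal.
apply/mapP; exists (p.1, evx p.2.1) => //; apply/flatten_mapP; exists p => //.
by rewrite !inE eqxx.
Qed.

End Sys.

(** Each of the [q] minors uses its own [r] generic directions. Modulo the off-diagonal directional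
    derivatives a minor is a product of diagonal ones, which are members of one strong, hence
    regular, system. The off-diagonal entries are then dropped by the grading and the directions
    specialized. *)
Lemma jacobian_exact r q : exists s, forall (K : closedFieldType) n (E : seq (nat * {mpoly K[n]})),
  size E = r -> wf D E -> strong s E -> exists W : 'I_q -> nat -> 'I_n -> K,
  reg (@zeroid _) ([seq e.2 | e <- E] ++ [seq jacdet r [seq e.2 | e <- E] (W b) | b <- enum 'I_q]).
Proof.
have [s' hs'] := strong_reg #|{: 'I_r + ('I_q * 'I_r * 'I_r)}| hstar.
have [||s2 [_ h2]] := @fin_uniform _ (fun (e : 'I_D.+1) s _ =>
  forall (K : closedFieldType) n (g : {mpoly K[n]}),
  (0 < e)%N -> g \is e.-homog -> gradweak (2 * s') e g -> weak s e g).
- by move=> e s t _ _ hs _ h K n g h0 h1 h2; apply: weak_le (h K n g h0 h1 h2).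
- by move=> e; have [|s h] := hstar (d := e) _ (2 * s'); [rewrite -ltnS | exists s, 0%N].
exists (s' + s2)%N => K n E hE wE sE.
(* Without forms the minors are 1, which is no form of positive degree, and the graded argument
   below would not cover them. *)
have [r0|r0] := posnP r.
  exists (fun _ _ _ => 0); move: hE; rewrite r0 => /size0nil -> /=.
  rewrite (eq_map (g := fun=> 1)) => [|b]; last by rewrite /jacdet det_mx00.
  elim: (enum 'I_q) (@zeroid {mpoly K[n]}) => //= b l IH I.
  by split=> [x|]; [rewrite mul1r | exact: IH].
pose d (j : 'I_r) := (nth (0%N, 0) E j).1; pose f (j : 'I_r) : {mpoly K[n]} := (nth (0%N, 0) E j).2.
have jE (j : 'I_r) : nth (0%N, 0) E j \in E by rewrite mem_nth // hE.
have fh j : f j \is (d j).-homog by case: (wE _ (jE j)).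
have d0 j : (0 < d j <= D)%N by case: (wE _ (jE j)) => -> ->.
have eE : E = [seq (d j, f j) | j <- enum 'I_r].
  apply: (@eq_from_nth _ (0%N, 0)); first by rewrite size_map size_enum_ord.
  move=> i; rewrite hE => hi.
  rewrite (nth_map (Ordinal hi)) ?size_enum_ord // /d /f nth_enum_ord //.
  by case: (nth _ _ _).
have st : strong s' (map (selt (q := q) d f) (enum {: 'I_r + ('I_q * 'I_r * 'I_r)})).
  apply: (selt_strong fh d0 (s := (s' + s2)%N)) => //; first exact: leq_addr.
    by rewrite -eE.
  move=> e g eD e0 hg hw; apply: (@weak_le _ _ s2); first exact: leq_addl.
  by apply: (h2 (Ordinal (eD : (e < D.+1)%N))).
pose el x := (selt (q := q) d f x).2.
have elP x : posform (el x).
  exists (selt (q := q) d f x).1; last exact: selt_homog.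
  by case: x => [j|[[b j'] j]] /=; case/andP: (d0 j).
have rall : reg (@zeroid _) [seq el x | x <- enum {: 'I_r + ('I_q * 'I_r * 'I_r)}].
  rewrite /el (map_comp snd (selt (q := q) d f)); apply: hs' st; first by rewrite size_map -cardE.
  move=> _ /mapP[x _ ->]; split; last exact: selt_homog.
    by case: x => [j|[[b j'] j]] /=; case/andP: (d0 j).
  by case: x => [j|[[b j'] j]] /=; case/andP: (d0 j).
have rsub xs : uniq xs -> reg (@zeroid _) (map el xs).
  move=> ux; have pe : perm_eq (enum {: 'I_r + ('I_q * 'I_r * 'I_r)})
      (xs ++ [seq x <- enum {: 'I_r + ('I_q * 'I_r * 'I_r)} | x \notin xs]).
    apply: uniq_perm; rewrite ?enum_uniq //.
      rewrite cat_uniq ux filter_uniq ?enum_uniq // andbT /=; apply/hasPn => x.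
      by rewrite mem_filter => /andP[].
    by move=> x; rewrite mem_enum mem_cat mem_filter mem_enum andbT orbN.
  have := regT_one_perm _ (perm_map el pe) rall; rewrite map_cat /reg regT_cat.
  by case=> // _ /mapP[x _ ->].
pose off : seq ('I_r + ('I_q * 'I_r * 'I_r)) := [seq inr p | p <- enum {: 'I_q * 'I_r * 'I_r} & p.1.2 != p.2].
pose fx : seq ('I_r + ('I_q * 'I_r * 'I_r)) := [seq inl j | j <- enum 'I_r].
have ubase : uniq (fx ++ off).
  rewrite cat_uniq; apply/and3P; split.
  - by rewrite map_inj_uniq ?enum_uniq // => ? ? [].
  - by apply/hasPn => _ /mapP[p _ ->]; apply/negP => /mapP[].
  rewrite map_inj_uniq => [|? ? [] //]; apply: filter_uniq; exact: enum_uniq.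
pose J := idadd (@zeroid _) (map el (fx ++ off)).
have idJ : is_ideal J by apply/idadd_ideal/zeroid_ideal.
pose M b := \det (\matrix_(j < r, j' < r) gdir f (q := q) b j' j).
have rM : reg J [seq M b | b <- enum 'I_q].
  apply: (regT_eqmod (F := fun b => \prod_j gdir f b j j)) => //.
    move=> b; have := @det_offdiag _ r J (\matrix_(j < r, j' < r) gdir f (q := q) b j' j) idJ.
    rewrite (eq_bigr (fun j => gdir f b j j)) => [|j _]; last by rewrite mxE.
    apply=> i j ij; rewrite mxE; apply: idadd_gen; first exact: zeroid_ideal.
    apply/mapP; exists (inr (b, j, i)) => //; rewrite mem_cat; apply/orP; right.
    by apply: map_f; rewrite mem_filter mem_enum /= eq_sym ij.
  apply: (@regT_blocks _ _ _ (fun b j => gdir f b j j)) => //; first exact: enum_uniq.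
  move=> ps u1 _.
  have : uniq ((fx ++ off) ++ [seq inr (p.1, p.2, p.2) | p <- ps]).
    rewrite cat_uniq ubase /=; apply/andP; split.
      apply/hasPn => _ /mapP[p _ ->]; rewrite mem_cat negb_or; apply/andP; split.
        by apply/negP => /mapP[].
      apply/negP => /mapP[[[b j] j']]; rewrite mem_filter /= => /andP[ne _] [_ e1 e2].
      by rewrite -e1 e2 eqxx in ne.
    by rewrite map_inj_uniq ?(map_uniq u1) // => -[a b] [a' b'] [-> ->].
  move=> /rsub; rewrite map_cat /reg regT_cat => -[_]; by rewrite -map_comp.
(* The off-diagonal derivatives are moved to the front and removed; every member has positive
   degree, so [regT_one_dropl] applies. *)
have rM' : reg (@zeroid _) (map el fx ++ [seq M b | b <- enum 'I_q]).
  have P z : z \in map el off ++ map el fx ++ [seq M b | b <- enum 'I_q] -> posform z.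
    rewrite !mem_cat => /orP[/mapP[x _ ->]|/orP[/mapP[x _ ->]|/mapP[b _ ->]]]; try exact: elP.
    exists (\sum_(j < r) d j)%N.
      by rewrite (bigD1 (Ordinal r0)) //= ltn_addr //; case/andP: (d0 (Ordinal r0)).
    apply: rpred_sum => sg _; rewrite -signr_odd; case: (odd _); rewrite ?expr0 ?expr1 ?mulN1r ?mul1r ?rpredN.
      apply: homog_prod => j; rewrite mxE; exact: (selt_homog (d := d) fh d0 (inr (_, _, j))).
    apply: homog_prod => j; rewrite mxE; exact: (selt_homog (d := d) fh d0 (inr (_, _, j))).
  apply: (regT_one_dropl P); apply: (@regT_one_perm _ _ (map el (fx ++ off) ++ [seq M b | b <- enum 'I_q])).
  - move=> z hz; apply: P; move: hz; rewrite map_cat !mem_cat; by case: (z \in map el fx) => /=; rewrite ?orbT.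
  - by rewrite map_cat -catA perm_catCA.
  rewrite /reg regT_cat; split; last exact: rM.
  exact: rsub.
have [v hv] := specialize_reg rM'.
exists (fun b j i => if insub j is Some j' then v (enum_rank (b, j' : 'I_r, i)) else 0).
move: hv; rewrite map_cat; congr (reg _ (_ ++ _)).
  by rewrite eE -!map_comp; apply: eq_map => j; apply: evw_xin.
rewrite -map_comp; apply: eq_map => b /=.
rewrite /M /jacdet -det_map_mx; congr (\det _); apply/matrixP => j j'; rewrite !mxE.
rewrite /gdir rmorph_sum /dirder; apply: eq_bigr => i _; rewrite rmorphM /= evw_xin valK.
rewrite /wv mmapU (unsplitK (inr _ : 'I_n + 'I_#|{: 'I_q * 'I_r * 'I_n}|)%type).
by rewrite (nth_map (0%N, 0)) // hE.
Qed.

End Jacobian.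

(** * Projections onto p-th powers *)

Section Taylor.
Variables (S : comNzRingType) (N p : nat) (D : 'I_N -> S -> S) (y : 'I_N -> S) (mu : S) (a : nat -> S).
Hypothesis p0 : (0 < p)%N.
Hypothesis DD : forall k g h, D k (g + h) = D k g + D k h.
Hypothesis DM : forall k g h, D k (g * h) = D k g * h + g * D k h.
Hypothesis Dy : forall k l, D k (y l) = if k == l then mu else 0.
Hypothesis Dmu : forall k, D k mu = 0.
Hypothesis Da : forall k i, D k (a i) = 0.
Hypothesis DC : forall k l g, D k (D l g) = D l (D k g).
Hypothesis Dp : forall k g, iter p (D k) g = 0.
Hypothesis a0 : a 0%N = 1.
Hypothesis aS : forall i, (i.+1 < p)%N -> a i.+1 * i.+1%:R = a i.

(* [a i] plays the role of [1 / i`!]: up to a power of [mu], this is the Taylor expansion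
   that computes the value of [g] at [y k = 0]. *)
Definition taylor k g :=
  \sum_(0 <= i < p) a i * (- y k) ^+ i * mu ^+ (p.-1 - i) * iter i (D k) g.

Lemma der0 k : D k 0 = 0.
Proof. by apply: (addrI (D k 0)); rewrite -DD !addr0. Qed.

Lemma derN k g : D k (- g) = - D k g.
Proof. by apply: (addrI (D k g)); rewrite -DD !subrr der0. Qed.

Lemma der_sum k (J : Type) (r : seq J) (F : J -> S) :
  D k (\sum_(j <- r) F j) = \sum_(j <- r) D k (F j).
Proof. by elim: r => [|j r IH]; rewrite ?big_nil ?der0 // !big_cons DD IH. Qed.

Lemma der1 k : D k 1 = 0.
Proof. by have := DM k 1 1; rewrite !mulr1 mul1r => e; apply: (addrI (D k 1)); rewrite -e addr0. Qed.

Lemma derX k x i : D k (x ^+ i) = i%:R * x ^+ i.-1 * D k x.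
Proof.
elim: i => [|i IH]; first by rewrite expr0 der1 !mul0r.
rewrite exprS DM IH -natr1; case: i {IH} => [|i] /=; first by rewrite !mul0r mulr0 expr0; ring.
rewrite exprS; ring.
Qed.

Lemma iterD k i g h : iter i (D k) (g + h) = iter i (D k) g + iter i (D k) h.
Proof. by elim: i => //= i ->; rewrite DD. Qed.

Lemma iterM k i c g : D k c = 0 -> iter i (D k) (c * g) = c * iter i (D k) g.
Proof. by move=> hc; elim: i => //= i ->; rewrite DM hc mul0r add0r. Qed.

Lemma iterC k l i g : D l (iter i (D k) g) = iter i (D k) (D l g).
Proof. by elim: i => //= i IH; rewrite DC IH. Qed.

Lemma iter_y k i h : iter i (D k) (y k * h) = y k * iter i (D k) h + i%:R * mu * iter i.-1 (D k) h.
Proof.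
elim: i => [|i IH] /=; first by rewrite !mul0r addr0.
rewrite IH DD !DM Dy eqxx Dmu -natr1.
have -> : D k i%:R = 0.
  by elim: i {IH} => [|i IH]; rewrite ?der0 // -natr1 DD IH der1 addr0.
case: i {IH} => [|i] /=; ring.
Qed.

Lemma comm_leibniz k l g h : D k (D l (g * h)) - D l (D k (g * h)) =
  (D k (D l g) - D l (D k g)) * h + g * (D k (D l h) - D l (D k h)).
Proof. by rewrite !DM !DD !DM; ring. Qed.

Lemma iter_leibniz k i g h : iter i (D k) (g * h) =
  \sum_(j < i.+1) 'C(i, j)%:R * (iter (i - j) (D k) g * iter j (D k) h).
Proof.
have nat0 c : D k c%:R = 0 by elim: c => [|c IH]; rewrite ?der0 // -natr1 DD IH der1 addr0.
elim: i => [|i IH]; first by rewrite big_ord_recl big_ord0 /= bin0 mul1r addr0.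
rewrite iterS IH der_sum.
rewrite (eq_bigr (fun j : 'I_i.+1 => 'C(i, j)%:R * (iter (i.+1 - j) (D k) g * iter j (D k) h) +
   'C(i, j)%:R * (iter (i - j) (D k) g * iter j.+1 (D k) h))) => [|j _]; last first.
  by rewrite DM nat0 mul0r add0r DM subSn ?(leq_ord j) //= mulrDr.
rewrite big_split /= [RHS]big_ord_recl /= bin0.
rewrite [in RHS](eq_bigr (fun j : 'I_i.+1 => 'C(i, j.+1)%:R * (iter (i - j) (D k) g * iter j.+1 (D k) h)
  + 'C(i, j)%:R * (iter (i - j) (D k) g * iter j.+1 (D k) h))) => [|j _]; last first.
  by rewrite /bump /= add1n binS natrD mulrDl subSS.
rewrite big_split /= addrA; congr (_ + _).
rewrite [in RHS]big_ord_recr /= bin_small // mul0r addr0 big_ord_recl /= bin0; congr (_ + _).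
Qed.

(** The derivatives of the summands telescope, by the relation [aS] between the [a i], and the last
    term contains [iter p (D k) g = 0]. *)
Lemma D_taylor k g : D k (taylor k g) = 0.
Proof.
pose u i := if i is i'.+1 then a i' * (- y k) ^+ i' * mu ^+ (p.-1 - i') * iter i (D k) g else 0.
rewrite /taylor der_sum (eq_big_nat _ _ (F2 := fun i => u i.+1 - u i)) => [|i /andP[_ ip]].
  rewrite telescope_sumr //= subr0 -(prednK p0) /u; rewrite prednK // Dp mulr0 //.
rewrite !DM Da !derX derN Dy eqxx Dmu.
case: i ip => [|i] ip /=; first by ring.
rewrite -[in X in _ = _ - X](aS ip).
have -> : (p.-1 - i = (p.-1 - i.+1).+1)%N by rewrite -subSn ?subSS // -ltnS prednK.
move: (p.-1 - i.+1)%N => e; rewrite !mulr0 !exprS; ring.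
Qed.

Lemma D_taylor_neq k l g : l != k -> D l (taylor k g) = taylor k (D l g).
Proof.
move=> lk; rewrite /taylor der_sum; apply: eq_bigr => i _.
rewrite !DM Da !derX derN Dy (negbTE lk) Dmu oppr0 iterC; ring.
Qed.

Lemma taylorD k g h : taylor k (g + h) = taylor k g + taylor k h.
Proof. by rewrite /taylor -big_split; apply: eq_bigr => i _; rewrite iterD mulrDr. Qed.

Lemma taylorM k c g : D k c = 0 -> taylor k (c * g) = c * taylor k g.
Proof. by move=> hc; rewrite /taylor big_distrr; apply: eq_bigr => i _ /=; rewrite iterM //; ring. Qed.

Lemma taylor_y k h : taylor k (y k * h) = - (a p.-1 * (- y k) ^+ p * iter p.-1 (D k) h).
Proof.
pose u i := if i is i'.+1 then - (a i' * (- y k) ^+ i * mu ^+ (p.-1 - i') * iter i' (D k) h) else 0.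
rewrite /taylor (eq_big_nat _ _ (F2 := fun i => u i.+1 - u i)) => [|i /andP[_ ip]].
  rewrite telescope_sumr //= subr0 -{1}(prednK p0) /u subnn mulr1 prednK //.
rewrite iter_y; case: i ip => [|i] ip /=; first by rewrite !mul0r addr0 subr0 expr1 expr0; ring.
rewrite -[in X in _ = _ - X](aS ip) opprK.
have -> : (p.-1 - i = (p.-1 - i.+1).+1)%N by rewrite -subSn ?subSS // -ltnS prednK.
move: (p.-1 - i.+1)%N => e; rewrite !exprS; ring.
Qed.

Definition proj l g := foldr taylor g l.

Lemma D_proj l g k : (k \in l \/ D k g = 0) -> D k (proj l g) = 0.
Proof.
elim: l => [|j l IH] /= h; first by case: h.
have [->|kj] := eqVneq k j; first exact: D_taylor.
rewrite D_taylor_neq // IH; last by case: h => [|->]; [rewrite inE (negbTE kj) /=; left | right].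
rewrite /taylor big1 // => i _; have -> : iter i (D j) 0 = 0; last by rewrite mulr0.
by elim: i => //= i ->; exact: der0.
Qed.

Section Mod.
Variables (I : S -> Prop) (Z : pred 'I_N).
Hypothesis idI : is_ideal I.
Hypothesis yZ : forall k, Z k -> I (y k).
Hypothesis DI : forall k g, ~~ Z k -> I g -> I (D k g).

(** Every summand with [i > 0] has the factor [y k], in [I] when [Z k] holds, and a factor derived
    from [D k g], in [I] otherwise. *)
Lemma taylor_mod k g : Z k \/ I (D k g) -> I (taylor k g - mu ^+ p.-1 * g).
Proof.
move=> h; rewrite /taylor big_ltn // subn0 expr0 a0 /= [X in I X](_ : _ =
  \sum_(1 <= i < p) a i * (- y k) ^+ i * mu ^+ (p.-1 - i) * iter i (D k) g); last by ring.
rewrite big_nat; apply: ideal_sum => // i /andP[i0 _]; case: i i0 => // i _.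
have [hZ|hZ] := boolP (Z k).
  rewrite exprS; do 2 (apply: idealMr => //); apply: idealM => //; apply: idealMr => //.
  by apply: idealN => //; apply: yZ.
apply: idealM => //; rewrite iterS; elim: i => [|i IH] /=; last exact: DI.
by case: h => // hk; rewrite hk in hZ.
Qed.

Lemma taylor_I k g : I g -> I (taylor k g).
Proof.
move=> hg; have h : Z k \/ I (D k g) by case: (boolP (Z k)) => hZ; [left | right; apply: DI].
have := idealD idI (taylor_mod h) (idealM idI (mu ^+ p.-1) hg); by rewrite subrK.
Qed.

Lemma proj_mod l g : (forall k, ~~ Z k -> I (D k g)) ->
  I (proj l g - mu ^+ (p.-1 * size l) * g) /\ forall k, ~~ Z k -> I (D k (proj l g)).
Proof.
move=> hg; elim: l => [|j l [IH1 IH2]]; first by rewrite muln0 expr0 mul1r subrr; split; first exact: ideal0.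
split=> [|k hk] /=; last first.
  have [->|kj] := eqVneq k j; first by rewrite D_taylor; apply: ideal0.
  by rewrite D_taylor_neq //; apply/taylor_I/IH2.
have h : Z j \/ I (D j (proj l g)) by case: (boolP (Z j)) => hZ; [left | right; apply: IH2].
have := idealD idI (taylor_mod h) (idealM idI (mu ^+ p.-1) IH1).
by rewrite mulrBr addrA subrK mulrA -exprD mulnS.
Qed.
End Mod.

Lemma projD l g h : proj l (g + h) = proj l g + proj l h.
Proof. by elim: l => //= k l ->; rewrite taylorD. Qed.

Lemma proj0 l : proj l 0 = 0.
Proof. by apply: (addrI (proj l 0)); rewrite -projD !addr0. Qed.

Lemma projM l c g : (forall k, k \in l -> D k c = 0) -> proj l (c * g) = c * proj l g.
Proof.
elim: l => //= k l IH hc; rewrite IH => [|j jl]; last by apply: hc; rewrite inE jl orbT.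
by rewrite taylorM // hc // mem_head.
Qed.

Hypothesis DP : forall k x, D k (x ^+ p) = 0.

(** Shows where the projection sends the ideal of the [y k]: into combinations of the [y k ^+ p]
    whose coefficients are killed by the derivations in [l]. The Taylor sum of [y k * h] telescopes
    to its top term. *)
Lemma proj_y l k h : uniq l -> k \in l ->
  exists v, (forall j, j \in l -> D j v = 0) /\ proj l (y k * h) = y k ^+ p * v.
Proof.
elim: l => // j l IH /= /andP[jl ul]; rewrite inE.
have [-> _|kj /= kl] := eqVneq k j.
  exists (- (a p.-1 * (-1) ^+ p * iter p.-1 (D j) (proj l h))); split=> [i|].
    have Dm i' : D i' ((-1) ^+ p) = 0 by rewrite DP.
    rewrite inE derN !DM Da Dm !(mulr0, mul0r, add0r) iterC => /orP[/eqP ->|il].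
      by rewrite -iterC -iterS prednK // Dp mulr0 oppr0.
    rewrite D_proj; last by left.
    have -> : iter p.-1 (D j) 0 = 0 by elim: p.-1 => //= i' ->; exact: der0.
    by rewrite mulr0 oppr0.
  rewrite projM => [|i il]; last by rewrite Dy; case: eqP => // e; rewrite -e il in jl.
  by rewrite taylor_y [(- y j) ^+ p]exprNn; move: (_ ^+ p) (y j ^+ p) => e e'; ring.
have [v [hv ->]] := IH ul kl.
exists (taylor j v); split=> [i|]; last by rewrite taylorM.
rewrite inE => /orP[/eqP ->|il]; first exact: D_taylor.
rewrite D_taylor_neq ?hv //; last by apply/eqP => e; rewrite -e il in jl.
rewrite /taylor big1 // => i' _; have -> : iter i' (D j) 0 = 0; last by rewrite mulr0.
by elim: i' => //= i' ->; exact: der0.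
Qed.

End Taylor.

Section Coord.
Variables (K : closedFieldType) (N p : nat) (y : 'I_N -> {mpoly K[N]}).
Hypothesis pK : p \in [pchar K].
Local Notation S := {mpoly K[N]}.

Definition jac_mx : 'M[S]_N := \matrix_(k, l) (y k)^`M(l).
Local Notation Jm := jac_mx.
Local Notation Delta := (\det jac_mx).
Hypothesis Delta0 : Delta != 0.

(** The derivation dual to the coordinates [y], cleared of denominators. The adjugate alone would
    give [Delta] on [y k]; the extra factor makes this value [Delta ^+ p], a [p]-th power and hence
    killed by all derivations. *)
Definition cder (k : 'I_N) (g : S) : S := Delta ^+ p.-1 * \sum_l \adj Jm l k * g^`M(l).

Let p_prime : prime p := pcharf_prime pK.
Let p_gt0 : (0 < p)%N := prime_gt0 p_prime.

Lemma pS : p%:R = 0 :> S.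
Proof. by have := pcharf0 (pchar_mpoly N pK). Qed.

Lemma cderD k g h : cder k (g + h) = cder k g + cder k h.
Proof.
rewrite /cder -mulrDr -big_split; congr (_ * _); apply: eq_bigr => l _ /=.
by rewrite mderivD mulrDr.
Qed.

Lemma cderM k g h : cder k (g * h) = cder k g * h + g * cder k h.
Proof.
rewrite /cder -mulrA [X in _ = _ + X]mulrCA -mulrDr; congr (_ * _).
rewrite mulr_suml mulr_sumr -big_split.
by apply: eq_bigr => l _ /=; rewrite mderivM; ring.
Qed.

Lemma cderC k c : cder k c%:MP = 0.
Proof. by rewrite /cder big1 ?mulr0 // => l _; rewrite mderivC mulr0. Qed.

Lemma cder0 k : cder k 0 = 0.
Proof. by rewrite -{1}(mpolyC0 N K) cderC. Qed.

Lemma cdery k l : cder k (y l) = if k == l then Delta ^+ p else 0.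
Proof.
have e : \sum_i \adj Jm i k * (y l)^`M(i) = if k == l then Delta else 0.
  have := congr1 (fun A : 'M[S]_N => A l k) (mul_mx_adj Jm); rewrite !mxE eq_sym => h.
  transitivity (Delta *+ (k == l)); last by case: eqP.
  by rewrite -h; apply: eq_bigr => i _; rewrite !mxE mulrC.
by rewrite /cder e; case: eqP => _; rewrite ?mulr0 // -exprSr prednK.
Qed.

Lemma cder_exp k x : cder k (x ^+ p) = 0.
Proof. by rewrite (derX (D := cder) cderM) pS !mul0r. Qed.

(** With a nonzero Jacobian, a derivation that kills all [y k] is zero. This is applied to
    commutators and, in characteristic [p], to [p]-th iterates of the [cder k], which are again
    derivations. *)
Lemma der_eq0 (th : S -> S) : (forall g h, th (g + h) = th g + th h) ->
  (forall g h, th (g * h) = th g * h + g * th h) -> (forall c, th c%:MP = 0) ->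
  (forall k, th (y k) = 0) -> forall g, th g = 0.
Proof.
move=> hD hM hC hy.
have ch := @chain_rule _ _ _ (idfun : {rmorphism S -> S}) th hD hM hC.
have z : Jm *m (\col_l th 'X_l) = 0.
  apply/matrixP => k j; rewrite !mxE -[RHS](hy k) ch; apply: eq_bigr => l _.
  by rewrite !mxE.
have z' : Delta *: (\col_l th 'X_l) = 0 by rewrite -mul_scalar_mx -mul_adj_mx -mulmxA z mulmx0.
move=> g; rewrite ch big1 // => l _; apply/eqP; rewrite mulf_eq0; apply/orP; right.
have /eqP := congr1 (fun A : 'cV[S]_N => A l 0) z'.
by rewrite !mxE mulf_eq0 (negbTE Delta0).
Qed.

Lemma cder_comm k l g : cder k (cder l g) = cder l (cder k g).
Proof.
apply/eqP; rewrite -subr_eq0; apply/eqP.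
apply: (@der_eq0 (fun g => cder k (cder l g) - cder l (cder k g))) => [g' h|g' h|c|j].
- by rewrite !cderD opprD addrACA.
- exact: (comm_leibniz (D := cder) cderD cderM).
- by rewrite !cderC ?cder0 subrr.
have d0 i j' : cder i (cder j' (y j)) = 0.
  rewrite cdery; case: eqP => _; first exact: cder_exp.
  by rewrite cder0.
by rewrite !d0 subr0.
Qed.

Lemma cder_p k g : iter p (cder k) g = 0.
Proof.
apply: (@der_eq0 (fun g => iter p (cder k) g)) => [g' h|g' h|c|j].
- exact: (iterD (D := cder) cderD).
- rewrite (iter_leibniz (D := cder) cderD cderM).
  rewrite -(big_mkord xpredT (fun j => 'C(p, j)%:R * (iter (p - j) (cder k) g' * iter j (cder k) h))).
  rewrite big_nat_recr //= big_ltn // bin0 binn subn0 subnn !mul1r big_nat big1 ?addr0 //.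
  move=> i /andP[i0 ip]; rewrite (_ : _%:R = 0) ?mul0r //.
  have : (p %| 'C(p, i))%N by apply: prime_dvd_bin => //; rewrite i0.
  by case/dvdnP => a ->; rewrite natrM pS mulr0.
- rewrite -(prednK p_gt0) iterSr cderC; elim: p.-1 => //= i ->.
  by rewrite cder0.
rewrite -(subnK (prime_gt1 p_prime)) addn2 !iterSr cdery.
have -> : cder k (if k == j then Delta ^+ p else 0) = 0.
  by case: eqP => _; [exact: cder_exp | rewrite cder0].
by elim: (p - 2)%N => //= i ->; rewrite cder0.
Qed.

Definition ifact i : S := ((i`!)%:R^-1)%:MP.

Lemma ifactS i : (i.+1 < p)%N -> ifact i.+1 * i.+1%:R = ifact i.
Proof.
move=> ip; rewrite /ifact -(mpolyC_nat N K) -mpolyCM; congr (_%:MP); rewrite factS natrM invfM mulrAC.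
rewrite mulVf ?mul1r // -(dvdn_pcharf pK); by apply/negP => /dvdn_leq h; have := h isT; rewrite leqNgt ip.
Qed.

Lemma cder_const g : (forall k, cder k g = 0) -> exists w, g = w ^+ p.
Proof.
move=> hg; suff h l : g^`M(l) = 0 by have [w [-> _]] := pth_power pK h; exists w.
have z : (\row_l g^`M(l)) *m \adj Jm = 0.
  apply/matrixP => i k; rewrite !mxE; apply/eqP; have := hg k; rewrite /cder => /eqP.
  rewrite mulf_eq0 expf_eq0 (negbTE Delta0) andbF /= => /eqP e; apply/eqP; rewrite -[RHS]e.
  by apply: eq_bigr => j _; rewrite !mxE mulrC.
have z' : (\row_l g^`M(l)) *m Delta%:M = 0 by rewrite -mul_adj_mx mulmxA z mul0mx.
have /eqP := congr1 (fun A : 'rV[S]_N => A 0 l) z'.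
by rewrite mul_mx_scalar !mxE mulf_eq0 (negbTE Delta0) => /eqP.
Qed.

Local Notation prj := (proj p cder y (Delta ^+ p) ifact (enum 'I_N)).

Lemma prj_pth g : exists w, prj g = w ^+ p.
Proof.
apply: cder_const => k; apply: D_proj => //; last by left; rewrite mem_enum.
- exact: cderD.
- exact: cderM.
- exact: cdery.
- move=> j; exact: cder_exp.
- move=> j i; exact: cderC.
- exact: cder_comm.
- exact: cder_p.
- exact: ifactS.
Qed.

Section ModY.
Variable Z : pred 'I_N.
Local Notation I := (idadd (@zeroid S) [seq y k | k <- enum 'I_N & Z k]).

Let idI : is_ideal I.
Proof. by apply/idadd_ideal/zeroid_ideal. Qed.

Lemma coord_pth_power g : (forall l, I (g^`M(l))) -> exists e w, I (Delta ^+ (p * e) * g - w ^+ p).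
Proof.
move=> hg; have [w ew] := prj_pth g.
have cI k : I (cder k g) by apply: idealM => //; apply: ideal_sum => // l _; apply: idealM.
exists (p.-1 * size (enum 'I_N))%N, w; rewrite -ew exprM.
have a0 : ifact 0 = 1 by rewrite /ifact fact0 invr1 mpolyC1.
have yZ k : Z k -> I (y k).
  move=> hk; apply: idadd_gen; first exact: zeroid_ideal.
  by apply: map_f; rewrite mem_filter hk mem_enum.
have DI k x : ~~ Z k -> I x -> I (cder k x).
  move=> hk hx; suff : I x /\ I (cder k x) by case.
  move: x hx; apply: idadd_min.
  - split; first by rewrite cder0; split; apply: ideal0.
    split=> [u v [h1 h2] [h3 h4]|r u [h1 h2]]; first by rewrite cderD; split; apply: idealD.
    by rewrite cderM; split; [apply: idealM | apply: idealD => //; apply: idealM].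
  - by move=> u ->; rewrite cder0; split; apply: ideal0.
  move=> u /mapP[j]; rewrite mem_filter => /andP[hj _] ->; split; first exact: yZ.
  rewrite cdery; case: eqP => [e|_]; last exact: ideal0.
  by rewrite e hj in hk.
have [h _] := @proj_mod S N p cder y (Delta ^+ p) ifact p_gt0 cderD cderM cdery (fun k => cder_exp k _)
  (fun k i => cderC k _) cder_comm cder_p a0 ifactS I Z idI yZ DI (enum 'I_N) g (fun k _ => cI k).
by have := idealN idI h; rewrite opprB.
Qed.

(** Project an expression of [z ^+ p] by the generators: the left side becomes the [p]-th power of
    [Delta ^+ e * z], while by [proj_y] the right side becomes a sum of terms [(y k * v') ^+ p], the
    [p]-th power of an element of [I]. Extracting the root is possible since the ring is a domain of
    characteristic [p]. *)
Lemma coord_reduced z : I (z ^+ p) -> exists e, I (Delta ^+ e * z).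
Proof.
move=> /idadd0P [cs [hcs ez]].
have a0 : ifact 0 = 1 by rewrite /ifact fact0 invr1 mpolyC1.
pose e := (p.-1 * size (enum 'I_N))%N; exists e.
have e1 : prj (z ^+ p) = (Delta ^+ e * z) ^+ p.
  have [|h _] := @proj_mod S N p cder y (Delta ^+ p) ifact p_gt0 cderD cderM cdery (fun k => cder_exp k _)
    (fun k i => cderC k _) cder_comm cder_p a0 ifactS (@zeroid S) pred0 (zeroid_ideal S)
    (fun k (f : false) => False_ind _ (notF f)) _ (enum 'I_N) (z ^+ p) (fun k _ => cder_exp k _).
    by move=> k x _ ->; apply: cder0.
  move/eqP: h; rewrite subr_eq0 => /eqP ->.
  by rewrite exprMn -/e -!exprM mulnC.
have fr (u v : S) : (u + v) ^+ p = u ^+ p + v ^+ p.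
  by rewrite -!(pFrobenius_autE (pchar_mpoly N pK)) rmorphD.
have [u [Iu eu]] : exists u, I u /\ prj (z ^+ p) = u ^+ p.
  rewrite ez; clear ez e1 e.
  have sub k : k \in [seq k <- enum 'I_N | Z k] -> I (y k).
    by move=> hk; apply: idadd_gen; [exact: zeroid_ideal | exact: (map_f y hk)].
  move: (idI) sub; generalize I => J idJ.
  elim: [seq k <- enum 'I_N | Z k] cs {hcs} => [|k ks IH] cs sub.
    exists 0; split; first exact: (ideal0 idJ).
    have -> : lcomb cs [seq y i | i <- [::]] = 0 by rewrite /lcomb; case: (cs) => [|? ?]; rewrite big_nil.
    by rewrite expr0n (gtn_eqF p_gt0) (proj0 _ _ _ _ cderD).
  case: cs => [|c cs].
    exists 0; split; first exact: (ideal0 idJ).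
    by rewrite expr0n (gtn_eqF p_gt0) /lcomb /= big_nil (proj0 _ _ _ _ cderD).
  have [j jk|u [Iu eu]] := IH cs; first by apply: sub; rewrite inE jk orbT.
  have [v [hv ev]] := @proj_y S N p cder y (Delta ^+ p) ifact p_gt0 cderD cderM cdery (fun k => cder_exp k _)
    (fun k i => cderC k _) cder_comm cder_p ifactS cder_exp (enum 'I_N) k c (enum_uniq _) (mem_enum _ _).
  have [v' ev'] := cder_const (fun j => hv j (mem_enum _ _)).
  exists (y k * v' + u); split.
    by apply: (idealD idJ) => //; apply: (idealMr idJ); apply: sub; rewrite mem_head.
  rewrite lcomb_cons (projD _ _ _ _ cderD) eu fr exprMn mulrC ev ev'.
  by [].
have : (Delta ^+ e * z - u) ^+ p = 0 by rewrite -(pFrobenius_autE (pchar_mpoly N pK)) rmorphB /= !pFrobenius_autE -e1 eu subrr.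
by move/eqP; rewrite expf_eq0 p_gt0 /= subr_eq0 => /eqP ->.
Qed.
End ModY.
End Coord.

Section JacLocal.
Variables (K : closedFieldType) (n m p : nat) (fs : seq {mpoly K[n]}) (w : nat -> 'I_n -> K).
Hypothesis pK : p \in [pchar K].
Hypothesis szfs : size fs = m.
Local Notation R := {mpoly K[n]}.
Local Notation S := {mpoly K[n + m]}.
Local Notation M := (jacdet m fs w).
Hypothesis M0 : M != 0.
Local Notation I := (idadd (@zeroid R) fs).

(** To make [fs] part of a coordinate system whose Jacobian is the given minor, one variable is
    added for each direction [w a] and the point is moved along these directions. Then the old
    variables and the moved forms are coordinates: their Jacobian matrix is block triangular with
    determinant [tr M]. Setting the new variables to zero returns to [R]. *)
Definition tr : R -> S := mmap (@mpolyC (n + m) K)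
  (fun i => 'X_(lshift m i) + \sum_(a < m) (w a i)%:MP * 'X_(rshift n a)).
Lemma tr_is_additive : zmod_morphism tr.
Proof. exact: raddfB. Qed.
HB.instance Definition _ := GRing.isZmodMorphism.Build R S tr tr_is_additive.
Lemma tr_is_multiplicative : monoid_morphism tr.
Proof. by split; [exact: rmorph1 | exact: rmorphM]. Qed.
HB.instance Definition _ := GRing.isMonoidMorphism.Build R S tr tr_is_multiplicative.

Definition ev0 : S -> R := mmap (@mpolyC n K)
  (fun k => match fintype.split k with inl i => 'X_i | inr _ => 0 end).
Lemma ev0_is_additive : zmod_morphism ev0.
Proof. exact: raddfB. Qed.
HB.instance Definition _ := GRing.isZmodMorphism.Build S R ev0 ev0_is_additive.
Lemma ev0_is_multiplicative : monoid_morphism ev0.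
Proof. by split; [exact: rmorph1 | exact: rmorphM]. Qed.
HB.instance Definition _ := GRing.isMonoidMorphism.Build S R ev0 ev0_is_multiplicative.

Lemma trC c : tr c%:MP = c%:MP. Proof. by rewrite /tr mmapC. Qed.
Lemma trX i : tr 'X_i = 'X_(lshift m i) + \sum_(a < m) (w a i)%:MP * 'X_(rshift n a).
Proof. by rewrite /tr mmapU. Qed.

Lemma ev0_tr f : ev0 (tr f) = f.
Proof.
apply: (@mpoly_rmorph_ext _ _ _ (ev0 \o tr : {rmorphism _ -> _}) idfun) => [a|i] /=.
  by rewrite trC /ev0 mmapC.
rewrite trX rmorphD rmorph_sum /= /ev0 mmapU (unsplitK (inl i : 'I_n + 'I_m)%type) big1 ?addr0 //.
by move=> a _; rewrite rmorphM /= mmapU (unsplitK (inr a : 'I_n + 'I_m)%type) mulr0.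
Qed.

Lemma mderivU N (i k : 'I_N) : ('X_i : {mpoly K[N]})^`M(k) = (i == k)%:R.
Proof.
rewrite mderivX mnm1E; case: eqP => [->|_]; last by rewrite scale0r.
set u := U_(k)%MM; have -> : (u - u)%MM = 0%MM by apply/mnmP => j; rewrite mnmBE subnn mnm0E.
by rewrite scale1r mpolyX0.
Qed.

Lemma tr_deriv k f : (tr f)^`M(k) = \sum_i tr (f^`M(i)) * (tr 'X_i)^`M(k).
Proof.
apply: (@chain_rule _ _ _ tr (fun f => (tr f)^`M(k))) => [g h|g h|c].
- by rewrite rmorphD mderivD.
- by rewrite rmorphM mderivM.
by rewrite trC mderivC.
Qed.

Lemma tr_derivr (a : 'I_m) f : (tr f)^`M(rshift n a) = tr (dirder (w a) f).
Proof.
rewrite tr_deriv /dirder rmorph_sum; apply: eq_bigr => i _; rewrite rmorphM /= trC mulrC; congr (_ * _).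
rewrite trX mderivD mderivU eq_lrshift add0r (raddf_sum (mderiv _)) (bigD1 a) //= big1 => [|b ba].
  by rewrite mderiv_mulC mderivU eqxx mulr1 addr0.
by rewrite mderiv_mulC mderivU eq_rshift (negbTE ba) mulr0.
Qed.

Definition coords (k : 'I_(n + m)) : S :=
  match fintype.split k with inl i => 'X_(lshift m i) | inr c => tr (nth 0 fs c) end.
Local Notation Z := (fun k : 'I_(n + m) => if fintype.split k is inr _ then true else false).

Lemma coords_det : \det (jac_mx coords) = tr M.
Proof.
have -> : jac_mx coords = block_mx 1%:M 0 (\matrix_(c, i) (tr (nth 0 fs c))^`M(lshift m i))
    (map_mx tr (\matrix_(j, j') dirder (w j') (nth 0 fs j))).
  apply/matrixP => k l; rewrite mxE /coords.
  case: (fintype.splitP k) => i ei; case: (fintype.splitP l) => j ej.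
  - have ek : k = lshift m i by apply: val_inj. have el : l = lshift m j by apply: val_inj.
    rewrite {}ek {}el.
    by rewrite block_mxEul mxE mderivU eq_lshift.
  - have ek : k = lshift m i by apply: val_inj. have el : l = rshift n j by apply: val_inj.
    rewrite {}ek {}el.
    by rewrite block_mxEur mxE mderivU eq_lrshift.
  - have ek : k = rshift n i by apply: val_inj. have el : l = lshift m j by apply: val_inj.
    rewrite {}ek {}el.
    by rewrite block_mxEdl mxE.
  have ek : k = rshift n i by apply: val_inj. have el : l = rshift n j by apply: val_inj.
    rewrite {}ek {}el.
  by rewrite block_mxEdr !mxE tr_derivr.
by rewrite det_lblock det1 mul1r det_map_mx.
Qed.

Lemma coords_det0 : \det (jac_mx coords) != 0.
Proof.
rewrite coords_det; apply: contra M0 => /eqP e.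
by rewrite -(ev0_tr M) e rmorph0.
Qed.

Lemma tr_ideal x : I x -> idadd (@zeroid S) [seq coords k | k <- enum 'I_(n + m) & Z k] (tr x).
Proof.
move=> /(idadd_morph tr) /=; move: (tr x); apply: idadd_min; first exact/idadd_ideal/zeroid_ideal.
  by move=> u ->; apply: ideal0; apply: idadd_ideal; exact: zeroid_ideal.
move=> u /mapP[a /(nthP 0) [i hi <-] ->]; rewrite szfs in hi.
apply: idadd_gen; first exact: zeroid_ideal.
apply/mapP; exists (rshift n (Ordinal hi)).
  by rewrite mem_filter mem_enum (unsplitK (inr (Ordinal hi) : 'I_n + 'I_m)%type).
by rewrite /coords (unsplitK (inr (Ordinal hi) : 'I_n + 'I_m)%type).
Qed.

Lemma ev0_ideal x : idadd (@zeroid S) [seq coords k | k <- enum 'I_(n + m) & Z k] x -> I (ev0 x).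
Proof.
move=> /(idadd_morph ev0) /=; move: (ev0 x); apply: idadd_min; first exact/idadd_ideal/zeroid_ideal.
  by move=> u ->; apply: ideal0; apply: idadd_ideal; exact: zeroid_ideal.
move=> u /mapP[a /mapP[k]]; rewrite mem_filter => /andP[hk _] -> ->; move: hk; rewrite /coords.
case: fintype.splitP => // c _ _ /=; rewrite ev0_tr; apply: idadd_gen; first exact: zeroid_ideal.
by apply: mem_nth; rewrite szfs.
Qed.

Lemma jac_pth_power f : (forall i, I (f^`M(i))) -> exists e g, I (M ^+ (p * e) * f - g ^+ p).
Proof.
move=> hf.
have [|e [g h]] := @coord_pth_power K (n + m) p coords pK coords_det0 Z (tr f).
  move=> l; rewrite tr_deriv; apply: ideal_sum; first exact/idadd_ideal/zeroid_ideal.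
  by move=> i _; apply: idealMr; [exact/idadd_ideal/zeroid_ideal | apply: tr_ideal].
exists e, (ev0 g); have := ev0_ideal h.
by rewrite coords_det rmorphB rmorphM !rmorphXn /= !ev0_tr.
Qed.

Lemma jac_reduced z : I (z ^+ p) -> exists e, I (M ^+ e * z).
Proof.
move=> /tr_ideal; rewrite rmorphXn => /(coord_reduced pK coords_det0) [e /ev0_ideal h].
by exists e; move: h; rewrite coords_det rmorphM rmorphXn /= !ev0_tr.
Qed.

End JacLocal.

(** * Removing denominators, and [star] in every degree *)

Lemma posform_proper (K : fieldType) n (s : seq {mpoly K[n]}) :
  (forall z, z \in s -> posform z) -> ~ idadd (@zeroid _) s 1.
Proof.
move=> hs h1; suff : (1 : {mpoly K[n]})@_0 = 0 by rewrite mcoeff1 eqxx => /eqP; rewrite oner_eq0.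
move: (1 : {mpoly K[n]}) h1; apply: idadd_min.
- split; first by rewrite mcoeff0.
  split=> [x y hx hy|r x hx]; first by rewrite mcoeffD hx hy addr0.
  rewrite mcoeffM big1 // => -[k1 k2] /= /eqP /esym /eqP; rewrite mnmD_eq0 => /andP[_ /eqP ->].
  by rewrite hx mulr0.
- by move=> x ->; rewrite mcoeff0.
move=> z /hs [d d0 hd]; apply: memN_msupp_eq0; apply/negP => hm.
by move: d0; rewrite -(dhomog_mf hd hm : mdeg _ = d) mdeg0.
Qed.

Lemma alg_ideal (K : fieldType) n (S : {mpoly K[n]} -> Prop) (J : {mpoly K[n]} -> Prop) f :
  is_ideal J -> (forall g, S g -> J g) -> alg S f -> exists c, J (f - c%:MP).
Proof.
move=> idJ hS; elim=> {f} [c|f /hS hf|f g _ [c hc] _ [c' hc']|f g _ [c hc] _ [c' hc']].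
- by exists c; rewrite subrr; apply: ideal0.
- by exists 0; rewrite mpolyC0 subr0.
- exists (c + c'); rewrite mpolyCD opprD addrACA; exact: idealD.
exists (c * c'); rewrite mpolyCM.
have -> : f * g - c%:MP * c'%:MP = (f - c%:MP) * g + c%:MP * (g - c'%:MP) by ring.
by apply: idealD => //; [apply: idealMr | apply: idealM].
Qed.

(** A polynomial in generators of positive degree differs from an element of their ideal by a
    constant, which vanishes for a form of positive degree. *)
Lemma form_in_ideal (K : fieldType) n (E : seq (nat * {mpoly K[n]})) D k d f : wf D E ->
  (0 < d)%N -> f \is d.-homog -> alg (gens E k) f -> idadd (@zeroid _) [seq e.2 | e <- E] f.
Proof.
move=> wE d0 hf hal; set I := idadd _ _.
have hI : hid I.
  by apply: hid_idadd; [move=> z /mapP[e /wE [_ _ he] ->]; exists e.1 | exact: hid0].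
have [|c hc] := alg_ideal hI.1 _ hal.
  move=> g [e [he _]]; apply: idadd_gen; first exact: zeroid_ideal.
  by apply/mapP; exists (e, g).
have := hI.2 0%N _ hc; rewrite raddfB /= (pihomog_ne0 _ hf) ?(gtn_eqF d0) // sub0r.
rewrite pihomog_dE; last by rewrite -[c%:MP]mulr1 mul_mpolyC rpredZ // dhomog1.
by move=> h; have := idealB hI.1 hc h; rewrite opprK subrK.
Qed.

Lemma pihomog_pth (K : closedFieldType) n p d (r : {mpoly K[n]}) : p \in [pchar K] -> (p %| d)%N ->
  pihomog mdeg d (r ^+ p) = (pihomog mdeg (d %/ p) r) ^+ p.
Proof.
move=> pK pd; have p0 : (0 < p)%N := prime_gt0 (pcharf_prime pK).
have fr (u v : {mpoly K[n]}) : (u + v) ^+ p = u ^+ p + v ^+ p.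
  by rewrite -!(pFrobenius_autE (pchar_mpoly n pK)) rmorphD.
apply: (mpoly_scale_ind (Q := fun r => pihomog mdeg d (r ^+ p) = (pihomog mdeg (d %/ p) r) ^+ p)).
- by rewrite expr0n (gtn_eqF p0) !raddf0 expr0n (gtn_eqF p0).
- by move=> f g hf hg; rewrite fr !raddfD /= hf hg fr.
- by move=> a f hf; rewrite exprZn !linearZ /= hf exprZn.
move=> k _; rewrite mpolyXn !pihomogX /= mdegMn.
rewrite -{1}(divnK pd) eqn_pmul2r //; case: eqP => _; first by rewrite mpolyXn.
by rewrite expr0n (gtn_eqF p0).
Qed.

(* [f] is the [p]-th power of [g0 / M0 ^+ e0 = g1 / M1 ^+ e1], and regularity of [M0, M1]
   shows that this fraction has no denominator. *)
Lemma glue_pth_power (R : idomainType) (I : R -> Prop) p (M0 M1 f : R) :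
  p \in [pchar R] -> is_ideal I -> reg I [:: M0; M1] ->
  (forall z, I (z ^+ p) -> exists e, I (M0 ^+ e * z)) ->
  (exists e g, I (M0 ^+ (p * e) * f - g ^+ p)) -> (exists e g, I (M1 ^+ (p * e) * f - g ^+ p)) ->
  exists g, I (f - g ^+ p).
Proof.
move=> pR idI hreg red [e0 [g0 h0]] [e1 [g1 h1]].
have frB (u v : R) : (u - v) ^+ p = u ^+ p - v ^+ p.
  by rewrite -!(pFrobenius_autE pR) rmorphB.
have TM (u v : R) : u = 1 -> v = 1 -> u * v = 1 by move=> -> ->; rewrite mulr1.
have nz0 : nzd (fun u => u = 1) I M0 by case: hreg.
have nzX e x : I (M0 ^+ e * x) -> I x.
  have h : nzd (fun u => u = 1) I (M0 ^+ e) := nzdX idI nz0.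
  by have := h x; rewrite !sat1.
(* Multiplying by one more power of [M0] makes the exponent positive, as [regT_exp] requires. *)
have [a h0'] : exists a, I (M0 ^+ (p * e0.+1) * f - a ^+ p).
  by exists (M0 * g0); rewrite mulnS exprD exprMn -mulrA -mulrBr; apply: idealM.
move: (@regT_exp R (fun u => u = 1) erefl TM I M0 [:: M1] e0 idI hreg) => [_ [nz1 _]].
move: e0.+1 h0' nz1 => e h0' nz1 {e0 g0 h0}.
have ht : I ((M1 ^+ e1 * a - M0 ^+ e * g1) ^+ p).
  rewrite frB !exprMn -!exprM [(e1 * p)%N]mulnC [(e * p)%N]mulnC.
  have -> : M1 ^+ (p * e1) * a ^+ p - M0 ^+ (p * e) * g1 ^+ p =
    M0 ^+ (p * e) * (M1 ^+ (p * e1) * f - g1 ^+ p) - M1 ^+ (p * e1) * (M0 ^+ (p * e) * f - a ^+ p) by ring.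
  by apply: idealB => //; apply: idealM.
have [k hk] := red _ ht; have {hk}ht' := nzX _ _ hk.
have ha : isum I (M0 ^+ e) a.
  have h : nzd (fun u => u = 1) (isum I (M0 ^+ e)) (M1 ^+ e1) := nzdX (isum_ideal idI _) nz1.
  have := h a; rewrite !sat1; apply.
  by exists g1; rewrite [g1 * _]mulrC.
have [r hr] := ha; exists r.
apply: (nzX (p * e)%N).
have hp : I ((a - r * M0 ^+ e) ^+ p).
  by rewrite -(prednK (prime_gt0 (pcharf_prime pR))) exprS; apply: idealMr.
have := idealD idI h0' hp; rewrite frB exprMn -exprM [(e * p)%N]mulnC.
by congr I; ring.
Qed.

(* If the degree is invertible in [K], this is Euler's formula.  Otherwise [f] is a [p]-th
   power modulo a strong system [E] generating the given forms, first after inverting a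
   Jacobian minor of [E], then globally because two minors form a regular sequence
   modulo [E]; and a form that is [w ^+ p] modulo [E] is weak. *)
Lemma star_step D : (forall e, (e <= D)%N -> star e) -> star D.+1.
Proof.
move=> hstar s.
have hj t := jacobian_exact hstar t 2.
pose sigma t := proj1_sig (constructive_indefinite_description _ (hj t)).
have hsig t := proj2_sig (constructive_indefinite_description _ (hj t)).
have [s0 [N href]] := refine D sigma 0 s.
(* The summand [s] serves Euler's formula; [N + 1] counts one product for each generator of the
   refined system and one for the [p]-th power. *)
exists (s + (N + 1))%N => K n f _ hf [hs [h1 h2 h3]].
have [d0|d0] := eqVneq (D.+1%:R : K) 0; last first.
  apply: (@weak_le _ _ (size hs)); first exact: leq_trans h1 (leq_addr _ _).
  apply: weak_of_ideal => //; have idI := idadd_ideal [seq h.2 | h <- hs] (zeroid_ideal {mpoly K[n]}).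
  rewrite -[f]scale1r -(mulVf d0) -scalerA -(euler hf) -mul_mpolyC.
  by apply: idealM => //; apply: ideal_sum => // i _; apply: idealM.
have [p pK] : exists p, p \in [pchar K] by apply: natf0_pchar (ltn0Sn D) (introT eqP d0).
have pd : (p %| D.+1)%N by rewrite (dvdn_pcharf pK) d0.
have p_pr := pcharf_prime pK; have p1 := prime_gt1 p_pr; have p0 := prime_gt0 p_pr.
have whs : wf D hs by move=> h /h2 [q1 q2 q3]; split.
have w0 : wf D ([::] : seq (nat * {mpoly K[n]})) by [].
have st0 : strong s0 ([::] : seq (nat * {mpoly K[n]})) by move=> [|c cs].
have [F' [wF sF st hal]] := href K n [::] hs (leqnn _) h1 w0 whs st0.
rewrite add0n cat0s in st hal.
have [W hW] := hsig (size F') K n F' erefl wF st.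
set fs := [seq e.2 | e <- F'] in hW *.
set I := idadd (@zeroid {mpoly K[n]}) fs.
have idI : is_ideal I by apply/idadd_ideal/zeroid_ideal.
have pfs z : z \in fs -> posform z by move=> /mapP[e /wF [q1 q2 q3] ->]; exists e.1.
have hI : hid I by apply: hid_idadd; [move=> z /pfs [e _ he]; exists e | exact: hid0].
have hfI i : I (f^`M(i)).
  move: (f^`M(i)) (h3 i); apply: idadd_min => //; first by move=> x ->; apply: ideal0.
  move=> z /mapP[h hh ->]; have [q1 q2 q3] := h2 _ hh.
  exact: (form_in_ideal wF q1 q3 (hal _ hh)).
pose M b := jacdet (size F') fs (W b).
have hM : reg I [:: M ord0; M ord_max].
  move: hW; rewrite /reg regT_cat => -[_].
  have -> : enum 'I_2 = [:: ord0; ord_max] by apply: (inj_map val_inj); rewrite val_enum_ord.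
  by [].
have szfs : size fs = size F' by rewrite size_map.
have nz0 : M ord0 != 0.
  apply/eqP => e; apply: (posform_proper pfs); have [+ _] := hM; move=> /(_ 1).
  by rewrite !sat1 e mul0r; apply; apply: ideal0.
have [g hg] : exists g, I (f - g ^+ p).
  have [e0 [g0 hg0]] := jac_pth_power pK szfs nz0 hfI.
  (* The local statements need a nonzero minor. If the second minor is zero, its regularity makes
     the first one invertible modulo [I], and the denominator can be removed directly. *)
  have [m1|m1] := eqVneq (M ord_max) 0.
    have [r hr] : isum I (M ord0) 1.
      have [_ [+ _]] := hM; move=> /(_ 1); rewrite !sat1 m1 mul0r; apply.
      by apply: ideal0; exact: isum_ideal.
    have hk k : I (1 - (r * M ord0) ^+ k).
      elim: k => [|k IH]; first by rewrite expr0 subrr; apply: ideal0.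
      have -> : 1 - (r * M ord0) ^+ k.+1 = (1 - (r * M ord0) ^+ k) * (r * M ord0) + (1 - r * M ord0).
        by rewrite exprS; ring.
      by apply: idealD => //; apply: idealMr.
    exists (r ^+ e0 * g0); have -> : f - (r ^+ e0 * g0) ^+ p = (1 - (r * M ord0) ^+ (p * e0)) * f +
        r ^+ (p * e0) * (M ord0 ^+ (p * e0) * f - g0 ^+ p).
      by rewrite !exprMn -exprM [(e0 * p)%N]mulnC; ring.
    by apply: idealD => //; [apply: idealMr | apply: idealM].
  apply: (glue_pth_power (pchar_mpoly n pK) idI hM); last exact: jac_pth_power.
  - exact: (jac_reduced pK szfs nz0).
  - by exists e0, g0.
have h := hI.2 D.+1 _ hg; rewrite raddfB /= (pihomog_dE hf) (pihomog_pth _ pK pd) in h.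
set w := pihomog _ _ _ in h; have hw : w \is (D.+1 %/ p).-homog by apply: pihomogP.
(* Since [p] is at least 2 and divides the degree, [w] and [w ^+ p.-1] have positive degree, so the
   [p]-th power counts as a single product. *)
have q0 : (0 < D.+1 %/ p < D.+1)%N by rewrite divn_gt0 // (dvdn_leq _ pd) //= ltn_Pdiv.
rewrite -[f](subrK (w ^+ p)); apply: (@weak_le _ _ (size F' + 1)%N).
  by apply: leq_trans (leq_addl _ _); rewrite leq_add2r.
apply: weakD.
  apply: weak_of_ideal => //.
  by apply: rpredB => //; rewrite -(divnK pd); exact: dhomogMn.
rewrite -(prednK p0) exprS; apply: (weakM q0) => //.
rewrite (_ : (D.+1 - D.+1 %/ p)%N = (D.+1 %/ p * p.-1)%N); first exact: dhomogMn.
by rewrite -{1}(divnK pd) -{2}[(D.+1 %/ p)%N]muln1 -mulnBr subn1.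
Qed.

Theorem star_all d : star d.
Proof.
elim/ltn_ind: d => -[_ s|d IH]; first by exists 0%N.
by apply: star_step => e he; apply: IH.
Qed.

(** * From Jacobian minors to Serre's condition *)

Lemma lcombE (R : comNzRingType) (cs fs : seq R) : size cs = size fs ->
  lcomb cs fs = \sum_(j < size fs) cs`_j * fs`_j.
Proof.
move=> h; rewrite /lcomb (big_nth (0, 0)) size_zip h minnn big_mkord; apply: eq_bigr => j _.
by rewrite nth_zip.
Qed.

(** Derivations map the square of [P] into [P]. Differentiating a relation modulo that square gives
    a linear system for the coefficients modulo [P]; multiplying by the adjugate shows that the
    determinant times each coefficient lies in [P]. *)
Lemma jacobian_indep (R : comNzRingType) (P : R -> Prop) (fs : seq R) m (del : nat -> R -> R) :
  is_prime P -> size fs = m -> (forall f, f \in fs -> P f) ->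
  (forall a g h, del a (g + h) = del a g + del a h) ->
  (forall a g h, del a (g * h) = del a g * h + g * del a h) ->
  ~ P (\det (\matrix_(j < m, a < m) del a fs`_j)) -> indep_mod_sq P fs.
Proof.
move=> [idP [_ prP]] szf hf hD hM; set A := \matrix_(j, a) _ => hdet cs szc [ps [hps e]] c hc.
have del0 a : del a 0 = 0 by apply: (addrI (del a 0)); rewrite -hD !addr0.
have dsum a (J : Type) (r : seq J) (F : J -> R) : del a (\sum_(j <- r) F j) = \sum_(j <- r) del a (F j).
  by elim: r => [|j r IH]; rewrite ?big_nil ?del0 // !big_cons hD IH.
have hA a : P (\sum_(j < m) cs`_j * del a fs`_j).
  have h1 : P (del a (lcomb cs fs)).
    rewrite e dsum big_seq; apply: ideal_sum => // p /hps [p1 p2].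
    by rewrite hM; apply: idealD => //; [apply: idealM | apply: idealMr].
  move: h1; rewrite (lcombE szc) szf dsum (eq_bigr (fun j : 'I_m => del a cs`_j * fs`_j + cs`_j * del a fs`_j)).
    rewrite big_split /= => /(idealDl idP); apply; apply: ideal_sum => // j _; apply: idealM => //.
    by apply: hf; apply: mem_nth; rewrite szf.
  by move=> j _; rewrite hM.
pose C : 'rV[R]_m := \row_j cs`_j.
have hk k : P (\det A * cs`_(nat_of_ord (k : 'I_m))).
  have := congr1 (fun X : 'rV[R]_m => X 0 k) (esym (mulmxA C A (\adj A))).
  rewrite mul_mx_adj mul_mx_scalar [RHS]mxE [X in _ = _ * X]mxE => <-.
  rewrite mxE; apply: ideal_sum => // a _; apply: idealMr => //.
  rewrite mxE; have := hA a; congr P; apply: eq_bigr => j _; by rewrite !mxE.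
have lt : (index c cs < m)%N by rewrite -szf -szc index_mem.
have := hk (Ordinal lt); rewrite /= nth_index // => /prP; by case.
Qed.

Lemma iter_of_reg (K : closedFieldType) n (s : seq {mpoly K[n]}) : reg (@zeroid _) s ->
  reg (@zeroid _) (map (@iter_of K n) s).
Proof.
move=> hs; apply/(@regT_preim _ _ (@iter_of K n) (fun u => u = 1)).
- exact: zeroid_ideal.
- by move=> y; exists (multi_of K n y); exact: multi_ofK.
- by move=> u ->; rewrite rmorph1.
- by move=> u ->; exists 1; rewrite rmorph1.
move: hs; congr (regT _ _ _); apply: predext => x; split=> [->|h]; first exact: rmorph0.
by rewrite -(iter_ofK x) h rmorph0.
Qed.

(** Combinations of combinations are again homogeneous combinations of [E], so independent ones
    inherit its strength. The bound [m <= size E] ensures that the thresholds chosen for the size of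
    [E] serve them too. *)
Lemma strong_comb (K : fieldType) n D s (E : seq (nat * {mpoly K[n]})) m (k : 'I_m -> nat)
    (f : 'I_m -> {mpoly K[n]}) : wf D E -> strong s E -> (forall i, f i \is (k i).-homog) ->
  (forall i, exists C : 'I_(size E) -> K, f i = \sum_j C j *: (nth (0%N, 0) E j).2) ->
  (forall c : 'I_m -> K, \sum_i c i *: f i = 0 -> forall i, c i = 0) ->
  [/\ wf D [seq (k i, f i) | i <- enum 'I_m], strong s [seq (k i, f i) | i <- enum 'I_m] &
      (m <= size E)%N].
Proof.
move=> wE sE hf hC ind.
have hC' i : exists C : 'I_(size E) -> K, f i = \sum_j C j *: (nth (0%N, 0) E j).2 /\
    forall j, C j != 0 -> (nth (0%N, 0) E j).1 = k i.
  have [C eC] := hC i.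
  exists (fun j : 'I_(size E) => if (nth (0%N, 0) E j).1 == k i then C j else 0); split=> [|j]; last first.
    by case: ifP => [/eqP //|_]; rewrite eqxx.
  rewrite -[LHS](pihomog_dE (hf i)) eC raddf_sum; apply: eq_bigr => j _ /=; rewrite linearZ /=.
  have [_ _ hj] := wE _ (mem_nth (0%N, 0) (ltn_ord j)).
  case: eqP => [e|/eqP ne]; first by rewrite pihomog_dE // -e.
  by rewrite (pihomog_ne0 ne hj) scaler0 scale0r.
pose C i := proj1_sig (constructive_indefinite_description _ (hC' i)).
have CP i : f i = \sum_j C i j *: (nth (0%N, 0) E j).2 /\
    forall j, C i j != 0 -> (nth (0%N, 0) E j).1 = k i.
  by rewrite /C; case: constructive_indefinite_description.
have comb (c : 'I_m -> K) : \sum_i c i *: f i =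
    \sum_j (\sum_i c i * C i j) *: (nth (0%N, 0) E j).2.
  rewrite (eq_bigr (fun i => \sum_j (c i * C i j) *: (nth (0%N, 0) E j).2)) => [|i _].
    by rewrite exchange_big; apply: eq_bigr => j _; rewrite scaler_suml.
  by rewrite (CP i).1 scaler_sumr; apply: eq_bigr => j _; rewrite scalerA.
split.
- move=> _ /mapP[i _ ->] /=.
  have [j hj] : exists j, C i j != 0.
    apply: NNPP => hno; have e0 : f i = 0.
      rewrite (CP i).1 big1 // => j _; have [->|h] := eqVneq (C i j) 0; first exact: scale0r.
      by case: hno; exists j.
    have e1 : \sum_i' (if i' == i then 1 else 0) *: f i' = 0.
      by rewrite big1 // => i' _; case: eqP => [->|_]; rewrite ?e0 ?scaler0 ?scale0r.
    by have := ind _ e1 i; rewrite eqxx => /eqP; rewrite oner_eq0.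
  have [h1 h2 _] := wE _ (mem_nth (0%N, 0) (ltn_ord j)).
  by have e := (CP i).2 j hj; rewrite e in h1 h2; split.
- move=> c d; rewrite size_map -cardE => /(seq_enum 0) [c' ->] /degs_enum hd.
  rewrite lc_enum /= comb => hw _ /mapP[i _ ->]; apply: ind; rewrite comb big1 // => j _.
  rewrite (strong_ord sE _ hw) ?scale0r // => j' hj'.
  apply: NNPP => hne; case/eqP: hj'; rewrite big1 // => i' _.
  have [->|h1] := eqVneq (c' i') 0; first by rewrite mul0r.
  have [->|h2] := eqVneq (C i' j') 0; first by rewrite mulr0.
  by case: hne; rewrite ((CP i').2 _ h2); apply: (hd i').
pose A : 'M[K]_(m, size E) := \matrix_(i, j) C i j.
have fr : row_free A.
  apply: inj_row_free => v hv; apply/rowP => i; rewrite [RHS]mxE; apply: (ind (fun i => v 0 i)).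
  rewrite comb big1 // => j _; have := congr1 (fun X : 'rV[K]__ => X 0 j) hv; rewrite !mxE => e.
  rewrite (_ : \sum_i _ = 0) ?scale0r // -[RHS]e; apply: eq_bigr => i' _; by rewrite mxE.
by rewrite -(eqP fr) rank_leq_col.
Qed.

Lemma main_bound eta D r : exists N, forall (K : closedFieldType) n (F : seq (nat * {mpoly K[n]})),
  (size F <= r)%N -> wf D F -> exists G : seq (nat * {mpoly K[n]}),
  [/\ wf D G, (size G <= N)%N, reg (@zeroid _) [seq e.2 | e <- G],
      forall f, f \in F -> alg (gens G f.1) f.2 &
      forall m (k : 'I_m -> nat) (f : 'I_m -> {mpoly K[n]}), (forall i, f i \is (k i).-homog) ->
        (forall i, exists C : 'I_(size G) -> K, f i = \sum_j C j *: (nth (0%N, 0) G j).2) ->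
        (forall c : 'I_m -> K, \sum_i c i *: f i = 0 -> forall i, c i = 0) ->
        (forall i, (0 < k i)%N) /\ exists W : 'I_eta.+1 -> nat -> 'I_n -> K,
        reg (@zeroid _) ([seq f i | i <- enum 'I_m] ++
          [seq jacdet m [seq f i | i <- enum 'I_m] (W b) | b <- enum 'I_eta.+1])].
Proof.
have hstar e : (e <= D)%N -> star e by move=> _; exact: star_all.
have hsig t : exists s, forall (K : closedFieldType) n (E : seq (nat * {mpoly K[n]})),
    (size E <= t)%N -> wf D E -> strong s E -> reg (@zeroid _) [seq e.2 | e <- E] /\
    exists W : 'I_eta.+1 -> nat -> 'I_n -> K, reg (@zeroid _) ([seq e.2 | e <- E] ++
      [seq jacdet (size E) [seq e.2 | e <- E] (W b) | b <- enum 'I_eta.+1]).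
  have [||s [_ h]] := @fin_uniform _ (fun (k : 'I_t.+1) s _ =>
    forall (K : closedFieldType) n (E : seq (nat * {mpoly K[n]})),
    size E = k -> wf D E -> strong s E -> 
    exists W : 'I_eta.+1 -> nat -> 'I_n -> K, reg (@zeroid _) ([seq e.2 | e <- E] ++
      [seq jacdet k [seq e.2 | e <- E] (W b) | b <- enum 'I_eta.+1])).
  - by move=> k s s' _ _ hs _ h K n E h1 h2 h3; apply: (h K n E) => //; apply: strong_le h3.
  - by move=> k; have [s h] := jacobian_exact hstar k eta.+1; exists s, 0%N.
  have [s' h'] := strong_reg t hstar.
  exists (s + s')%N => K n E h1 h2 h3; split.
    by apply: h' => //; apply: strong_le h3; exact: leq_addl.
  apply: (h (Ordinal (h1 : (size E < t.+1)%N))) => //; apply: strong_le h3; exact: leq_addr.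
pose sigma t := proj1_sig (constructive_indefinite_description _ (hsig t)).
have sigP t := proj2_sig (constructive_indefinite_description _ (hsig t)).
have [s0 [N href]] := refine D sigma 0 r.
exists N => K n F hF wF.
have w0 : wf D ([::] : seq (nat * {mpoly K[n]})) by [].
have st0 : strong s0 ([::] : seq (nat * {mpoly K[n]})) by move=> [|c cs].
have [G [wG sG st hal]] := href K n [::] F (leqnn _) hF w0 wF st0.
rewrite add0n cat0s in st hal; exists G; split=> //.
  by case: (sigP (size G) K n G (leqnn _) wG st).
move=> m k f hf hC ind.
have [wf' sf' mG] := strong_comb wG st hf hC ind.
split=> [i|].
  by case: (wf' (k i, f i)) => //; apply: (map_f (fun i => (k i, f i))); rewrite mem_enum.
have szm : size [seq (k i, f i) | i <- enum 'I_m] = m by rewrite size_map size_enum_ord.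
have [|_ [W hW]] := sigP (size G) K n _ _ wf' sf'; first by rewrite szm.
by exists W; move: hW; rewrite szm -map_comp.
Qed.

Lemma regular_of_reg (R : comNzRingType) (gs : seq R) : ~ idadd (@zeroid R) gs 1 ->
  reg (@zeroid R) gs -> regular_seq gs.
Proof.
move=> h1 hr; split=> [/in_idealE //|i hi x /in_idealE hx]; apply/in_idealE.
have : reg (@zeroid R) (take i gs ++ drop i gs) by rewrite cat_take_drop.
rewrite /reg regT_cat (drop_nth 0 hi) => -[_ [+ _]].
by move=> /(_ x); rewrite !sat1 mulrC; apply.
Qed.

(** * Regular envelopes *)

Section Transfer.
Variables (K : closedFieldType) (n : nat).
Local Notation io := (@iter_of K n).
Local Notation mo := (multi_of K n).

Lemma klincombE (cs : seq K) (fs : seq (Defs.mpoly K n)) : size cs = size fs ->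
  klincomb cs fs = lcomb (map (mconst n) cs) fs.
Proof.
move=> h; rewrite lcombE ?size_map // /klincomb; apply: eq_bigr => i _.
by rewrite (nth_map 0) // h.
Qed.

Lemma klinindep_take k (fs : seq (Defs.mpoly K n)) : klinindep fs -> klinindep (take k fs).
Proof.
move=> h cs hcs e i hi.
have sz : size (cs ++ nseq (size (drop k fs)) 0) = size fs.
  by rewrite size_cat size_nseq hcs -size_cat cat_take_drop.
have e' : klincomb (cs ++ nseq (size (drop k fs)) 0) fs = 0.
  rewrite klincombE // map_cat map_nseq rmorph0 -[X in lcomb _ X](cat_take_drop k fs).
  by rewrite lcomb_cat ?size_map // lcomb0 addr0 -klincombE.
have := h _ sz e' i; rewrite nth_cat hcs hi; apply.
by apply: leq_trans hi _; rewrite -{2}(cat_take_drop k fs) size_cat leq_addr.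
Qed.

Lemma multi_klincomb (cs : seq K) (fs : seq (Defs.mpoly K n)) :
  mo (klincomb cs fs) = \sum_(i < size fs) cs`_i *: mo fs`_i.
Proof.
rewrite /klincomb rmorph_sum; apply: eq_bigr => i _.
by rewrite rmorphM /= multi_ofC mul_mpolyC.
Qed.

Lemma klinindep_multi (fs : seq (Defs.mpoly K n)) : klinindep fs ->
  forall c : 'I_(size fs) -> K, \sum_i c i *: mo fs`_i = 0 -> forall i, c i = 0.
Proof.
move=> h c e i; pose cs := [seq c i | i <- enum 'I_(size fs)].
have sz : size cs = size fs by rewrite size_map size_enum_ord.
have csE (j : 'I_(size fs)) : cs`_j = c j.
  by rewrite (nth_map j) ?size_enum_ord // nth_ord_enum.
rewrite -csE; apply: h => //; apply: (can_inj (@multi_ofK K n)); rewrite rmorph0 -[RHS]e.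
by rewrite multi_klincomb; apply: eq_bigr => j _; rewrite csE.
Qed.

Lemma alg_kalg (G : seq (nat * {mpoly K[n]})) d f : alg (gens G d) f ->
  in_kalg [seq io e.2 | e <- G] (io f).
Proof.
elim=> {f} [c|f [e [he _]]|f g _ hf _ hg|f g _ hf _ hg].
- by rewrite iter_ofC; apply: kalg_const.
- by apply: kalg_gen; apply/mapP; exists (e, f).
- by rewrite rmorphD; apply: kalg_add.
by rewrite rmorphM; apply: kalg_mul.
Qed.

Lemma proper_posform (fs : seq (Defs.mpoly K n)) : (forall f, f \in fs -> posform (mo f)) ->
  ~ in_ideal fs 1.
Proof.
move=> h /in_idealE /(idadd_morph mo); rewrite rmorph1; apply: posform_proper.
by move=> z /mapP[f /h hf ->].
Qed.

Lemma jacdet_indep m (fs : seq (Defs.mpoly K n)) P w : size fs = m -> is_prime P ->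
  (forall f, f \in fs -> P f) -> ~ P (io (jacdet m (map mo fs) w)) -> indep_mod_sq P fs.
Proof.
move=> szf hP hf hj.
apply: (@jacobian_indep _ P fs m (fun a g => io (dirder (w a) (mo g)))) => //.
- move=> a g h; rewrite -rmorphD; congr io; rewrite rmorphD /dirder -big_split; apply: eq_bigr => i _ /=.
  by rewrite mderivD mulrDr.
- move=> a g h; rewrite -{2}[h](multi_ofK) -{3}[g](multi_ofK) -!rmorphM -rmorphD; congr io.
  rewrite rmorphM /dirder mulr_suml mulr_sumr -big_split; apply: eq_bigr => i _ /=.
  by rewrite mderivM; ring.
move: hj; rewrite /jacdet -det_map_mx; congr (~ P (\det _)); apply/matrixP => j a; rewrite !mxE.
by rewrite (nth_map 0) // szf.
Qed.
End Transfer.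

Lemma regular_envelope eta D r : exists N, forall (K : closedFieldType) n (F : seq (nat * {mpoly K[n]})),
  (size F <= r)%N -> wf D F -> exists gs : seq (Defs.mpoly K n),
  [/\ forall g, g \in gs -> exists e, (e <= D)%N /\ mhomog e g, regular_seq gs, (size gs <= N)%N,
      forall f, f \in F -> in_kalg gs (iter_of f.2) &
      forall fs : seq (Defs.mpoly K n), (forall f, f \in fs ->
         (exists cs : seq K, size cs = size gs /\ f = klincomb cs gs) /\ (exists k, mhomog k f)) ->
       klinindep fs -> Reta_seq eta fs].
Proof.
have [N hN] := main_bound eta D r; exists N => K n F hF wF.
have [G [wG sG rG aG jG]] := hN K n F hF wF.
exists [seq iter_of e.2 | e <- G]; rewrite size_map; split=> //.
- move=> _ /mapP[e /wG [h1 h2 h3] ->]; exists e.1; split=> //.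
  by rewrite homog_multi_of iter_ofK.
- apply: regular_of_reg; last by rewrite (map_comp (@iter_of K n) snd); apply: iter_of_reg.
  move/in_idealE; apply: proper_posform => _ /mapP[e /wG [h1 h2 h3] ->].
  by rewrite iter_ofK; exists e.1.
- move=> f /aG; exact: alg_kalg.
move=> fs hfs ifs.
have key ts : (forall f, f \in ts -> f \in fs) -> klinindep ts ->
    ~ in_ideal ts 1 /\ serre_R eta (in_ideal ts).
  move=> sub its; pose m := size ts.
  have hts (i : 'I_m) : ts`_i \in ts by apply: mem_nth.
  pose f (i : 'I_m) := multi_of K n ts`_i.
  have hk i : exists k, f i \is k.-homog.
    by have [_ [k hk]] := hfs _ (sub _ (hts i)); exists k; rewrite -homog_multi_of.
  pose k i := proj1_sig (constructive_indefinite_description _ (hk i)).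
  have kP i : f i \is (k i).-homog by rewrite /k; case: constructive_indefinite_description.
  have hC i : exists C : 'I_(size G) -> K, f i = \sum_j C j *: (nth (0%N, 0) G j).2.
    have [[cs [scs e]] _] := hfs _ (sub _ (hts i)); exists (fun j => cs`_j).
    rewrite /f e multi_klincomb size_map; apply: eq_bigr => j _.
    by rewrite (nth_map (0%N, 0)) // iter_ofK.
  have [k0 [W hW]] := jG m k f kP hC (klinindep_multi its).
  have ets : [seq f i | i <- enum 'I_m] = map (multi_of K n) ts.
    apply: (@eq_from_nth _ 0); first by rewrite size_map size_enum_ord size_map.
    move=> i; rewrite size_map size_enum_ord => hi.
    by rewrite (nth_map (Ordinal hi)) ?size_enum_ord // (nth_map 0) // /f nth_enum_ord.
  split.
    apply: proper_posform => x xts; pose i := index x ts.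
    have lt : (i < m)%N by rewrite index_mem.
    by exists (k (Ordinal lt)) => //; have := kP (Ordinal lt); rewrite /f /= nth_index.
  rewrite ets in hW.
  apply: (@serre_criterion _ (@noeth_mpoly K n) eta ts
     [seq iter_of (jacdet m (map (multi_of K n) ts) (W b)) | b <- enum 'I_eta.+1]).
  - exact: locally_regular_mpoly.
  - by rewrite size_map size_enum_ord.
  - have := iter_of_reg hW; rewrite map_cat -!map_comp /reg regT_cat => -[_].
    by rewrite (eq_map (g := id)) ?map_id // => x; apply: multi_ofK.
  (* If any Jacobian minor is outside [P], it gives independence. Otherwise all of them lie in [P],
     in particular the [eta.+1] that form the regular sequence. *)
  move=> P hP hPts; case: (classic (exists w, ~ P (iter_of (jacdet m (map (multi_of K n) ts) w)))).
    by move=> [w hw]; right; apply: jacdet_indep hw.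
  by move=> hno; left => _ /mapP[b _ ->]; apply: NNPP => hn; apply: hno; exists (W b).
split; first by case: (key fs).
by move=> k _; case: (key (take k fs)) => //; [move=> f /mem_take | apply: klinindep_take].
Qed.

(** Degrees are read off from the last nonzero entry instead of the length, so that the bound
    ignores trailing zeros. *)
Definition top_degree (delta : seq nat) := (\max_(i < size delta | nth 0%N delta i != 0%N) i.+1)%N.

Lemma top_degree_leP (delta : seq nat) k :
  reflect (forall i, nth 0%N delta i != 0%N -> (i < k)%N) (top_degree delta <= k)%N.
Proof.
apply: (iffP (bigmax_leqP _ _ _)) => [h i hi|h i /h //].
have lt : (i < size delta)%N by rewrite ltnNge; apply: contra hi => /(nth_default 0%N) ->.
exact: (h (Ordinal lt)).
Qed.

Lemma top_degree_mono (delta delta' : seq nat) :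
  (forall i, nth 0%N delta i != 0%N -> nth 0%N delta' i != 0%N) ->
  (top_degree delta <= top_degree delta')%N.
Proof. by move=> h; apply/top_degree_leP => i /h; apply/top_degree_leP. Qed.

Lemma theoremB_bound eta : exists B : seq nat -> nat,
  [/\ ascending B, trailing_zero_invariant B, theoremB_property B None &
      theoremB_property B (Some eta)].
Proof.
pose N D r := proj1_sig (constructive_indefinite_description _ (regular_envelope eta D r)).
have NP D r := proj2_sig (constructive_indefinite_description _ (regular_envelope eta D r)).
(* Nothing is known about monotonicity of [N]; summing over all smaller degree bounds and sizes
   makes the result ascending. *)
pose B delta := (\sum_(D < (top_degree delta).+1) \sum_(r < (sumn delta).+1) N D r)%N.
have Bmono delta delta' : (top_degree delta <= top_degree delta')%N -> (sumn delta <= sumn delta')%N ->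
    (B delta <= B delta')%N.
  move=> h1 h2; rewrite /B.
  rewrite -!(big_mkord xpredT (fun D => \sum_(r < _) N D r)%N).
  rewrite [X in (_ <= X)%N](@big_cat_nat _ _ _ (top_degree delta).+1) //=.
  apply: leq_trans (leq_addr _ _); apply: leq_sum => D _.
  rewrite -!(big_mkord xpredT (fun r => N D r)) [X in (_ <= X)%N](@big_cat_nat _ _ _ (sumn delta).+1) //=.
  exact: leq_addr.
have key (K : closedFieldType) (n : nat) (delta : seq nat) (bas : 'I_(size delta) -> seq (Defs.mpoly K n)) :
    (forall i, size (bas i) = nth 0%N delta i) -> (forall i f, f \in bas i -> mhomog i.+1 f) ->
    exists gs : seq (Defs.mpoly K n),
      [/\ forall g, g \in gs -> exists e, (e <= size delta)%N /\ mhomog e g, regular_seq gs,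
          (size gs <= B delta)%N, forall i f, f \in bas i -> in_kalg gs f &
          forall fs : seq (Defs.mpoly K n), (forall f, f \in fs ->
            (exists cs : seq K, size cs = size gs /\ f = klincomb cs gs) /\ (exists k, mhomog k f)) ->
          klinindep fs -> Reta_seq eta fs].
  move=> hsz hh.
  pose F := flatten [seq [seq (i.+1, multi_of K n f) | f <- bas i] | i : 'I_(size delta) <- enum 'I_(size delta)].
  have sF : (size F <= sumn delta)%N.
    rewrite /F size_flatten /shape -map_comp !sumnE big_map big_enum [X in (_ <= X)%N](big_nth 0%N).
    by rewrite big_mkord leq_sum // => i _ /=; rewrite size_map hsz.
  have wF : wf (top_degree delta) F.
    move=> e /flatten_mapP [i _ /mapP[f hf ->]] /=; split=> //; last by rewrite -homog_multi_of hh.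
    have /top_degree_leP := leqnn (top_degree delta); apply.
    by rewrite -hsz -lt0n; case: (bas i) hf.
  have [gs [g1 g2 g3 g4 g5]] := NP (top_degree delta) (sumn delta) K n F sF wF.
  exists gs; split=> //.
  - move=> g /g1 [e [he hg]]; exists e; split=> //; apply: leq_trans he _; apply/top_degree_leP => i hi.
    by rewrite ltnNge; apply: contra hi => /(nth_default 0%N) ->.
  - by apply: leq_trans g3 _; rewrite /B (bigD1 ord_max) //= (bigD1 ord_max) //= -addnA leq_addr.
  move=> i f hf; rewrite -(multi_ofK f); apply: (g4 (i.+1, multi_of K n f)).
  by apply/flatten_mapP; exists i; rewrite ?mem_enum //; apply: (map_f (fun f => (i.+1, multi_of K n f))).
exists B; split.
- move=> delta i m hi hm; apply: Bmono.
    apply: top_degree_mono => j; rewrite nth_set_nth /=; case: (eqVneq j i) => [->|//].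
    by rewrite -!lt0n => h; apply: leq_trans h hm.
  by rewrite sumn_set_nth_ltn // -addnBA // leq_addr.
- move=> delta; rewrite /B sumn_rcons addn0.
  have nr i : nth 0%N (rcons delta 0%N) i = nth 0%N delta i.
    by rewrite nth_rcons; case: ltngtP => // [/ltnW h|->]; rewrite nth_default.
  have -> // : top_degree (rcons delta 0%N) = top_degree delta.
  by apply/eqP; rewrite eqn_leq; apply/andP; split; apply: top_degree_mono => i; rewrite nr.
- by move=> K n delta bas h1 h2 _; have [gs [g1 g2 g3 g4 _]] := key K n delta bas h1 h2; exists gs.
by move=> K n delta bas h1 h2 _; exact: key.
Qed.

Theorem theoremB :
  (exists B : seq nat -> nat,
     ascending B /\ trailing_zero_invariant B /\ theoremB_property B None) /\
  (forall eta : nat, (1 <= eta)%N ->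
     exists B : seq nat -> nat,
       ascending B /\ trailing_zero_invariant B /\ theoremB_property B (Some eta)).
Proof.
split=> [|eta _]; first by have [B [h1 h2 h3 _]] := theoremB_bound 0; exists B.
by have [B [h1 h2 _ h4]] := theoremB_bound eta; exists B.
Qed.
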